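(* Let $\theta$ be an arithmetic function with $\max(2,n)\le\theta(n)\ll n$. For each positive integer $m$ let $\mathcal{A}_m$ and $c_m$ be as in the context. Let $\mathcal{S}$ be a set of positive integers such that $\mathcal{A}_{m_1}\cap\mathcal{A}_{m_2}=\emptyset$ for all distinct $m_1,m_2\in\mathcal{S}$ and $\sum_{m\in\mathcal{S}} m^{-1}\log^6 m<\infty$. Let $\mathcal{A}=\bigcup_{m\in\mathcal{S}}\mathcal{A}_m$, assume its counting function satisfies $A(x)\ll x/\log x$, and let $C=\sum_{m\in\mathcal{S}}c_m$ (so that $A(x)=Cx/\log x+O(x/\log^2 x)$). Then $$C=\frac{6/\pi^2}{1-e^{-\gamma}}\sum_{m\in\mathcal{S}}\sum_{n\in\mathcal{A}_m}\frac1n\Biggl(\sum_{P^+(m)<p\le\theta(n)}\frac{\log p}{p+1}-\log\Bigl(\frac nm\Bigr)\Biggr)\prod_{p\le\theta(n)}\Bigl(1+\frac1p\Bigr)^{-1},$$ where $\gamma$ is Euler's constant and $p$ runs over primes.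
   Context: $P^+(n)$ denotes the largest prime factor of $n$, with $P^+(1)=1$. For a positive integer $m$ (a ''starter''), $\mathcal{A}_m$ is the set of all integers of the form $mp_1p_2\cdots p_k$ ($k\ge0$) with primes $P^+(m)<p_1<\dots<p_k$ satisfying $p_i\le\theta(mp_1\cdots p_{i-1})$ for all $1\le i\le k$. It is known that its counting function satisfies $A_m(x)=c_m x/\log x+O\big(\log^6(2m)\,x/(m\log^2x)\big)$ for $m\ge1$, $x\ge2$, for some constant $c_m$; this defines $c_m$. *)

(* Defs.v *)
From HB Require Import structures.
From mathcomp Require Import all_boot all_order all_algebra.
From mathcomp Require Import all_classical all_reals all_analysis.

Set Implicit Arguments.
Unset Strict Implicit.
Unset Printing Implicit Defensive.

Import Order.TTheory GRing.Theory Num.Theory.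
Import numFieldNormedType.Exports.

Local Open Scope classical_set_scope.
Local Open Scope ring_scope.

(* [max_pdiv] is the largest prime factor P^+, with [max_pdiv 1 = 1]. The list
   [s] is [:: p_1; ...; p_k]; with 0-based indices, the condition at [i] reads
   p_{i+1} <= theta (m p_1 ... p_i). *)
Definition starter_set (R : realType) (theta : nat -> R) (m : nat) : set nat :=
  [set n | exists s : seq nat,
     [/\ all prime s,
         path ltn (max_pdiv m) s,
         forall i, (i < size s)%N ->
           (nth 0%N s i)%:R <= theta (m * \prod_(p <- take i s) p)%N
       & n = (m * \prod_(p <- s) p)%N]].

Definition counting_function (R : realType) (A : set nat) (x : R) : R :=
  (\sum_(1 <= n < (Num.truncn x).+1 | n \in A) 1)%N%:R.

(* The implied constant [K] may depend on [theta], but not on [m] or [x];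
   the asymptotics determine [c m] for every [m >= 1]. *)
Definition starter_constants (R : realType) (theta c : nat -> R) : Prop :=
  exists K : R, forall (m : nat) (x : R), (1 <= m)%N -> 2 <= x ->
    `| counting_function (starter_set theta m) x - c m * (x / ln x) |
      <= K * (ln (2 * m)%:R ^+ 6 * x / (m%:R * ln x ^+ 2)).

Definition abs_summable (R : realType) (D : set nat) (f : nat -> R) : Prop :=
  summable D (EFin \o f).

(* Meaningful for families with [abs_summable D f], for which the order of
   summation is immaterial. *)
Definition sum_over (R : realType) (D : set nat) (f : nat -> R) : R :=
  limn (fun N => \sum_(0 <= n < N | n \in D) f n).

Definition euler_gamma (R : realType) : R :=
  limn (fun n : nat => \sum_(1 <= k < n.+1) k%:R^-1 - ln n%:R).

(* For [0 <= y] and [p : nat], [p < (Num.truncn y).+1] means [p%:R <= y]. *)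
Definition starter_term (R : realType) (theta : nat -> R) (m n : nat) : R :=
  n%:R^-1
  * (\sum_(0 <= p < (Num.truncn (theta n)).+1 | prime p && (max_pdiv m < p)%N)
        ln p%:R / (p%:R + 1)
     - ln (n%:R / m%:R))
  * \prod_(0 <= p < (Num.truncn (theta n)).+1 | prime p) (1 + p%:R^-1)^-1.

(* Main.v *)
(* Replace every prime weight [1 / p] by [w p = p ^ -(1 + s)] with [s > 0], and keep
   each prime [p > P^+(m)] independently with probability [w p / (1 + w p)].
   Revealing the primes in increasing order and multiplying [m] by those that are
   kept, until [theta] of the current product [n] is passed, is a stopping rule
   whose final values range over [A_m]; the centred logarithm
   [log (n / m) - sum_p (log p) w p / (1 + w p)] is a martingale, so the weighted
   sum over [A_m] vanishes for every [s > 0].  At [s = 0] it need not vanish: the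
   defect depends only on the density [c_m] of [A_m], so it equals [c_m] times
   the defect of the same sum over the primes, with [theta p = p].  That sum
   telescopes; it tends to [- pi ^ 2 / 6] as [s] tends to [0], whereas its value at
   [s = 0] is [- (pi ^ 2 / 6) * exp (- gamma)] by Mertens' third theorem.  Hence the
   sum over [A_m] is [c_m * (pi ^ 2 / 6) * (1 - exp (- gamma))]. *)
Require Import Defs.
From HB Require Import structures.
From mathcomp Require Import all_boot all_order all_algebra.
From mathcomp Require Import all_classical all_reals all_analysis.
From mathcomp Require Import ring lra zify.

Set Implicit Arguments.
Unset Strict Implicit.
Unset Printing Implicit Defensive.

Import Order.TTheory GRing.Theory Num.Theory.
Import numFieldNormedType.Exports.

Local Open Scope classical_set_scope.
Local Open Scope ring_scope.

(** * Series *)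

Section Series.
Variable R : realType.
Implicit Types (u g h d : nat -> R) (l : R).

(** The hard step is that the defect depends only on [c_m]. A summable majorant uniform in [s] would
    make the sum at [s = 0] vanish, so none exists in general. Each term [T s] is therefore split,
    uniformly in [s], into [n^-1 * F s (trunc_log 2 n)] and an error of order [1 / (n log n)]. The
    errors are summable over [A_m] and over the primes, so they pass to [s = 0] by dominated
    convergence. The smooth parts are treated after subtracting [c_m] times the primes: the block
    sums of the coefficients then form a convergent series, [F s] has variation bounded uniformly in
    [s] and tends to 0 pointwise, and Abel summation removes them. All sums are cut at powers of 2.
    Within a block [n^-s] is comparable to a power of [2^-s], so sums over blocks become geometric
    or logarithmic series, and for the primes Mertens' averages suffice in place of the prime number
    theorem. Euler's constant enters because the same block sums are either damped by [2^-s], which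
    produces [- ln (1 - 2^-s)], or truncated at [2^J], which produces a harmonic number. *)

Lemma nonneg_bounded_series_cvg u (K : R) :
  (forall n, 0 <= u n) -> (forall n, series u n <= K) -> cvgn (series u).
Proof.
move=> u0 uK; apply: nondecreasing_is_cvgn.
  by apply/nondecreasing_seqP => n; rewrite seriesSr lerDl.
by exists K => _ [n _ <-].
Qed.

Lemma dominated_series_cvg u g :
  (forall n, `|u n| <= g n) -> cvgn (series g) -> cvgn (series u).
Proof.
move=> ug cg; apply: normed_cvg; apply: series_le_cvg cg => //.
- by move=> n; rewrite normr_ge0.
- by move=> n; apply: le_trans (ug n).
Qed.

Lemma series_le_lim u l n :
  (forall n, 0 <= u n) -> series u @ \oo --> l -> series u n <= l.
Proof.
move=> u0 cu; rewrite -(cvg_lim _ cu)//.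
apply: nondecreasing_cvgn_le; last by apply/cvg_ex; exists l.
by apply/nondecreasing_seqP => k; rewrite seriesSr lerDl.
Qed.

Lemma norm_series_sub u g m n : (forall n, `|u n| <= g n) -> (m <= n)%N ->
  `|series u n - series u m| <= series g n - series g m.
Proof.
move=> ug mn; rewrite !sub_series_geq// (le_trans (ler_norm_sum _ _ _))//.
by apply: ler_sum => i _.
Qed.

Lemma norm_lim_sub_series u g l (G : R) m : (forall n, `|u n| <= g n) ->
  series u @ \oo --> l -> series g @ \oo --> G ->
  `|l - series u m| <= G - series g m.
Proof.
move=> ug cu cg.
have cn : `|series u n - series u m| @[n --> \oo] --> `|l - series u m|.
  by apply: cvg_norm; apply: cvgB => //; exact: cvg_cst.
have g0 n : 0 <= g n by exact: le_trans (ug n).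
rewrite -(cvg_lim _ cn)//; apply: limr_le; first by apply/cvg_ex; eexists; exact: cn.
near=> n; apply: le_trans (norm_series_sub ug _) _; first by near: n; exact: nbhs_infty_ge.
by rewrite lerB// series_le_lim.
Unshelve. all: by end_near. Qed.

Lemma cvg_finite_sum (f : nat -> nat -> R) h (m n : nat) (P : pred nat) :
  (forall k, (m <= k < n)%N -> P k -> f i k @[i --> \oo] --> h k) ->
  (\sum_(m <= k < n | P k) f i k) @[i --> \oo] --> \sum_(m <= k < n | P k) h k.
Proof.
elim: n => [|n IH] fh.
  rewrite big_geq// (_ : (fun _ => _) = fun=> 0); first exact: cvg_cst.
  by apply/funext => i; rewrite big_geq.
have [mn|mn] := leqP m n; last first.
  rewrite big_geq// (_ : (fun _ => _) = fun=> 0); first exact: cvg_cst.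
  by apply/funext => i; rewrite big_geq.
have {}IH : (\sum_(m <= k < n | P k) f i k) @[i --> \oo] -->
    \sum_(m <= k < n | P k) h k.
  by apply: IH => k /andP[mk kn]; apply: fh; rewrite mk ltnW.
rewrite big_mkcond big_nat_recr//= -big_mkcond/=.
rewrite (_ : (fun _ => _) = fun i => \sum_(m <= k < n | P k) f i k +
  (if P n then f i n else 0)).
  apply: cvgD => //.
  by case: ifPn => // Pn; [apply: fh => //; rewrite mn/= | exact: cvg_cst].
by apply/funext => i; rewrite big_mkcond big_nat_recr//= -big_mkcond.
Qed.

(** Dominated convergence for series. The sums [l i] are given by a convergence hypothesis, so
    closed forms such as 0 can be inserted, and the common limit is then identified from either
    side. *)
Lemma tannery (f : nat -> nat -> R) g h (l : nat -> R) :
  (forall i n, `|f i n| <= g n) -> cvgn (series g) ->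
  (forall n, f i n @[i --> \oo] --> h n) ->
  (forall i, series (f i) @ \oo --> l i) ->
  exists2 L : R, series h @ \oo --> L & l @ \oo --> L.
Proof.
move=> fg cg fh fl.
have hg n : `|h n| <= g n.
  have cn : `|f i n| @[i --> \oo] --> `|h n| by exact: cvg_norm (fh n).
  rewrite -(cvg_lim _ cn)//; apply: limr_le; first by apply/cvg_ex; eexists; exact: cn.
  by apply: nearW.
have ch := dominated_series_cvg hg cg.
exists (limn (series h)) => //.
apply/cvgrPdist_lt => e e0.
move/cvgrPdist_lt : (cg) => /(_ (e / 3)); rewrite divr_gt0// => /(_ isT) [M _] HM.
have hM := HM M (leqnn M); have {HM}hM : limn (series g) - series g M < e / 3.
  by apply: le_lt_trans hM; rewrite ler_norm.
have cM : series (f i) M @[i --> \oo] --> series h M.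
  exact: cvg_finite_sum.
move/cvgrPdist_lt : cM => /(_ (e / 3)); rewrite divr_gt0// => /(_ isT) cM.
near=> i.
have h1 := norm_lim_sub_series M hg ch cg.
have h2 := norm_lim_sub_series M (fg i) (fl i) cg.
have h3 : `|series h M - series (f i) M| < e / 3 by near: i.
have -> : limn (series h) - l i = (limn (series h) - series h M) +
  (series h M - series (f i) M) - (l i - series (f i) M) by ring.
rewrite (le_lt_trans (ler_normB _ _))// .
have := ler_normD (limn (series h) - series h M) (series h M - series (f i) M).
lra.
Unshelve. all: by end_near. Qed.

(** The partial sums of [d] are centred at an arbitrary [D]: with [D] their limit the boundary term
    vanishes at infinity, with [D = 0] this is Abel's usual identity. *)
Lemma summation_by_parts d (F : nat -> R) (D : R) n :
  series (fun k => d k * F k) n = (series d n - D) * F n + D * F 0%N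
    - series (fun k => (series d k.+1 - D) * (F k.+1 - F k)) n.
Proof.
elim: n => [|n IH]; first by rewrite /series /= !big_geq//; ring.
rewrite (seriesSr (fun k => d k * F k)) IH.
rewrite (seriesSr (fun k => (series d k.+1 - D) * (F k.+1 - F k))).
by rewrite (seriesSr d n); ring.
Qed.

(* Abel's theorem for weights [F i] of uniformly bounded variation. *)
Lemma abel_bounded_variation d (D : R) (F : nat -> nat -> R) (C phi : R)
    (l : nat -> R) :
  series d @ \oo --> D ->
  (forall i n, \sum_(0 <= k < n) `|F i k.+1 - F i k| <= C) ->
  (forall k, F i k @[i --> \oo] --> phi) ->
  (forall i, series (fun k => d k * F i k) @ \oo --> l i) ->
  l @ \oo --> D * phi.
Proof.
move=> dD FC Fphi Fl.
pose S k := series d k - D.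
have S0 : S @ \oo --> 0 by rewrite -(subrr D); apply: cvgB => //; exact: cvg_cst.
have C0 : 0 <= C by have := FC 0%N 0%N; rewrite big_geq.
pose q i n := series (fun k => S k.+1 * (F i k.+1 - F i k)) n.
have Fb i n : `|F i n| <= `|F i 0%N| + C.
  have -> : F i n = F i 0%N + \sum_(0 <= k < n) (F i k.+1 - F i k).
    by rewrite telescope_sumr// addrC subrK.
  apply: (le_trans (ler_normD _ _)); rewrite lerD2l (le_trans (ler_norm_sum _ _ _))//.
(* By parts [q i] tends to [D * F i 0 - l i], so it suffices that this limit vanishes as [i] grows.
   Terms below a fixed [M] tend to 0; those beyond [M] are small by the choice of [M] and the
   variation bound. *)
have ql i : q i @ \oo --> D * F i 0%N - l i.
  have -> : q i = (fun n => S n * F i n + D * F i 0%N - series (fun k => d k * F i k) n).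
    by apply/funext => n; rewrite (summation_by_parts d (F i) D) /q /S; ring.
  apply: cvgB (Fl i); rewrite -[X in _ --> X]add0r; apply: cvgD; last exact: cvg_cst.
  apply/cvgr0Pnorm_le => e e0.
  have K0 : 0 < `|F i 0%N| + C + 1 by rewrite ltr_wpDl// addr_ge0.
  move/cvgr0Pnorm_le : S0 => /(_ (e / (`|F i 0%N| + C + 1))).
  rewrite divr_gt0// => /(_ isT); apply: filterS => n Sn.
  rewrite normrM -[leRHS](@divfK _ (`|F i 0%N| + C + 1)) ?gt_eqF//.
  by apply: ler_pM => //; rewrite (le_trans (Fb i n))// lerDl.
have -> : D * phi = D * phi - 0 by rewrite subr0.
have -> : l = (fun i => D * F i 0%N - (D * F i 0%N - l i)).
  by apply/funext => i; ring.
apply: cvgB; first by apply: cvgM; [exact: cvg_cst | exact: Fphi].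
apply/cvgr0Pnorm_le => e e0.
have C1 : 0 < C + 1 by rewrite ltr_wpDl.
move/cvgr0Pnorm_le : S0 => /(_ (e / 2 / (C + 1))).
rewrite !divr_gt0// => /(_ isT) [M _ HM].
have cM : q i M @[i --> \oo] --> \sum_(0 <= k < M) (S k.+1 * (phi - phi)).
  apply: cvg_finite_sum => k _ _; apply: cvgM; first exact: cvg_cst.
  by apply: cvgB; exact: Fphi.
move: cM; rewrite big1; last by move=> k _; rewrite subrr mulr0.
move/cvgr0Pnorm_le => /(_ (e / 2)); rewrite divr_gt0// => /(_ isT) cM.
near=> i.
have h1 : `|q i M| <= e / 2 by near: i.
have cn : `|q i n| @[n --> \oo] --> `|D * F i 0%N - l i| by exact: cvg_norm (ql i).
rewrite -(cvg_lim _ cn)//; apply: limr_le; first by apply/cvg_ex; eexists; exact: cn.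
near=> n.
have Mn : (M <= n)%N by near: n; exact: nbhs_infty_ge.
have -> : q i n = q i M + (q i n - q i M) by ring.
apply: (le_trans (ler_normD _ _)); rewrite [leRHS](splitr e) lerD//.
rewrite /q sub_series_geq// (le_trans (ler_norm_sum _ _ _))//.
apply: (@le_trans _ _ (e / 2 / (C + 1) * \sum_(M <= k < n) `|F i k.+1 - F i k|)).
  rewrite mulr_sumr big_nat_cond [leRHS]big_nat_cond; apply: ler_sum => k.
  rewrite andbT => /andP[Mk _]; rewrite normrM ler_wpM2r//.
  by apply: HM => /=; rewrite ltnW.
have : \sum_(M <= k < n) `|F i k.+1 - F i k| <= C.
  apply: le_trans (FC i n); rewrite (@big_cat_nat _ _ _ M 0%N n)//= lerDr.
  by apply: sumr_ge0.
move=> VC; apply: (@le_trans _ _ (e / 2 / (C + 1) * C)).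
  by rewrite ler_wpM2l// !divr_ge0// ltW.
rewrite mulrAC ler_pdivrMr// ler_wpM2l ?lerDl//.
by rewrite divr_ge0// ltW.
Unshelve. all: by end_near. Qed.

End Series.

Section Abel.
Variable R : realType.
Implicit Types (d F : nat -> R).

(** The boundary weight [F n] and the total variation [F 0 - F n] of a decreasing weight add up to
    [F 0]. *)
Lemma norm_abel_le d F (C : R) n : (forall k, `|series d k| <= C) ->
  (forall k, F k.+1 <= F k) -> (forall k, 0 <= F k) ->
  `|series (fun k => d k * F k) n| <= C * F 0%N.
Proof.
move=> dC Fd F0; rewrite (summation_by_parts d F 0) mul0r addr0 subr0.
have -> : C * F 0%N = C * F n + C * (F 0%N - F n) by ring.
apply: (le_trans (ler_normB _ _)); rewrite lerD//.
  by rewrite normrM (ger0_norm (F0 n)) ler_wpM2r.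
have -> : F 0%N - F n = \sum_(0 <= k < n) (F k - F k.+1).
  by rewrite -opprB -(telescope_sumr F (leq0n n)) -sumrN; apply: eq_bigr => k _; rewrite opprB.
rewrite /series /= (le_trans (ler_norm_sum _ _ _))// mulr_sumr; apply: ler_sum => k _.
rewrite subr0 normrM distrC [`|F k - _|]ger0_norm ?subr_ge0//.
by apply: ler_wpM2r; [rewrite subr_ge0|exact: dC].
Qed.

Lemma dirichlet_test d F (C : R) : (forall k, `|series d k| <= C) ->
  (forall k, F k.+1 <= F k) -> F @ \oo --> 0 ->
  cvgn (series (fun k => d k * F k)).
Proof.
move=> dC Fd F0.
have Fge k : 0 <= F k.
  have cF : cvgn F by apply/cvg_ex; exists 0.
  rewrite -(cvg_lim (@Rhausdorff R) F0); apply: nonincreasing_cvgn_ge => //.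
  by apply/nonincreasing_seqP.
have C0 : 0 <= C by apply: le_trans (dC 0%N).
have -> : series (fun k => d k * F k) = (fun n => series d n * F n -
    series (fun k => series d k.+1 * (F k.+1 - F k)) n).
  apply/funext => n; rewrite (summation_by_parts d F 0) mul0r addr0 subr0.
  by congr (_ - _); apply: eq_bigr => k _; rewrite subr0.
apply: is_cvgB.
  apply/cvg_ex; exists 0; apply/cvgr0Pnorm_le => e e0.
  have C1 : 0 < C + 1 by rewrite ltr_wpDl.
  move/cvgr0Pnorm_le : F0 => /(_ (e / (C + 1))).
  rewrite divr_gt0// => /(_ isT); apply: filterS => n Fn.
  rewrite normrM mulrC -[leRHS](@divfK _ (C + 1)) ?gt_eqF//.
  by apply: ler_pM => //; rewrite (le_trans (dC n))// lerDl.
apply: (@dominated_series_cvg _ _ (fun k => C * (F k - F k.+1))).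
  move=> k; rewrite normrM distrC [`|F k - _|]ger0_norm ?subr_ge0//.
  by apply: ler_wpM2r; [rewrite subr_ge0|exact: dC].
apply: (@nonneg_bounded_series_cvg _ _ (C * F 0%N)).
  by move=> k; rewrite mulr_ge0// subr_ge0.
move=> n; rewrite /series /= -mulr_sumr ler_wpM2l//.
have -> : \sum_(0 <= k < n) (F k - F k.+1) = F 0%N - F n.
  by rewrite -opprB -(telescope_sumr F (leq0n n)) -sumrN; apply: eq_bigr => k _; rewrite opprB.
by rewrite lerBlDr lerDl.
Qed.

End Abel.

(** * Chebyshev and Mertens estimates *)

Lemma big_dyadic (V : zmodType) (f : nat -> V) (P : pred nat) J :
  \sum_(1 <= n < (2 ^ J)%N | P n) f n =
  \sum_(0 <= j < J) \sum_((2 ^ j)%N <= n < (2 ^ j.+1)%N | P n) f n.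
Proof.
elim: J => [|J IH]; first by rewrite expn0 !big_geq.
rewrite big_nat_recr//= -IH (@big_cat_nat _ _ _ (2 ^ J)%N)//= ?expn_gt0//.
by rewrite leq_exp2l.
Qed.

Lemma series_dyadic (R : realType) (f : nat -> R) J : f 0%N = 0 ->
  series f (2 ^ J)%N = series (fun j => \sum_((2 ^ j)%N <= n < (2 ^ j.+1)%N) f n) J.
Proof.
move=> f0; rewrite /series /= -big_dyadic (@big_cat_nat _ _ _ 1%N)//= ?expn_gt0//.
by rewrite big_nat1 f0 add0r.
Qed.

Lemma prod_prime_dvd N a b :
  (forall p, (a <= p < b)%N -> prime p -> (p %| N)%N) ->
  (\prod_(a <= p < b | prime p) p %| N)%N.
Proof.
elim: b => [|b IH] H; first by rewrite big_geq.
have [ab|ab] := leqP a b; last by rewrite big_geq.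
rewrite big_mkcond big_nat_recr//= -big_mkcond/=.
have {}IH : (\prod_(a <= p < b | prime p) p %| N)%N.
  by apply: IH => p /andP[ap pb]; apply: H; rewrite ap ltnW.
case: ifPn => pb; last by rewrite muln1.
rewrite Gauss_dvd ?IH ?H ?ab//=.
rewrite coprime_sym big_nat_cond; elim/big_ind: _ => [|x y|p /andP[/andP[_ pltb] pp]].
- exact: coprimen1.
- by rewrite coprimeMr => -> ->.
- by rewrite prime_coprime// dvdn_prime2// gtn_eqF.
Qed.

Lemma bin_le_expn n m : ('C(n, m) <= 2 ^ n)%N.
Proof.
elim: n m => [|n IH] [|m] //; first by rewrite bin0 expn_gt0.
by rewrite binS expnS mul2n -addnn leq_add.
Qed.

Lemma prime_dvd_fact p n : prime p -> (p %| n`!)%N -> (p <= n)%N.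
Proof.
move=> pp; elim: n => [|n IH]; first by rewrite fact0 dvdn1 => /eqP p1; rewrite p1 in pp.
rewrite factS Euclid_dvdM// => /orP[/dvdn_leq->//|/IH]; exact: leqW.
Qed.

Section Chebyshev.
Variable R : realType.

Lemma sum_ln_prime a b :
  \sum_(a <= p < b | prime p) ln p%:R = ln (\prod_(a <= p < b | prime p) p)%:R :> R.
Proof.
elim: b => [|b IH]; first by rewrite !big_geq// ln1.
have [ab|ab] := leqP a b; last by rewrite !big_geq// ln1.
rewrite big_mkcond big_nat_recr//= -big_mkcond/= IH.
rewrite [in RHS]big_mkcond big_nat_recr//= -big_mkcond/=.
case: ifPn => pb; last by rewrite addr0 muln1.
rewrite natrM lnM ?posrE ?ltr0n//; last exact: prime_gt0.
by apply: prodn_cond_gt0 => p /prime_gt0.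
Qed.

(** A prime in [(n, 2n]] divides [(2n)!] but not [n!], hence divides the central binomial
    coefficient, which is at most [2^(2n)]. *)
Lemma sum_ln_prime_double n :
  \sum_(n.+1 <= p < n.*2.+1 | prime p) ln p%:R <= n.*2%:R * ln 2 :> R.
Proof.
rewrite sum_ln_prime mulr_natl -lnXn//.
rewrite -natrX ler_ln ?posrE ?ltr0n ?expn_gt0//; last first.
  by apply: prodn_cond_gt0 => p /prime_gt0.
rewrite ler_nat; apply: leq_trans (bin_le_expn n.*2 n).
apply: dvdn_leq; first by rewrite bin_gt0 -addnn leq_addr.
apply: prod_prime_dvd => // p /andP[np p2n] pp.
have : (p %| (n.*2)`!)%N by rewrite dvdn_fact// prime_gt0.
rewrite -(@bin_fact n.*2 n) -?addnn ?leq_addr// addnK !Euclid_dvdM// => /orP[//|].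
by rewrite orbb => /(prime_dvd_fact pp); rewrite leqNgt np.
Qed.

Lemma chebyshev_dyadic k :
  \sum_(1 <= p < (2 ^ k).+1 | prime p) ln p%:R <= 2 * (2 ^ k)%:R * ln 2 :> R.
Proof.
have l2 : 0 <= ln 2 :> R by rewrite ln_ge0// ler1n.
elim: k => [|k IH].
  by rewrite big_ltn_cond// big_geq// mulr_ge0.
have e : (2 ^ k.+1 = (2 ^ k).*2)%N by rewrite expnS mul2n.
rewrite e (@big_cat_nat _ _ _ (2 ^ k).+1)//=; last by rewrite ltnS -addnn leq_addr.
have := sum_ln_prime_double (2 ^ k).
rewrite -muln2 natrM; lra.
Qed.

End Chebyshev.

(** * The weights [n^-(1+s)] *)

Section PowerWeights.
Variable R : realType.
Implicit Types (s : R) (n : nat).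

(** This is [n^-s] for [n >= 1]; since [ln 0 = 0], its value at [n = 0] is 1. *)
Definition npow s n : R := expR (- s * ln n%:R).

(* [w s n] is [n ^ -(1 + s)] for [n >= 1]. *)
Definition w s n : R := n%:R^-1 * npow s n.

Lemma ln_nat_ge0 n : 0 <= ln n%:R :> R.
Proof. by case: n => [|n]; [rewrite ln0 | rewrite ln_ge0// ler1n]. Qed.

Lemma ler_ln_nat m n : (0 < m)%N -> (m <= n)%N -> ln m%:R <= ln n%:R :> R.
Proof.
by move=> m0 mn; rewrite ler_ln ?posrE ?ltr0n ?ler_nat// (leq_trans m0).
Qed.

Lemma ln_expn2 j : ln (2 ^ j)%:R = j%:R * ln 2 :> R.
Proof. by rewrite natrX lnXn// mulr_natl. Qed.

Lemma npow_ge0 s n : 0 <= npow s n. Proof. exact: expR_ge0. Qed.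

Lemma npow_le1 s n : 0 <= s -> npow s n <= 1.
Proof.
by move=> s0; rewrite -expR0 ler_expR mulNr oppr_le0 mulr_ge0// ln_nat_ge0.
Qed.

Lemma npow0 n : npow 0 n = 1. Proof. by rewrite /npow oppr0 mul0r expR0. Qed.

Lemma npow1 s : npow s 1 = 1. Proof. by rewrite /npow ln1 mulr0 expR0. Qed.

Lemma npowM s m n : (0 < m)%N -> (0 < n)%N -> npow s (m * n) = npow s m * npow s n.
Proof.
by move=> m0 n0; rewrite /npow natrM lnM ?posrE ?ltr0n// mulrDr expRD.
Qed.

Lemma npow_le s m n : 0 <= s -> (0 < m)%N -> (m <= n)%N -> npow s n <= npow s m.
Proof. by move=> s0 m0 mn; rewrite ler_expR ler_wnM2l ?oppr_le0// ler_ln_nat. Qed.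

Lemma npow_expn s n j : npow s (n ^ j) = npow s n ^+ j.
Proof.
elim: j => [|j IH]; first by rewrite expn0 npow1 expr0.
case: n IH => [|n] IH; last by rewrite expnS npowM ?expn_gt0// IH exprS.
by rewrite exp0n// /npow ln0// mulr0 expR0 expr1n.
Qed.

Lemma w_ge0 s n : 0 <= w s n. Proof. by rewrite mulr_ge0 ?npow_ge0. Qed.

Lemma w_leV s n : 0 <= s -> w s n <= n%:R^-1.
Proof. by move=> s0; rewrite ler_piMr ?npow_le1. Qed.

Lemma wM s m n : (0 < m)%N -> (0 < n)%N -> w s (m * n) = w s m * w s n.
Proof.
by move=> m0 n0; rewrite /w npowM// natrM invfM; ring.
Qed.

Lemma w0 n : w 0 n = n%:R^-1. Proof. by rewrite /w npow0 mulr1. Qed.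

Lemma w_0 s : w s 0 = 0. Proof. by rewrite /w invr0 mul0r. Qed.

Lemma w_1 s : w s 1 = 1. Proof. by rewrite /w invr1 mul1r npow1. Qed.

Lemma lnS_sub n : (0 < n)%N ->
  (n.+1%:R : R)^-1 <= ln (n.+1%:R : R) - ln (n%:R : R) <= (n%:R : R)^-1.
Proof.
move=> n0; have n0R : 0 < n%:R :> R by rewrite ltr0n.
have n1R : 0 < n.+1%:R :> R by rewrite ltr0n.
have e : n.+1%:R = n%:R + 1 :> R by rewrite -natr1.
rewrite -ln_div ?posrE//; apply/andP; split; last first.
  have -> : n.+1%:R / n%:R = 1 + n%:R^-1 :> R.
    by rewrite e mulrDl mul1r divff ?gt_eqF.
  by apply: le_ln1Dx; rewrite (lt_trans (ltrN10 _))// invr_gt0.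
rewrite -[leRHS]opprK lerNr -lnV ?posrE ?divr_gt0// invf_div.
have -> : n%:R / n.+1%:R = 1 + - n.+1%:R^-1 :> R.
  by rewrite -[n%:R](addrK 1) -e mulrBl divff ?gt_eqF// mul1r.
by apply: le_ln1Dx; rewrite ltrN2 invf_lt1// ltr1n ltnS.
Qed.

(** A discrete integral test: [n^-s - (n+1)^-s] is the integral of [s t^-(1+s)] over [[n, n+1]].
    Only [1 + x <= e^x] and the bounds for [ln (n+1) - ln n] are used. *)
Lemma npowS_sub s n : 0 <= s -> (0 < n)%N ->
  s * w s n.+1 <= npow s n - npow s n.+1 <= s * w s n.
Proof.
move=> s0 n0; have /andP[h1 h2] := lnS_sub n0.
set t := ln _ - ln _ in h1 h2.
have e1 : npow s n = npow s n.+1 * expR (s * t).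
  by rewrite /npow -expRD; congr expR; rewrite /t; ring.
have e2 : npow s n.+1 = npow s n * expR (- (s * t)).
  by rewrite /npow -expRD; congr expR; rewrite /t; ring.
apply/andP; split.
  rewrite e1 -[X in _ <= _ - X]mulr1 -mulrBr /w mulrA mulrC ler_wpM2l ?npow_ge0//.
  rewrite lerBrDl (le_trans _ (expR_ge1Dx _))// lerD2l ler_wpM2l//.
rewrite e2 -[X in X - _ <= _]mulr1 -mulrBr /w mulrA [leRHS]mulrC ler_wpM2l ?npow_ge0//.
rewrite lerBlDl -lerBlDr (le_trans _ (expR_ge1Dx _))// lerD2l lerN2 ler_wpM2l//.
Qed.

Lemma sum_w_le s N : 0 < s -> series (w s) N <= 1 + s^-1.
Proof.
move=> s0; case: N => [|N].
  by rewrite /series /= big_geq// addr_ge0// invr_ge0 ltW.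
case: N => [|N].
  by rewrite /series /= big_nat1 w_0 addr_ge0// invr_ge0 ltW.
have : series (w s) N.+2 <= 1 + s^-1 * (1 - npow s N.+1).
  elim: N => [|N IH].
    rewrite /series /= big_nat_recl// big_nat1 w_0 w_1 npow1 subrr mulr0 addr0 add0r//.
  rewrite seriesSr; apply: (le_trans (lerD IH (lexx _))).
  rewrite -addrA lerD2l -lerBrDl -mulrBr mulrC ler_pdivlMr// mulrC.
  have /andP[h _] := npowS_sub (ltW s0) (ltn0Sn N).
  by apply: (le_trans h); lra.
move=> /le_trans; apply; rewrite lerD2l ler_piMr ?invr_ge0 ?(ltW s0)//.
by rewrite gerBl npow_ge0.
Qed.

Lemma w_series_cvg s : 0 < s -> cvgn (series (w s)).
Proof.
move=> s0; apply: nonneg_bounded_series_cvg; first by move=> n; exact: w_ge0.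
by move=> n; exact: sum_w_le.
Qed.

(** From [ln x <= 2 sqrt x]; the right-hand side is [2 n^(-3/2)]. *)
Lemma ln_div_sqr_le n : ln n%:R / n%:R ^+ 2 <= 2 * w (2^-1) n.
Proof.
case: n => [|n]; first by rewrite w_0 ln0// mul0r mulr0.
set x : R := n.+1%:R; have x0 : 0 < x by rewrite ltr0n.
have h : ln x <= 2 * expR (ln x / 2).
  by have := @expR_ge1Dx R (ln x / 2); lra.
have -> : w 2^-1 n.+1 = expR (ln x / 2) / x ^+ 2.
  rewrite /w -/x expr2 invfM mulrA mulrC; congr (_ * _).
  rewrite -[X in _ / X]lnK ?posrE// -expRN -expRD /npow -/x.
  by congr expR; rewrite mulrC; lra.
by rewrite mulrA ler_wpM2r// invr_ge0 exprn_ge0// ltW.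
Qed.

Lemma sum_ln_div_sqr_le N :
  series (fun n => ln n%:R / n%:R ^+ 2) N <= 6 :> R.
Proof.
apply: (@le_trans _ _ (2 * series (w (2^-1)) N)).
  by rewrite /series /= mulr_sumr; apply: ler_sum => n _; exact: ln_div_sqr_le.
have := @sum_w_le (2^-1) N; rewrite invr_gt0 ltr0n invrK => /(_ isT); lra.
Qed.

End PowerWeights.

(** * Mertens' first and second theorems, from the prime factorization of [n!] *)

Section Mertens.
Variable R : realType.

Lemma ln_nat_prime_sum n N : (0 < n)%N -> (n <= N)%N ->
  ln n%:R = \sum_(1 <= p < N.+1 | prime p) (logn p n)%:R * ln p%:R :> R.
Proof.
move=> n0 nN; have := partnT n0; rewrite (widen_partn _ nN) => {1}<-.
rewrite big_ltn_cond//= [logn 0 n]lognE expn0 mul1n.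
rewrite -[LHS]/(ln (\prod_(1 <= p < N.+1) p ^ logn p n)%:R).
have E a b : ln (\prod_(a.+1 <= p < b) p ^ logn p n)%:R =
    \sum_(a.+1 <= p < b | prime p) (logn p n)%:R * ln p%:R :> R.
  elim: b => [|b IH]; first by rewrite !big_geq// ln1.
  have [ab|ab] := leqP a.+1 b; last by rewrite !big_geq// ln1.
  rewrite big_nat_recr//= [in RHS]big_mkcond big_nat_recr//= -big_mkcond/= -IH.
  have b0 : (0 < b)%N by exact: leq_trans ab.
  rewrite natrM lnM ?posrE ?ltr0n ?expn_gt0 ?b0//; last first.
    rewrite big_nat_cond; apply: prodn_cond_gt0 => p /andP[/andP[ap _] _].
    by rewrite expn_gt0 (leq_trans _ ap).
  congr (_ + _); case: ifPn => pb.
    by rewrite natrX lnXn ?ltr0n// mulr_natl.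
  by rewrite lognE (negbTE pb) expn0 ln1.
exact: E.
Qed.

Lemma ln_fact n : ln (n`!)%:R =
  \sum_(1 <= p < n.+1 | prime p) (logn p n`!)%:R * ln p%:R :> R.
Proof.
suff H N : (n <= N)%N -> ln (n`!)%:R =
    \sum_(1 <= p < N.+1 | prime p) (logn p n`!)%:R * ln p%:R :> R by exact: H.
elim: n N => [|n IH] N nN.
  by rewrite fact0 ln1 big1// => p _; rewrite logn1 mul0r.
rewrite factS natrM lnM ?posrE ?ltr0n ?fact_gt0// (@ln_nat_prime_sum _ N)//.
rewrite (IH N (ltnW nN)) -big_split/=; apply: eq_bigr => p _.
by rewrite lognM ?fact_gt0// natrD mulrDl.
Qed.

Lemma ln_fact_le n : ln (n`!)%:R <= n%:R * ln n%:R :> R.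
Proof.
elim: n => [|n IH]; first by rewrite fact0 ln1 mul0r.
rewrite factS natrM lnM ?posrE ?ltr0n ?fact_gt0//.
have -> : n.+1%:R * ln n.+1%:R = ln n.+1%:R + n%:R * ln n.+1%:R :> R.
  by rewrite -[X in X * _ = _]natr1 mulrDl mul1r addrC.
rewrite lerD// (le_trans IH)//.
case: n {IH} => [|n]; first by rewrite !mul0r.
by rewrite ler_wpM2l// ler_ln_nat.
Qed.

Lemma ln_fact_ge n : n%:R * ln n%:R - n%:R <= ln (n`!)%:R :> R.
Proof.
elim: n => [|n IH]; first by rewrite fact0 ln1 mul0r subrr.
rewrite factS natrM lnM ?posrE ?ltr0n ?fact_gt0//.
case: n IH => [|n] IH; first by rewrite fact0 ln1 mul1r; lra.
have /andP[_ h] := @lnS_sub R _ (ltn0Sn n).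
have {}h : n.+1%:R * (ln n.+2%:R - ln n.+1%:R) <= 1 :> R.
  by rewrite mulrC -ler_pdivlMr ?ltr0n// mul1r.
have e : n.+2%:R = n.+1%:R + 1 :> R by rewrite natr1.
by move: IH h; set b := ln n.+2%:R; rewrite e; lra.
Qed.

Lemma logn_fact_ge p n : prime p -> n%:R / p%:R - 1 <= (logn p n`!)%:R :> R.
Proof.
move=> pp; have p0 : 0 < p%:R :> R by rewrite ltr0n prime_gt0.
case: n => [|n]; first by rewrite mul0r sub0r logn1 lerN10.
apply: (@le_trans _ _ (n.+1 %/ p)%:R); last first.
  by rewrite ler_nat logn_fact// big_ltn// expn1 leq_addr.
rewrite lerBlDr natr1 ler_pdivrMr// -natrM ler_nat ltnW//.
by rewrite ltn_ceil// prime_gt0.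
Qed.

(** Legendre's formula with the floors dropped is a geometric series of total [n / (p - 1)]. *)
Lemma logn_fact_le p n : prime p -> (logn p n`!)%:R <= n%:R / (p%:R - 1) :> R.
Proof.
move=> pp; have p1 : 1 < p%:R :> R by rewrite ltr1n prime_gt1.
have p0 : 0 < p%:R :> R by exact: lt_trans p1.
have H m : (p%:R - 1) * (\sum_(1 <= k < m.+1) p%:R ^- k) = 1 - p%:R ^- m :> R.
  elim: m => [|m IH]; first by rewrite big_geq// expr0 invr1 mulr0 subrr.
  rewrite big_nat_recr//= mulrDr IH exprS invfM.
  by rewrite mulrBl mulrA divff ?gt_eqF// !mul1r; ring.
rewrite logn_fact// natr_sum ler_pdivlMr ?subr_gt0//.
apply: (@le_trans _ _ (n%:R * ((p%:R - 1) * (\sum_(1 <= k < n.+1) p%:R ^- k)))).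
  rewrite mulrCA [leRHS]mulrC ler_wpM2r ?subr_ge0 ?(ltW p1)//.
  rewrite mulr_sumr; apply: ler_sum => k _.
  by rewrite ler_pdivlMr ?exprn_gt0// -natrX -natrM ler_nat leq_trunc_div.
by rewrite H ler_piMr// gerBl invr_ge0 exprn_ge0// ltW.
Qed.

(** Legendre's formula gives [ln n! >= sum (n/p - 1) ln p], and Chebyshev's bound pays for the
    subtracted [ln p]. *)
Lemma mertens_upper k :
  \sum_(1 <= p < (2 ^ k).+1 | prime p) ln p%:R / p%:R <= k%:R * ln 2 + 2 * ln 2 :> R.
Proof.
set n := (2 ^ k)%N; have n0 : 0 < n%:R :> R by rewrite ltr0n expn_gt0.
rewrite -(ler_pM2l n0).
apply: (@le_trans _ _ (ln (n`!)%:R + 2 * n%:R * ln 2)); last first.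
  by have := ln_fact_le n; rewrite (ln_expn2 R k : ln n%:R = _); lra.
apply: (le_trans _ (lerD (lexx _) (chebyshev_dyadic R k))).
rewrite ln_fact mulr_sumr -big_split/=; apply: ler_sum => p pp.
have := ler_wpM2r (ln_nat_ge0 R p) (logn_fact_ge n pp); lra.
Qed.

(** Uses [1/(p-1) <= 1/p + 2/p^2]. In [13 = 1 + 2 * 6], the 1 comes from [ln n! >= n ln n - n] and
    the 6 bounds the sum of [ln n / n^2]. *)
Lemma mertens_lower k :
  k%:R * ln 2 - 13 <= \sum_(1 <= p < (2 ^ k).+1 | prime p) ln p%:R / p%:R :> R.
Proof.
set n := (2 ^ k)%N; have n0 : 0 < n%:R :> R by rewrite ltr0n expn_gt0.
have h1 : ln (n`!)%:R <= n%:R * (\sum_(1 <= p < n.+1 | prime p)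
    (ln p%:R / p%:R + 2 * (ln p%:R / p%:R ^+ 2))) :> R.
  rewrite ln_fact mulr_sumr; apply: ler_sum => p pp.
  have p2 : 2 <= p%:R :> R by rewrite ler_nat prime_gt1.
  apply: (le_trans (ler_wpM2r (ln_nat_ge0 R p) (logn_fact_le n pp))).
  rewrite -mulrA ler_wpM2l// mulrC.
  have -> : ln p%:R / p%:R + 2 * (ln p%:R / p%:R ^+ 2) =
    ln p%:R * (p%:R^-1 + 2 / p%:R ^+ 2) :> R by ring.
  rewrite ler_wpM2l ?ln_nat_ge0//.
  have -> : p%:R^-1 + 2 / p%:R ^+ 2 = (p%:R + 2) / p%:R ^+ 2 :> R by field; lra.
  have x1 : 0 < p%:R - 1 :> R by lra.
  by rewrite ler_pdivlMr ?exprn_gt0 ?ler_pdivrMl//; nra.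
rewrite big_split/= -mulr_sumr in h1.
have h2 : \sum_(1 <= p < n.+1 | prime p) ln p%:R / p%:R ^+ 2 <= 6 :> R.
  apply: le_trans (@sum_ln_div_sqr_le R n.+1).
  rewrite /series /= big_ltn// ln0// mul0r add0r big_mkcond; apply: ler_sum => p _.
  by case: ifP => // _; rewrite divr_ge0 ?ln_nat_ge0.
rewrite -(ler_pM2l n0).
have h3 := ln_fact_ge n; rewrite (ln_expn2 R k : ln n%:R = _) in h3.
have := ler_wpM2l (ltW n0) h2; lra.
Qed.

(** Block sums of [ln p / p], and below of [1 / p]. On average over [j] they are [ln 2] and
    [1 / (j+1)]; later only averages and upper bounds are used. *)
Definition lam j : R := \sum_((2 ^ j)%N <= p < (2 ^ j.+1)%N | prime p) ln p%:R / p%:R.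

Definition prec j : R := \sum_((2 ^ j)%N <= p < (2 ^ j.+1)%N | prime p) p%:R^-1.

Lemma lam_ge0 j : 0 <= lam j.
Proof. by apply: sumr_ge0 => p _; rewrite divr_ge0 ?ln_nat_ge0. Qed.

Lemma prec_ge0 j : 0 <= prec j.
Proof. by apply: sumr_ge0 => p _; rewrite invr_ge0. Qed.

Lemma mertens_first : exists2 C : R, 0 <= C &
  forall k, `|series (fun j => lam j - ln 2) k| <= C.
Proof.
have l0 : 0 <= ln 2 :> R by exact: ln_nat_ge0.
exists (14 + 2 * ln 2); first by lra.
move=> k; rewrite /series /= sumrB -big_dyadic sumr_const_nat subn0.
have h1 := mertens_upper k; have h2 := mertens_lower k.
(* The estimates for [p <= 2^k] include the endpoint, the blocks do not; that term is at most 1,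
   whence 14 instead of 13. *)
move: h1 h2; rewrite [X in X <= _ -> _ <= X -> _]big_mkcond big_nat_recr ?expn_gt0//= -big_mkcond/=.
set x := \sum_(_ <= _ < _ | _) _; set y := if _ then _ else _.
have y0 : 0 <= y by rewrite /y; case: ifP => // _; rewrite divr_ge0 ?ln_nat_ge0.
have y1 : y <= 1.
  rewrite /y; case: ifP => // _; rewrite ler_pdivrMr ?ltr0n ?expn_gt0// mul1r.
  by rewrite ltW// ln_sublinear// ltr0n expn_gt0.
rewrite -[ln 2 *+ k]mulr_natl => h1 h2.
by rewrite ler_norml; apply/andP; split; lra.
Qed.

Lemma lam_bounded : exists2 C : R, 0 <= C & forall j, lam j <= C.
Proof.
have [C C0 HC] := mertens_first.
exists (2 * C + ln 2); first by rewrite addr_ge0 ?ln_nat_ge0// mulr_ge0.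
move=> j; have := seriesSB (fun j => lam j - ln 2) j => /= E.
have := HC j; have := HC j.+1; rewrite !ler_norml => /andP[_ h1] /andP[h2 _]; lra.
Qed.

Lemma prec_le_lam j : j%:R * ln 2 * prec j <= lam j.
Proof.
rewrite mulr_sumr big_nat_cond [leRHS]big_nat_cond; apply: ler_sum => p.
move=> /andP[/andP[jp _] _]; rewrite ler_wpM2r ?invr_ge0// -ln_expn2.
by rewrite ler_ln_nat// expn_gt0.
Qed.

Lemma prec_bounded : exists2 C : R, 0 <= C & forall j, prec j <= C / j.+1%:R.
Proof.
have [C C0 HC] := lam_bounded; have l0 : 0 < ln 2 :> R by rewrite ln_gt0// ltr1n.
exists (2 * C / ln 2); first by rewrite divr_ge0 ?mulr_ge0// ltW.
case=> [|j].
  have -> : prec 0 = 0 by rewrite /prec big_ltn_cond//= big_geq.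
  by rewrite !divr_ge0 ?mulr_ge0// ltW.
rewrite ler_pdivlMr// ler_pdivlMr// mulrC mulrA.
apply: (@le_trans _ _ (2 * (j.+1%:R * ln 2 * prec j.+1))).
  have h : j.+2%:R <= 2 * j.+1%:R :> R by rewrite -natrM ler_nat; lia.
  have pl : 0 <= ln 2 * prec j.+1 by rewrite mulr_ge0 ?prec_ge0// ltW.
  by have := ler_wpM2l pl h; lra.
by rewrite ler_pM2l// (le_trans (prec_le_lam _))// HC.
Qed.

Lemma sum_inv_sqr_cvg : cvgn (series (fun j => j.+1%:R ^- 2 : R)).
Proof.
apply: (@nonneg_bounded_series_cvg _ _ 2) => [j|n]; first by rewrite invr_ge0.
suff : series (fun j => j.+1%:R ^- 2 : R) n.+1 <= 2 - n.+1%:R^-1.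
  rewrite seriesSr => h; apply: (le_trans _ (le_trans h _)); last by rewrite gerBl.
  by rewrite lerDl.
elim: n => [|n IH]; first by rewrite /series /= big_nat1 invr1 expr1n invr1; lra.
rewrite seriesSr; apply: (le_trans (lerD IH (lexx _))).
rewrite -addrA lerD2l -(natr1 n.+1); set x := n.+1%:R.
have x0 : 0 < x by rewrite ltr0n.
rewrite -subr_ge0 (_ : _ - _ = (x * (x + 1) ^+ 2)^-1); last by field; lra.
by rewrite invr_ge0 mulr_ge0 ?exprn_ge0//; lra.
Qed.

(** On block [j], [ln p] is within [ln 2] of [(j+1) ln 2], so replacing [prec j] by
    [lam j / ((j+1) ln 2)] costs [O(1/(j+1)^2)]. What remains is [lam j - ln 2], with bounded
    partial sums, against decreasing weights. *)
Lemma mertens_second : cvgn (series (fun j => prec j - j.+1%:R^-1)).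
Proof.
have l0 : 0 < ln 2 :> R by rewrite ln_gt0// ltr1n.
have [C C0 HC] := mertens_first; have [K K0 HK] := prec_bounded.
have -> : (fun j => prec j - j.+1%:R^-1) =
    (fun j => prec j - lam j / (ln 2 * j.+1%:R)) +
    (fun j => (lam j - ln 2) * (ln 2 * j.+1%:R)^-1).
  apply/funext => j; rewrite !fctE.
    have x0 : (j.+1%:R : R) != 0 by rewrite pnatr_eq0.
    move: j.+1%:R x0 => x x0; field; rewrite x0/=; exact: lt0r_neq0.
apply: is_cvg_seriesD; last first.
  apply: (dirichlet_test HC) => [k|].
    by rewrite lef_pV2 ?posrE ?mulr_gt0// ler_pM2l// ler_nat.
  have -> : (fun k => (ln 2 * k.+1%:R)^-1 : R) = (fun k => (ln 2)^-1 * harmonic k).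
    by apply/funext => k; rewrite invfM.
  by rewrite -(mulr0 (ln 2)^-1); apply: cvgM; [exact: cvg_cst|exact: cvg_harmonic].
apply: (@dominated_series_cvg _ _ (fun j => K * j.+1%:R ^- 2)); last first.
  by apply: is_cvg_seriesZ; exact: sum_inv_sqr_cvg.
move=> j.
have -> : prec j - lam j / (ln 2 * j.+1%:R) =
  \sum_((2 ^ j)%N <= p < (2 ^ j.+1)%N | prime p) p%:R^-1 * (1 - ln p%:R / (ln 2 * j.+1%:R)).
  rewrite /prec /lam mulr_suml -sumrB; apply: eq_bigr => p _; ring.
have -> : K * j.+1%:R ^- 2 = (K / j.+1%:R) / j.+1%:R by field.
apply: (le_trans _ (ler_wpM2r _ (HK j))); last by rewrite invr_ge0.
rewrite mulr_suml (le_trans (ler_norm_sum _ _ _))//.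
rewrite big_nat_cond [leRHS]big_nat_cond; apply: ler_sum => p /andP[/andP[jp pj] pp].
rewrite normrM ger0_norm ?invr_ge0// ler_wpM2l ?invr_ge0//.
have jl : 0 < ln 2 * j.+1%:R :> R by rewrite mulr_gt0.
have h1 : j%:R * ln 2 <= ln p%:R :> R by rewrite -ln_expn2 ler_ln_nat ?expn_gt0.
have h2 : ln p%:R <= j.+1%:R * ln 2 :> R.
  by rewrite -ln_expn2 ler_ln_nat ?prime_gt0// ltnW.
rewrite ger0_norm; last by rewrite subr_ge0 ler_pdivrMr// mul1r mulrC.
rewrite lerBlDr -lerBlDl.
have -> : 1 - j.+1%:R^-1 = j%:R * ln 2 / (ln 2 * j.+1%:R) :> R.
  have x0 : (j.+1%:R : R) != 0 by rewrite pnatr_eq0.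
  have -> : j%:R = j.+1%:R - 1 :> R by rewrite -natr1 addrK.
  by move: j.+1%:R x0 => x x0; field; rewrite x0/=; exact: lt0r_neq0.
by rewrite ler_pM2r ?invr_gt0.
Qed.

End Mertens.

(** * Euler products *)

Section EulerProduct.
Variable R : realType.
Implicit Types (s : R) (n N y : nat).

Lemma sum_multiples (V : zmodType) (F : nat -> V) y N : (0 < y)%N ->
  \sum_(0 <= n < N * y | (y %| n)%N) F n = \sum_(0 <= i < N) F (i * y)%N.
Proof.
move=> y0; elim: N => [|N IH]; first by rewrite mul0n !big_geq.
rewrite [RHS]big_nat_recr//= -IH (@big_cat_nat _ _ _ (N * y)%N)//=; last first.
  by rewrite leq_mul2r leqnSn orbT.
congr (_ + _); rewrite big_ltn_cond ?dvdn_mull//; last by rewrite mulSn -[ltnLHS]add0n ltn_add2r.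
rewrite big_nat_cond big1 ?addr0// => n /andP[/andP[n1 n2] /dvdnP[k nk]].
move: n1 n2; rewrite nk ltn_pmul2r// ltn_pmul2r// ltnS => h1 h2.
by move: (leq_trans h1 h2); rewrite ltnn.
Qed.

(** The restriction of [w s] to positive integers whose prime factors are all below [y]; [pnat]
    rejects 0. *)
Definition smooth_weight s y n : R :=
  if [pred p : nat | (p < y)%N].-nat n then w s n else 0.

Lemma smooth_weight_ge0 s y n : 0 <= smooth_weight s y n.
Proof. by rewrite /smooth_weight; case: ifP => // _; exact: w_ge0. Qed.

Lemma smooth_weight_le s y n : smooth_weight s y n <= w s n.
Proof. by rewrite /smooth_weight; case: ifP => // _; exact: w_ge0. Qed.

Lemma smooth0 n : [pred p : nat | (p < 0)%N].-nat n = (n == 1)%N.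
Proof.
apply/idP/eqP => [/andP[n0 /allP h]|->//].
apply/eqP; rewrite eqn_leq n0 andbT leqNgt; apply/negP => n1.
by have := h (pdiv n); rewrite mem_primes pdiv_prime// n0 pdiv_dvd => /(_ isT).
Qed.

Lemma smoothS_prime y n : prime y -> [pred p : nat | (p < y)%N].-nat n =
  [pred p : nat | (p < y.+1)%N].-nat n && ~~ (y %| n)%N.
Proof.
move=> py; apply/andP/andP => [[n0 /allP h]|[/andP[n0 /allP h] yn]].
  split; first by rewrite /pnat n0/=; apply/allP => p /h; rewrite !inE => /ltnW.
  by apply/negP => yn; have := h y; rewrite mem_primes py n0 yn inE ltnn => /(_ isT).
split=> //; apply/allP => p pn; have := h p pn; rewrite !inE ltnS leq_eqVlt => /orP[/eqP py'|//].
by move: pn yn; rewrite py' mem_primes => /and3P[_ _ ->].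
Qed.

Lemma smoothS_notprime y n : ~~ prime y -> [pred p : nat | (p < y.+1)%N].-nat n =
  [pred p : nat | (p < y)%N].-nat n.
Proof.
move=> py; apply: eq_in_pnat => p; rewrite !inE ltnS leq_eqVlt => pn.
by case: eqP => // py'; move: pn py; rewrite py' mem_primes => /and3P[->].
Qed.

Lemma smooth_lt y n : (0 < n)%N -> (n < y)%N -> [pred p : nat | (p < y)%N].-nat n.
Proof.
move=> n0 ny; rewrite /pnat n0; apply/allP => p; rewrite mem_primes inE => /and3P[_ _ pn].
by rewrite (leq_ltn_trans (dvdn_leq n0 pn)).
Qed.

Lemma smooth_weightM s y n : prime y ->
  smooth_weight s y.+1 (n * y) = w s y * smooth_weight s y.+1 n.
Proof.
move=> py; rewrite /smooth_weight pnatM.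
have -> : [pred p : nat | (p < y.+1)%N].-nat y by rewrite pnatE// inE.
rewrite andbT; case: ifP; last by rewrite mulr0.
by move=> /andP[n0 _]; rewrite (wM _ n0 (prime_gt0 py)) mulrC.
Qed.

Lemma series_smooth_weightS s y N : prime y ->
  series (smooth_weight s y.+1) (N * y)%N =
  series (smooth_weight s y) (N * y)%N + w s y * series (smooth_weight s y.+1) N.
Proof.
move=> py; rewrite /series/= mulr_sumr.
under [in X in _ = _ + X]eq_bigr do rewrite -smooth_weightM//.
rewrite -(sum_multiples _ _ (prime_gt0 py)) [in X in _ = _ + X]big_mkcond -big_split/=.
apply: eq_bigr => n _; rewrite {2}/smooth_weight smoothS_prime//.
by case: (boolP (y %| n)%N) => yn; rewrite ?andbF ?add0r//= ?andbT addr0.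
Qed.

Lemma w_prime_lt1 s p : 0 <= s -> prime p -> w s p <= 2^-1.
Proof.
move=> s0 pp; apply: (le_trans (w_leV p s0)).
by rewrite lef_pV2 ?posrE ?ltr0n ?prime_gt0// ler_nat prime_gt1.
Qed.

(* The sieve recurrence at a prime [y] gives [Z_(y+1) = Z_y + w_y Z_(y+1)] for
   the sums [Z_y] over [y]-smooth integers. *)
Lemma euler_product_smooth s y : 0 <= s ->
  series (smooth_weight s y) @ \oo -->
    \prod_(0 <= p < y | prime p) (1 - w s p)^-1.
Proof.
move=> s0; elim: y => [|y IH].
  rewrite big_geq//; apply: cvg_near_cst; exists 2 => // n /= n2.
  rewrite /series/= (@big_cat_nat _ _ _ 2)//= [X in _ + X]big_nat_cond [X in _ + X]big1 ?addr0.
    by rewrite big_ltn// big_nat1 /smooth_weight !smooth0 add0r w_1.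
  by case=> [|[|k]]; rewrite ?andbF// => _; rewrite /smooth_weight smooth0.
rewrite big_mkcond big_nat_recr//= -big_mkcond/=; case: ifPn => py; last first.
  rewrite mulr1 (_ : smooth_weight s y.+1 = smooth_weight s y)//.
  by apply/funext => n; rewrite /smooth_weight smoothS_notprime.
set Z := \prod_(_ <= _ < _ | _) _ in IH *.
have wy := w_prime_lt1 s0 py; have y0 := prime_gt0 py.
have nd z : nondecreasing_seq (series (smooth_weight s z)).
  by apply/nondecreasing_seqP => n; rewrite seriesSr lerDl smooth_weight_ge0.
have cmul : (fun N => (N * y)%N) @ \oo --> \oo by exact: cvg_mulnr.
(* The recurrence also yields boundedness: the sum up to [n] is at most the sum up to [n * y], which
   is at most [Z] plus [w s y] times the sum up to [n], and [w s y <= 1/2]. This argument includes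
   [s = 0]. *)
have cS : cvgn (series (smooth_weight s y.+1)).
  apply: (@nonneg_bounded_series_cvg _ _ (Z / (1 - w s y))).
    by move=> n; exact: smooth_weight_ge0.
  move=> n; rewrite ler_pdivlMr; last by lra.
  have h1 : series (smooth_weight s y) (n * y)%N <= Z.
    by apply: series_le_lim => // k; exact: smooth_weight_ge0.
  have h2 := nd y.+1 n (n * y)%N (leq_pmulr n y0).
  rewrite series_smooth_weightS// in h2; lra.
set L := limn (series (smooth_weight s y.+1)) in cS.
have c1 : series (smooth_weight s y.+1) (N * y)%N @[N --> \oo] --> L.
  exact: (cvg_comp _ _ cmul cS).
have c2 : series (smooth_weight s y.+1) (N * y)%N @[N --> \oo] --> Z + w s y * L.
  under eq_fun do rewrite series_smooth_weightS//.
  apply: cvgD; first exact: (cvg_comp _ _ cmul IH).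
  by apply: cvgM => //; exact: cvg_cst.
have e : L = Z + w s y * L by exact: (cvg_unique (@Rhausdorff R) c1 c2).
suff -> : Z * (1 - w s y)^-1 = L by [].
have -> : Z = L * (1 - w s y) by lra.
by rewrite mulfK// gt_eqF//; lra.
Qed.

(* Riemann's zeta function at [1 + s]. *)
Definition zeta s : R := limn (series (w s)).

(** Every positive integer below [N] has only prime factors below [N]. The case [s = 0] is included,
    where the full series diverges. *)
Lemma series_w_le_euler s N : 0 <= s ->
  series (w s) N <= \prod_(0 <= p < N | prime p) (1 - w s p)^-1.
Proof.
move=> s0; have h := @euler_product_smooth s N s0.
apply: le_trans (series_le_lim N _ h); last by move=> n; exact: smooth_weight_ge0.
rewrite /series/= big_nat_cond [leRHS]big_nat_cond; apply: ler_sum => n.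
move=> /andP[/andP[_ nN] _]; case: n nN => [|n] nN; first by rewrite w_0 smooth_weight_ge0.
by rewrite /smooth_weight smooth_lt.
Qed.

Lemma euler_le_zeta s N : 0 < s ->
  \prod_(0 <= p < N | prime p) (1 - w s p)^-1 <= zeta s.
Proof.
move=> s0; have ce := @euler_product_smooth s N (ltW s0).
rewrite -(cvg_lim (@Rhausdorff R) ce); apply: lim_series_le.
- by apply/cvg_ex; eexists; exact: ce.
- exact: w_series_cvg.
- by move=> n; exact: smooth_weight_le.
Qed.

Lemma euler_product s : 0 < s ->
  \prod_(0 <= p < N | prime p) (1 - w s p)^-1 @[N --> \oo] --> zeta s.
Proof.
move=> s0; apply: (@squeeze_cvgr _ _ _ _ (series (w s)) (fun=> zeta s)).
- by apply: nearW => N; rewrite series_w_le_euler ?(ltW s0)// euler_le_zeta.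
- exact: w_series_cvg.
- exact: cvg_cst.
Qed.

(** The probability that no prime below [N] is kept. *)
Definition V s N : R := \prod_(0 <= p < N | prime p) (1 + w s p)^-1.

(** The parameter [2 * s + 1] encodes the exponent [2 + 2s]; this is how the value of zeta at 2
    enters, through [(1 + w) (1 - w) = 1 - w^2]. *)
Lemma w_sqr s n : w s n ^+ 2 = w (2 * s + 1) n.
Proof.
case: n => [|n]; first by rewrite !w_0 expr0n.
rewrite /w exprMn -expRM_natl /npow.
have -> : - (2 * s + 1) * ln n.+1%:R = 2 * (- s * ln n.+1%:R) - ln n.+1%:R :> R by ring.
by rewrite expRD expRN lnK ?posrE// expr2; ring.
Qed.

Lemma V_euler s N : 0 <= s ->
  V s N * \prod_(0 <= p < N | prime p) (1 - w s p)^-1 =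
  \prod_(0 <= p < N | prime p) (1 - w (2 * s + 1) p)^-1.
Proof.
move=> s0; rewrite -big_split/=; apply: eq_bigr => p pp.
rewrite -invfM -w_sqr; congr (_^-1); ring.
Qed.

Lemma V_gt0 s N : 0 <= s -> 0 < V s N.
Proof.
by move=> s0; apply: prodr_gt0 => p _; rewrite invr_gt0 ltr_pwDl// w_ge0.
Qed.

Lemma zeta_ge1 s : 0 < s -> 1 <= zeta s.
Proof.
move=> s0; have := @series_le_lim _ (w s) _ 2 (@w_ge0 _ s) (w_series_cvg s0).
by rewrite /series/= big_ltn// big_nat1 w_0 w_1 add0r.
Qed.

Lemma V_cvg s : 0 < s -> V s @ \oo --> zeta (2 * s + 1) / zeta s.
Proof.
move=> s0; have z0 : zeta s != 0 by rewrite gt_eqF// (lt_le_trans _ (zeta_ge1 s0)).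
have -> : V s = (fun N => \prod_(0 <= p < N | prime p) (1 - w (2 * s + 1) p)^-1 *
    (\prod_(0 <= p < N | prime p) (1 - w s p)^-1)^-1).
  apply/funext => N; rewrite -V_euler ?(ltW s0)// mulfK// gt_eqF//.
  apply: prodr_gt0 => p pp; rewrite invr_gt0; have := w_prime_lt1 (ltW s0) pp; lra.
apply: cvgM; first by apply: euler_product; lra.
by apply: cvgV => //; exact: euler_product.
Qed.

Lemma zeta_le s : 0 < s -> zeta s <= 1 + s^-1.
Proof.
by move=> s0; apply: limr_le; [exact: w_series_cvg | apply: nearW => n; exact: sum_w_le].
Qed.

Lemma w_anti s t n : s <= t -> w t n <= w s n.
Proof.
move=> st; rewrite ler_wpM2l// /npow ler_expR ler_wpM2r ?ln_nat_ge0//.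
by rewrite lerN2.
Qed.

(** [V] times the Euler product is a partial product of [zeta (2 * s + 1)], at most
    [1 + 1/(2s+1) <= 2]. The bound is uniform down to [s = 0]. *)
Lemma V_bound s N : 0 <= s -> V s N * series (w s) N <= 2.
Proof.
move=> s0; have V0 := V_gt0 N s0.
apply: (le_trans (ler_wpM2l (ltW V0) (series_w_le_euler N s0))).
rewrite V_euler//; apply: le_trans (@euler_le_zeta (2 * s + 1) N _) _; first by lra.
apply: (le_trans (@zeta_le _ _)); first by lra.
rewrite -lerBrDl; apply: (@le_trans _ _ 1); last by lra.
by rewrite invf_le1; lra.
Qed.

End EulerProduct.

(** * The Basel sum *)

Section Basel.
Variable R : realType.
Implicit Types (x : R) (n k : nat).

Lemma mul_cos_le_sin x : 0 <= x <= pi / 2 -> x * cos x <= sin x.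
Proof.
move=> /andP[x0 xpi].
pose f y : R := sin y - y * cos y.
have df (y : R) : is_derive y 1 f (y * sin y).
  by apply: is_derive_eq; rewrite /GRing.scale/=; ring.
have := @MVT_segment R f (fun y => y * sin y) 0 x x0 (fun y _ => df y).
have cf : {within `[0, x], continuous f}.
  apply: continuous_subspaceT => y; apply: differentiable_continuous.
  by apply/derivable1_diffP; apply: ex_derive.
move=> /(_ cf)[c]; rewrite in_itv/= => /andP[c0 cx].
rewrite /f sin0 !mul0r !subr0 => e; rewrite -subr_ge0 e.
have : 0 <= sin c by apply: sin_ge0_pi; rewrite c0/= (le_trans cx)// (le_trans xpi)//
    ler_pdivrMr// ler_pMr ?pi_gt0// ler1n.
by move=> sc; rewrite !mulr_ge0.
Qed.

Lemma sin_le_id x : 0 <= x -> sin x <= x.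
Proof.
move=> x0; pose f y : R := y - sin y.
have df (y : R) : is_derive y 1 f (1 - cos y).
  by apply: is_derive_eq.
have cf : {within `[0, x], continuous f}.
  apply: continuous_subspaceT => y; apply: differentiable_continuous.
  by apply/derivable1_diffP; apply: ex_derive.
have := @MVT_segment R f (fun y => 1 - cos y) 0 x x0 (fun y _ => df y) cf.
move=> [c _]; rewrite /f sin0 !subr0 => e; rewrite -subr_ge0 e.
by rewrite mulr_ge0// subr_ge0 cos_le1.
Qed.

(** The left-hand side is [cot^2 x], so this is the squared form of [sin x <= x <= tan x]. *)
Lemma inv_sqr_sin_bounds x : 0 < x <= pi / 2 ->
  sin x ^- 2 - 1 <= x ^- 2 <= sin x ^- 2.
Proof.
move=> /andP[x0 xpi].
have s0 : 0 < sin x.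
  by apply: sin_gt0_pi; rewrite x0/= (le_lt_trans xpi)// ltr_pdivrMr// ltr_pMr ?pi_gt0// ltr1n.
have h1 := sin_le_id (ltW x0).
have h2 : x * cos x <= sin x by apply: mul_cos_le_sin; rewrite ltW.
have c0 : 0 <= cos x by apply: cos_ge0_pihalf; rewrite xpi andbT
    (le_trans _ (ltW x0))// oppr_le0 divr_ge0// pi_ge0.
apply/andP; split; last first.
  by rewrite lef_pV2 ?posrE ?exprn_gt0// ler_sqr ?nnegrE ?(ltW x0) ?(ltW s0).
have -> : sin x ^- 2 - 1 = cos x ^+ 2 / sin x ^+ 2.
  by rewrite cos2sin2 mulrBl mul1r divff// gt_eqF ?exprn_gt0.
rewrite ler_pdivrMr ?exprn_gt0// mulrC ler_pdivlMr ?exprn_gt0//.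
rewrite mulrC -exprMn ler_sqr ?nnegrE ?(ltW s0)//.
by rewrite mulr_ge0// ltW.
Qed.

(* Hofbauer's identity: [sin x ^-2] is a quarter of the sum of its values at
   [x / 2] and [x / 2 + pi / 2]. *)
Lemma inv_sqr_sin_half x : sin x != 0 ->
  sin x ^- 2 = (sin (x / 2) ^- 2 + sin ((pi - x) / 2) ^- 2) / 4.
Proof.
move=> sx; have e : x = (x / 2) *+ 2 by rewrite -mulr_natr divfK.
have -> : sin ((pi - x) / 2) = cos (x / 2).
  by rewrite mulrBl sinB sin_pihalf cos_pihalf mul1r mul0r subr0.
move: sx; rewrite {1 2}e sin_mulr2n; have := cos2Dsin2 (x / 2).
set c := cos _; set s := sin _ => cs.
rewrite -mulr_natr !mulf_eq0 !negb_or => /andP[/andP[c0 s0] _].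
have -> : s ^- 2 + c ^- 2 = (c ^+ 2 + s ^+ 2) / (c ^+ 2 * s ^+ 2).
  by field; rewrite c0 s0.
by rewrite cs; field; rewrite c0 s0.
Qed.

(** The odd multiples of [pi / 2^(n+2)] in the first quadrant. One step of the half-angle identity
    sends angle [k] of level [n] to the angles [k] and [2^(n+1) - k - 1] of level [n+1]. *)
Definition hofbauer_angle n k : R := (k.*2.+1)%:R * pi / (2 ^ n.+2)%:R.

Lemma hofbauer_angle_bounds n k : (k < 2 ^ n)%N -> 0 < hofbauer_angle n k <= pi / 2.
Proof.
move=> kn; rewrite /hofbauer_angle divr_gt0 ?mulr_gt0 ?pi_gt0 ?ltr0n ?expn_gt0//=.
rewrite ler_pdivrMr ?ltr0n ?expn_gt0// mulrC -mulrA ler_wpM2l ?pi_ge0//.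
rewrite mulrC ler_pdivlMr// -natrM ler_nat !expnS.
move: (2 ^ n)%N kn => N; lia.
Qed.

Lemma sum_fold (f : nat -> R) n :
  \sum_(0 <= k < n + n) f k = \sum_(0 <= k < n) (f k + f (n + n - k.+1)%N).
Proof.
rewrite (@big_cat_nat _ _ _ n)//= ?leq_addr// big_split/=; congr (_ + _).
rewrite big_nat_rev/= -[X in \sum_(X <= _ < _) _]add0n big_addn addnK.
by apply: eq_bigr => k _; congr f; lia.
Qed.

(** Level 0 is [sin(pi/4)^-2 = 2], and each halving step multiplies the sum by 4. The new angles
    come in mirror pairs, which [sum_fold] collects. *)
Lemma sum_inv_sqr_sin n :
  \sum_(0 <= k < 2 ^ n) sin (hofbauer_angle n k) ^- 2 = 2 * (4 ^ n)%:R.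
Proof.
elim: n => [|n IH].
  rewrite expn0 big_nat1 /hofbauer_angle mul1r expn0 mulr1.
  have := cos2Dsin2 (pi / 4 : R).
  have -> : cos (pi / 4 : R) = sin (pi / 4).
    have -> : pi / 4 = pi / 2 - pi / 4 :> R by lra.
    by rewrite cosB cos_pihalf sin_pihalf mul0r add0r mul1r; congr sin; field.
  rewrite (_ : (2 ^ 2)%:R = 4)// => e.
  have -> : sin (pi / 4) ^+ 2 = 2^-1 :> R by lra.
  by rewrite invrK.
have -> : (2 * (4 ^ n.+1)%:R : R) = 4 * (2 * (4 ^ n)%:R).
  by rewrite expnS natrM; ring.
rewrite -IH mulr_sumr expnS mul2n -addnn.
rewrite sum_fold.
rewrite big_nat_cond [RHS]big_nat_cond; apply: eq_bigr => k; rewrite andbT => /andP[_ kn].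
have p20 m : (2 ^ m)%:R != 0 :> R by rewrite pnatr_eq0 -lt0n expn_gt0.
have /andP[x0 xpi] := hofbauer_angle_bounds kn.
rewrite [in RHS]inv_sqr_sin_half; last first.
  rewrite gt_eqF//; apply: sin_gt0_pi; rewrite x0/= (le_lt_trans xpi)//.
  by rewrite ltr_pdivrMr// ltr_pMr ?pi_gt0// ltr1n.
rewrite mulrC divfK//; congr (_ ^- 2 + _ ^- 2); congr sin; rewrite /hofbauer_angle.
  by rewrite [in LHS]expnS natrM; field.
set N := (2 ^ n)%N in kn *.
have -> : (2 ^ n.+3)%N = (8 * N)%N by rewrite !expnS /N; lia.
have -> : (2 ^ n.+2)%N = (4 * N)%N by rewrite !expnS /N; lia.
have -> : ((N + N - k.+1).*2.+1 = 4 * N - k.*2.+1)%N by lia.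
rewrite natrB; last by lia.
rewrite !natrM; field; exact: (p20 n).
Qed.

Lemma sum_odd_inv_sqr_bounds n :
  (pi : R) ^+ 2 / 8 - (pi : R) ^+ 2 / 16 * (2 ^ n)%:R^-1 <=
  \sum_(0 <= k < 2 ^ n) (k.*2.+1)%:R ^- 2 <= (pi : R) ^+ 2 / 8.
Proof.
have pi0 := pi_gt0 R; have p20 m : (0 : R) < (2 ^ m)%:R by rewrite ltr0n expn_gt0.
have e k : (k.*2.+1)%:R ^- 2 = pi ^+ 2 / ((2 ^ n)%:R ^+ 2 * 16) * hofbauer_angle n k ^- 2 :> R.
  rewrite /hofbauer_angle.
  have -> : (2 ^ n.+2)%:R = 4 * (2 ^ n)%:R :> R by rewrite !expnS !natrM; ring.
  have k0 : (k.*2.+1)%:R != 0 :> R by rewrite pnatr_eq0.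
  move: (k.*2.+1)%:R k0 (2 ^ n)%:R (lt0r_neq0 (p20 n)) pi (lt0r_neq0 pi0).
  move=> x x0 y y0 z z0; by field; rewrite x0 y0 z0.
have E4 : (4 ^ n)%:R = (2 ^ n)%:R ^+ 2 :> R.
  by rewrite -natrX -expnM mulnC expnM.
under eq_bigr do rewrite e; rewrite -mulr_sumr.
have a0 : 0 <= pi ^+ 2 / ((2 ^ n)%:R ^+ 2 * 16) :> R.
  by rewrite divr_ge0 ?exprn_ge0 ?mulr_ge0 ?exprn_ge0// ltW.
apply/andP; split.
  apply: (@le_trans _ _ (pi ^+ 2 / ((2 ^ n)%:R ^+ 2 * 16) *
     \sum_(0 <= k < 2 ^ n) (sin (hofbauer_angle n k) ^- 2 - 1))).
    rewrite sumrB sum_inv_sqr_sin sumr_const_nat subn0 E4.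
    move: (2 ^ n)%:R (lt0r_neq0 (p20 n)) => y y0.
    by rewrite le_eqVlt; apply/orP; left; apply/eqP; field; rewrite y0.
  rewrite ler_wpM2l// big_nat_cond [leRHS]big_nat_cond; apply: ler_sum => k.
  by rewrite andbT => /andP[_ /hofbauer_angle_bounds/inv_sqr_sin_bounds/andP[]].
apply: (@le_trans _ _ (pi ^+ 2 / ((2 ^ n)%:R ^+ 2 * 16) *
     \sum_(0 <= k < 2 ^ n) sin (hofbauer_angle n k) ^- 2)); last first.
  rewrite sum_inv_sqr_sin E4.
  move: (2 ^ n)%:R (lt0r_neq0 (p20 n)) => y y0.
  by rewrite le_eqVlt; apply/orP; left; apply/eqP; field; rewrite y0.
rewrite ler_wpM2l// big_nat_cond [leRHS]big_nat_cond; apply: ler_sum => k.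
by rewrite andbT => /andP[_ /hofbauer_angle_bounds/inv_sqr_sin_bounds/andP[]].
Qed.

Lemma sum_even_odd (f : nat -> R) N :
  \sum_(0 <= k < N.*2) f k = \sum_(0 <= k < N) f k.*2 + \sum_(0 <= k < N) f k.*2.+1.
Proof.
elim: N => [|N IH]; first by rewrite !big_geq// addr0.
by rewrite doubleS !big_nat_recr//= IH; ring.
Qed.

Lemma cvg_expn2 : (fun n => (2 ^ n)%N) @ \oo --> \oo.
Proof.
apply/cvgnyPge => A; exists A => // n /= An.
by rewrite (leq_trans An)// ltnW// ltn_expl.
Qed.

Lemma cvg_inv_expn2 : (2 ^ n)%:R^-1 @[n --> \oo] --> (0 : R).
Proof.
have -> : (fun n => (2 ^ n)%:R^-1 : R) = (fun n => 2^-1 ^+ n).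
  by apply/funext => n; rewrite natrX exprVn.
apply: cvg_expr; rewrite ger0_norm ?invr_ge0// invf_lt1// ltr1n//.
Qed.

(** The odd terms sum to [pi^2 / 8] and the even terms to a quarter of the whole; [zeta 1] is
    Riemann's zeta at 2. *)
Lemma basel : zeta 1 = pi ^+ 2 / 6 :> R.
Proof.
have e n : w 1 n = n%:R ^- 2 :> R.
  by rewrite -[n%:R ^- 2]exprVn -w0 w_sqr mulr0 add0r.
have odd_cvg : (\sum_(0 <= k < 2 ^ n) (k.*2.+1)%:R ^- 2) @[n --> \oo] --> (pi ^+ 2 / 8 : R).
  apply: (@squeeze_cvgr _ _ _ _ (fun n => pi ^+ 2 / 8 - pi ^+ 2 / 16 * (2 ^ n)%:R^-1)
     (fun=> pi ^+ 2 / 8)).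
  - by apply: nearW => n; exact: sum_odd_inv_sqr_bounds.
  - rewrite -[X in _ --> X]subr0 -[X in _ --> _ - X](mulr0 (pi ^+ 2 / 16)).
    apply: cvgB; first exact: cvg_cst.
    by apply: cvgM; [exact: cvg_cst|exact: cvg_inv_expn2].
  - exact: cvg_cst.
have c1 : series (w 1) @ \oo --> (zeta 1 : R) by exact: w_series_cvg.
have c2 : series (w 1) (2 ^ n)%N @[n --> \oo] --> (zeta 1 : R) := cvg_comp _ _ cvg_expn2 c1.
have c3 : series (w 1) (2 ^ n.+1)%N @[n --> \oo] --> (zeta 1 : R).
  by rewrite (cvg_shiftS (fun n => series (w 1) (2 ^ n)%N)).
have c4 : series (w 1) (2 ^ n.+1)%N @[n --> \oo] --> (4^-1 * zeta 1 + pi ^+ 2 / 8 : R).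
  have -> : (fun n => series (w 1) (2 ^ n.+1)%N) = (fun n =>
      4^-1 * series (w 1) (2 ^ n)%N + \sum_(0 <= k < 2 ^ n) (k.*2.+1)%:R ^- 2) :> (nat -> R).
    apply/funext => n; rewrite /series/= expnS mul2n sum_even_odd mulr_sumr; congr (_ + _).
      apply: eq_bigr => k _; rewrite !e -muln2 natrM exprMn invfM mulrC; congr (_ * _).
      by rewrite expr2 -natrM.
    by apply: eq_bigr => k _; rewrite e.
  by apply: cvgD => //; apply: cvgM => //; exact: cvg_cst.
have e4 : zeta 1 = 4^-1 * zeta 1 + pi ^+ 2 / 8 :> R.
  exact: (cvg_unique (@Rhausdorff R) c3 c4).
by move: e4; move: (zeta 1) (pi ^+ 2) => z q e4; lra.
Qed.

End Basel.

(** * Geometric sums, later with ratio [2^-s], and the logarithmic series *)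

Section Geometric.
Variable R : realType.
Implicit Types (r : R) (j : nat).

Definition geo r j : R := \sum_(0 <= i < j.+1) r ^+ i.

Lemma geo_mul r j : (1 - r) * geo r j = 1 - r ^+ j.+1.
Proof.
rewrite /geo; elim: j => [|j IH]; first by rewrite big_nat1 expr0 expr1 mulr1.
by rewrite big_nat_recr//= mulrDr IH !exprS; ring.
Qed.

Lemma geo_ge1 r j : 0 <= r -> 1 <= geo r j.
Proof.
move=> r0; rewrite /geo big_nat_recl// expr0 lerDl.
by apply: sumr_ge0 => i _; rewrite exprn_ge0.
Qed.

Lemma geo_ge r j : 0 <= r <= 1 -> j.+1%:R * r ^+ j <= geo r j.
Proof.
move=> r01; have -> : j.+1%:R * r ^+ j = \sum_(0 <= i < j.+1) r ^+ j.
  by rewrite sumr_const_nat subn0 mulr_natl.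
rewrite /geo big_nat_cond [leRHS]big_nat_cond; apply: ler_sum => i.
rewrite andbT => /andP[_ ij]; move/andP: r01 => [r0 r1].
by apply: ler_wiXn2l.
Qed.

Lemma geo_le r j : 0 <= r <= 1 -> geo r j <= j.+1%:R.
Proof.
move=> /andP[r0 r1]; have -> : j.+1%:R = \sum_(0 <= i < j.+1) (1 : R).
  by rewrite sumr_const_nat subn0.
by apply: ler_sum => i _; rewrite exprn_ile1.
Qed.

Lemma geo_expn_le r j : 0 <= r <= 1 -> j.+1%:R * r ^+ j * (1 - r) <= 1.
Proof.
move=> r01; have /andP[r0 r1] := r01.
apply: (@le_trans _ _ ((1 - r) * geo r j)).
  by rewrite mulrC ler_wpM2l ?geo_ge// subr_ge0.
by rewrite geo_mul gerBl exprn_ge0.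
Qed.

(** The linear bound is applied at half the exponent and squared; [j + 1 <= 2 (h + 1)] accounts for
    the 4. *)
Lemma geo_expn_sqr_le r j : 0 <= r <= 1 -> r ^+ j * (j.+1%:R * (1 - r)) ^+ 2 <= 4.
Proof.
move=> r01; have /andP[r0 r1] := r01; set h := j./2.
have r10 : 0 <= 1 - r by rewrite subr_ge0.
have h1 := geo_expn_le h r01; set y := _ * _ * _ in h1.
have y0 : 0 <= y by rewrite !mulr_ge0// exprn_ge0.
have h2 : r ^+ j <= r ^+ h * r ^+ h.
  by rewrite -exprD addnn; apply: ler_wiXn2l => //; rewrite -geq_half_double.
have h3 : j.+1%:R * (1 - r) <= 2 * h.+1%:R * (1 - r).
  rewrite ler_wpM2r// -natrM ler_nat mul2n doubleS ltnS.
  by rewrite /h -[X in (X <= _)%N](odd_double_half j); case: odd; rewrite ?add0n// leqnSn.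
have h4 : (j.+1%:R * (1 - r)) ^+ 2 <= (2 * h.+1%:R * (1 - r)) ^+ 2.
  by rewrite ler_sqr ?nnegrE ?mulr_ge0.
apply: (le_trans (ler_pM _ _ h2 h4)); rewrite ?exprn_ge0 ?mulr_ge0//.
have -> : r ^+ h * r ^+ h * (2 * h.+1%:R * (1 - r)) ^+ 2 = 4 * y ^+ 2 by rewrite /y; ring.
by rewrite ler_piMr// exprn_ile1.
Qed.

Lemma sum_geo_diff_le r n : 0 <= r <= 1 ->
  \sum_(0 <= j < n) (1 - r) * r ^+ j <= 1.
Proof.
move=> /andP[r0 r1]; rewrite -mulr_sumr; case: n => [|n]; first by rewrite big_geq// mulr0.
by rewrite geo_mul gerBl exprn_ge0.
Qed.

(** The summands are the masses of a negative binomial law. With the geometric law they bound the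
    variation of [F] independently of [s]. *)
Lemma sum_geo_diff_sqr_le r n : 0 <= r <= 1 ->
  \sum_(0 <= j < n) (1 - r) ^+ 2 * (j.+1%:R * r ^+ j) <= 1.
Proof.
move=> /andP[r0 r1].
have -> : \sum_(0 <= j < n) (1 - r) ^+ 2 * (j.+1%:R * r ^+ j) =
    1 - (n.+1%:R * r ^+ n * (1 - r) + r ^+ n.+1).
  elim: n => [|n IH]; first by rewrite big_geq// expr0 expr1; ring.
  rewrite big_nat_recr//= IH !exprS.
  have -> : n.+2%:R = n.+1%:R + 1 :> R by rewrite natr1.
  by ring.
by rewrite gerBl addr_ge0 ?mulr_ge0 ?exprn_ge0// subr_ge0.
Qed.

Lemma is_derive_ln_1B (t : R) : t < 1 ->
  is_derive t 1 (fun t : R => ln (1 - t)) (- (1 - t)^-1).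
Proof.
rewrite -subr_gt0 => t1.
have dt : is_derive t 1 (fun t : R => 1 - t) (-1).
  by apply: is_derive_eq; rewrite add0r mul1r.
have := @is_derive1_comp R (@ln R) (fun t : R => 1 - t) t _ _ (is_derive1_ln t1) dt.
by rewrite mulrN1.
Qed.

(** The partial sum plus [ln (1 - t)] has derivative [- t^n / (1 - t)], so the mean value theorem
    bounds the remainder by [r^n / (1 - r)]. *)
Lemma cvg_log_series r : 0 <= r < 1 ->
  series (fun j => r ^+ j.+1 / j.+1%:R) @ \oo --> - ln (1 - r).
Proof.
move=> /andP[r0 r1]; have r10 : 0 < 1 - r by rewrite subr_gt0.
have cr : (fun n => r ^+ n / (1 - r)) @ \oo --> 0.
  rewrite -(mul0r (1 - r)^-1); apply: cvgM; last exact: cvg_cst.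
  by apply: cvg_expr; rewrite ger0_norm.
suff H n : `|- ln (1 - r) - series (fun j => r ^+ j.+1 / j.+1%:R) n| <= r ^+ n / (1 - r).
  apply/cvgrPdist_le => e e0; move/cvgr0Pnorm_le : cr => /(_ e e0).
  by apply: filterS => n; apply: le_trans; rewrite [leRHS]ger0_norm ?divr_ge0 ?exprn_ge0// ltW.
pose f (t : R) : R := \sum_(0 <= j < n) t ^+ j.+1 / j.+1%:R + ln (1 - t).
have ds (t : R) : is_derive t 1 (fun t : R => \sum_(0 <= j < n) t ^+ j.+1 / j.+1%:R)
    (\sum_(0 <= j < n) t ^+ j).
  elim: n {f} => [|n IH].
    rewrite big_geq// (_ : (fun _ => _) = cst 0); first exact: is_derive_cst.
    by apply/funext => u; rewrite big_geq.
  rewrite big_nat_recr//= (_ : (fun _ => _) = (fun u : R => \sum_(0 <= j < n) u ^+ j.+1 / j.+1%:R)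
      + n.+1%:R^-1 *: (@id R ^+ n.+1)); last first.
    by apply/funext => u; rewrite big_nat_recr//= fctE scalrfctE exprfctE /GRing.scale/= mulrC.
  have -> : t ^+ n = n.+1%:R^-1 *: ((n.+1%:R * t ^+ n) *: 1).
    by rewrite /GRing.scale/= mulr1 mulrA mulVf ?mul1r// pnatr_eq0.
  apply: is_deriveD; apply: is_deriveZ; exact: is_deriveX.
have df (t : R) : t \in `]0, r[%R -> is_derive t 1 f (- (t ^+ n / (1 - t))).
  rewrite in_itv/= => /andP[t0 tr]; have t1 : 0 < 1 - t by lra.
  have tr1 : t < 1 by lra.
  have dl := is_derive_ln_1B tr1.
  have := is_deriveD (ds t) dl; rewrite /f.
  have -> : \sum_(0 <= j < n) t ^+ j + - (1 - t)^-1 = - (t ^+ n / (1 - t)).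
    have : (1 - t) * (\sum_(0 <= j < n) t ^+ j) = 1 - t ^+ n.
      case: (n) => [|k]; first by rewrite big_geq// mulr0 expr0 subrr.
      exact: geo_mul.
    move=> h; apply: (mulfI (lt0r_neq0 t1)); rewrite mulrDr h; field; exact: lt0r_neq0.
  by [].
have cf : {within `[0, r], continuous f}.
  apply: continuous_in_subspaceT => t; rewrite inE/= in_itv/= => /andP[t0 tr].
  have t1 : 0 < 1 - t by lra.
  have tr1 : t < 1 by lra.
  have dl := is_derive_ln_1B tr1.
  apply: differentiable_continuous; apply/derivable1_diffP.
  by apply: ex_derive; exact: is_deriveD (ds t) dl.
have [c] := MVT_segment r0 df cf; rewrite in_itv/= => /andP[c0 cr1].
have -> : f 0 = 0.
  rewrite /f subr0 ln1 addr0 big1// => j _; by rewrite expr0n mul0r.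
rewrite !subr0 => e.
have -> : - ln (1 - r) - series (fun j => r ^+ j.+1 / j.+1%:R) n = - f r.
  by rewrite /f /series/=; ring.
have c1 : 0 < 1 - c by lra.
rewrite e mulNr opprK ger0_norm; last by rewrite !mulr_ge0 ?exprn_ge0 ?invr_ge0// ltW.
apply: (@le_trans _ _ (c ^+ n / (1 - c))).
  by rewrite ler_piMr ?(ltW r1)// divr_ge0 ?exprn_ge0 ?(ltW c1).
apply: ler_pM; rewrite ?exprn_ge0 ?invr_ge0 ?(ltW c1)//.
  by rewrite lerXn2r.
by rewrite lef_pV2 ?posrE//; lra.
Qed.

End Geometric.

(** * Zeta and the full product over the primes as [s] tends to 0 *)

Section ZetaNearOne.
Variable R : realType.
Implicit Types (s : R) (n j k : nat).

Lemma cvg_npow (t : nat -> R) s n : t @ \oo --> s ->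
  npow (t i) n @[i --> \oo] --> npow s n.
Proof.
move=> ts; apply: continuous_cvg; first exact: continuous_expR.
by apply: cvgM; [exact: cvgN | exact: cvg_cst].
Qed.

Lemma cvg_w (t : nat -> R) s n : t @ \oo --> s -> w (t i) n @[i --> \oo] --> w s n.
Proof. by move=> ts; apply: cvgM; [exact: cvg_cst | exact: cvg_npow]. Qed.

Lemma npow2_lt1 s : 0 < s -> npow s 2 < 1.
Proof. by move=> s0; rewrite expR_lt1 mulNr oppr_lt0 mulr_gt0// ln_gt0// ltr1n. Qed.

Lemma npow2_bounds s : 0 <= s -> 0 <= npow s 2 <= 1.
Proof. by move=> s0; rewrite npow_ge0 npow_le1. Qed.

Lemma cvg_npow_expn2 s : 0 < s -> npow s (2 ^ k) @[k --> \oo] --> (0 : R).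
Proof.
move=> s0; have -> : (fun k => npow s (2 ^ k)) = (fun k => npow s 2 ^+ k).
  by apply/funext => k; rewrite npow_expn.
by apply: cvg_expr; rewrite ger0_norm ?npow_ge0// npow2_lt1.
Qed.

(** The simple pole with residue 1, obtained by telescoping [n^-s - (n+1)^-s <= s n^-(1+s)]. *)
Lemma zeta_mul_bounds s : 0 < s -> 1 <= s * zeta s <= 1 + s.
Proof.
move=> s0; apply/andP; split; last first.
  have := ler_wpM2l (ltW s0) (zeta_le s0).
  by rewrite mulrDr mulr1 divff ?gt_eqF// addrC.
have H N : 1 - npow s N.+1 <= s * zeta s.
  apply: (@le_trans _ _ (s * series (w s) N.+1)); last first.
    rewrite ler_wpM2l ?(ltW s0)//; apply: series_le_lim; first by move=> n; exact: w_ge0.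
    exact: w_series_cvg.
  elim: N => [|N IH]; first by rewrite /series/= big_nat1 w_0 mulr0 npow1 subrr.
  rewrite seriesSr mulrDr.
  have /andP[_ h] := npowS_sub (ltW s0) (ltn0Sn N); lra.
have c : 1 - npow s (2 ^ k) @[k --> \oo] --> (1 : R).
  rewrite -[X in _ --> X]subr0; apply: cvgB; first exact: cvg_cst.
  exact: cvg_npow_expn2.
rewrite -(cvg_lim (@Rhausdorff R) c); apply: limr_le; first by apply/cvg_ex; exists 1.
apply: nearW => k; have : (0 < 2 ^ k)%N by rewrite expn_gt0.
by case: (2 ^ k)%N => // N _; exact: H.
Qed.

Lemma cvg_mul_zeta (t : nat -> R) : (forall i, 0 < t i) -> t @ \oo --> 0 ->
  t i * zeta (t i) @[i --> \oo] --> (1 : R).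
Proof.
move=> t0 ct; apply: (@squeeze_cvgr _ _ _ _ (fun=> 1) (fun i => 1 + t i)).
- by apply: nearW => i; exact: zeta_mul_bounds.
- exact: cvg_cst.
- by rewrite -[X in _ --> X]addr0; apply: cvgD => //; exact: cvg_cst.
Qed.

Lemma cvg_zeta_two (t : nat -> R) : (forall i, 0 < t i) -> t @ \oo --> 0 ->
  zeta (2 * t i + 1) @[i --> \oo] --> zeta (1 : R).
Proof.
move=> t0 ct.
have ct2 : 2 * t i + 1 @[i --> \oo] --> (1 : R).
  rewrite -[X in _ --> X]add0r -[X in _ --> X + _](mulr0 2).
  by apply: cvgD; [apply: cvgM => //; exact: cvg_cst | exact: cvg_cst].
have [i n||n|i|L cL lL] := @tannery R (fun i => w (2 * t i + 1)) (w 1) (w 1)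
  (fun i => zeta (2 * t i + 1)).
- by rewrite ger0_norm ?w_ge0//; apply: w_anti; have := t0 i; lra.
- exact: w_series_cvg.
- exact: cvg_w.
- by apply: w_series_cvg; have := t0 i; lra.
by rewrite /zeta (cvg_lim (@Rhausdorff R) cL).
Qed.

(* [Vinf s] is the product of [(1 + p ^ -(1 + s))^-1] over all primes. *)
Definition Vinf s : R := zeta (2 * s + 1) / zeta s.

Lemma Vinf_gt0 s : 0 < s -> 0 < Vinf s.
Proof.
move=> s0; rewrite divr_gt0//; first by apply: lt_le_trans (zeta_ge1 _) => //; lra.
by apply: lt_le_trans (zeta_ge1 _).
Qed.

Lemma cvg_Vinf_div (t : nat -> R) : (forall i, 0 < t i) -> t @ \oo --> 0 ->
  Vinf (t i) / t i @[i --> \oo] --> zeta (1 : R).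
Proof.
move=> t0 ct.
have -> : (fun i => Vinf (t i) / t i) =
    (fun i => zeta (2 * t i + 1) * (t i * zeta (t i))^-1).
  by apply/funext => i; rewrite /Vinf invfM; ring.
rewrite -[zeta 1]mulr1 -[X in zeta 1 * X]invr1; apply: cvgM; first exact: cvg_zeta_two.
by apply: cvgV => //; exact: cvg_mul_zeta.
Qed.

Lemma cvg_npow2_sub (t : nat -> R) : (forall i, 0 < t i) -> t @ \oo --> 0 ->
  (1 - npow (t i) 2) / t i @[i --> \oo] --> (ln 2 : R).
Proof.
move=> t0 ct; have l0 : 0 < ln 2 :> R by rewrite ln_gt0// ltr1n.
apply: (@squeeze_cvgr _ _ _ _ (fun i => ln 2 / (1 + t i * ln 2)) (fun=> ln 2)).
- apply: nearW => i; have ti := t0 i; set x := t i * ln 2.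
  have x0 : 0 < x by rewrite mulr_gt0.
  have e : npow (t i) 2 = expR (- x) by rewrite /npow mulNr.
  rewrite e; apply/andP; split.
    rewrite ler_pdivlMr// mulrAC -/x.
    have -> : ln 2 * t i = x by rewrite mulrC.
    rewrite ler_pdivrMr ?ltr_wpDl//.
    have h := @expR_ge1Dx R x.
    have h2 : expR (- x) * expR x = 1 by rewrite -expRD addNr expR0.
    have h3 := ler_wpM2l (expR_ge0 (- x)) h; rewrite h2 in h3.
    lra.
  rewrite ler_pdivrMr// mulrC -/x; have := @expR_ge1Dx R (- x); lra.
- suff : ln 2 / (1 + t i * ln 2) @[i --> \oo] --> ln 2 / (1 + 0 * ln 2).
    by rewrite mul0r addr0 divr1.
  apply: cvgM; first exact: cvg_cst.
  apply: cvgV; first by rewrite mul0r addr0.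
  by apply: cvgD; [exact: cvg_cst | apply: cvgM => //; exact: cvg_cst].
- exact: cvg_cst.
Qed.

End ZetaNearOne.

(** * Passing between integers and dyadic blocks *)

Section DyadicBounds.
Variable R : realType.
Implicit Types (s : R) (n j k : nat).

Lemma npow_dyadic_bounds s n : 0 <= s -> (0 < n)%N ->
  npow s 2 ^+ (trunc_log 2 n).+1 <= npow s n <= npow s 2 ^+ trunc_log 2 n.
Proof.
move=> s0 n0; have /andP[h1 h2] := trunc_log_bounds (ltnSn 1) n0.
by rewrite -!npow_expn !npow_le ?expn_gt0// ltnW.
Qed.

Lemma trunc_log_bucket j n : (2 ^ j <= n < 2 ^ j.+1)%N -> trunc_log 2 n = j.
Proof. exact: trunc_log_eq. Qed.

Lemma inv_nat_le_bucket n : (0 < n)%N -> (n%:R^-1 : R) <= (trunc_log 2 n).+1%:R^-1.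
Proof.
move=> n0; rewrite lef_pV2 ?posrE ?ltr0n// ler_nat.
have /andP[h1 _] := trunc_log_bounds (ltnSn 1) n0.
by rewrite (leq_trans _ h1)// ltn_expl.
Qed.

Lemma dyadic_series_cvg (f u : nat -> R) : f 0%N = 0 -> (forall n, 0 <= f n) ->
  (forall j, \sum_((2 ^ j)%N <= n < (2 ^ j.+1)%N) f n <= u j) ->
  cvgn (series u) -> cvgn (series f).
Proof.
move=> f0 fge fu cu.
have u0 j : 0 <= u j by apply: le_trans (fu j); apply: sumr_ge0.
apply: (@nonneg_bounded_series_cvg _ _ (limn (series u))) => // n.
apply: (@le_trans _ _ (series f (2 ^ n)%N)).
  have /nondecreasing_seqP := nondecreasing_series (P := xpredT) (m := 0) (fun n _ _ => fge n).
  move=> /nondecreasing_seqP h; apply: h; exact/ltnW/ltn_expl.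
rewrite series_dyadic//; apply: le_trans (series_le_lim n u0 cu).
by apply: ler_sum => j _.
Qed.

(** Stands for [1 / (p log p)], the summable majorant in every comparison over the primes. *)
Definition prime_tail n : R := if prime n then n%:R^-1 / (trunc_log 2 n).+1%:R else 0.

Lemma prime_tail_cvg : cvgn (series prime_tail).
Proof.
have [K K0 HK] := prec_bounded R.
apply: (@dyadic_series_cvg _ (fun j => K * j.+1%:R ^- 2)) => //.
- by move=> n; rewrite /prime_tail; case: ifP => // _; rewrite divr_ge0.
- move=> j; apply: (@le_trans _ _ (prec R j / j.+1%:R)); last first.
    by apply: le_trans (ler_wpM2r _ (HK j)) _ => //; rewrite expr2 invfM mulrA.
  rewrite /prec mulr_suml [leRHS]big_mkcond [leLHS]big_nat_cond [leRHS]big_nat_cond.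
  apply: ler_sum => n /andP[/trunc_log_bucket e _].
  by rewrite /prime_tail e; case: ifP.
- by apply: is_cvg_seriesZ; exact: sum_inv_sqr_cvg.
Qed.

End DyadicBounds.

(** * Logarithms of the product over the primes *)

Section MertensThird.
Variable R : realType.
Implicit Types (s : R) (n j k : nat).

Lemma ln1D_bounds (x : R) : 0 <= x -> x - x ^+ 2 <= ln (1 + x) <= x.
Proof.
move=> x0; apply/andP; split; last by rewrite le_ln1Dx// (lt_le_trans _ x0)// ltrN10.
have x1 : 0 < 1 + x by lra.
rewrite -[leRHS]opprK lerNr -lnV ?posrE//.
have -> : (1 + x)^-1 = 1 + - (x / (1 + x)) by field; lra.
apply: le_trans (le_ln1Dx _) _; first by rewrite ltrN2 ltr_pdivrMr//; lra.
rewrite opprB -subr_ge0 (_ : _ - _ = x ^+ 3 / (1 + x)); last by field; lra.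
by rewrite divr_ge0 ?exprn_ge0// ltW.
Qed.

Definition prime_log s n : R := if prime n then ln (1 + w s n) else 0.

Lemma series_prime_log s N : 0 <= s -> series (prime_log s) N = - ln (V s N).
Proof.
move=> s0; rewrite /V; elim: N => [|N IH].
  by rewrite /series/= !big_geq// ln1 oppr0.
rewrite seriesSr IH [in RHS]big_mkcond big_nat_recr//= -big_mkcond/= /prime_log.
have h : 0 < 1 + w s N by rewrite ltr_pwDl// w_ge0.
case: ifP => _; last by rewrite mulr1 addr0.
by rewrite lnM ?posrE ?invr_gt0//; [rewrite lnV ?posrE// opprD opprK | exact: V_gt0].
Qed.

Lemma cvg_series_prime_log s : 0 < s -> series (prime_log s) @ \oo --> - ln (Vinf s).
Proof.
move=> s0; have -> : series (prime_log s) = (fun N => - ln (V s N)).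
  by apply/funext => N; rewrite series_prime_log// ltW.
apply: cvgN; apply: continuous_cvg; last exact: V_cvg.
by apply: continuous_ln; exact: Vinf_gt0.
Qed.

(** Replacing [p^-s] by a power of [2^-s] that is constant on each block turns the sum over primes
    into a power series in [2^-s]. *)
Definition dyadic_log s n : R := prime_log 0 n * npow s 2 ^+ (trunc_log 2 n).+1.

(** With [r = 2^-s], two errors occur, each at most [1 / (p (k+1))]: within a block [p^-s] varies by
    at most [r^k (1 - r) <= 1/(k+1)], and the quadratic error of [ln (1 + x)] is at most [1/p^2].
    The bound is uniform in [s]. *)
Lemma prime_log_approx s n : 0 <= s ->
  `|prime_log s n - dyadic_log s n| <= 2 * prime_tail R n.
Proof.
move=> s0; rewrite /dyadic_log /prime_log /prime_tail; case: ifP => pn; last first.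
  by rewrite mul0r subr0 normr0 mulr0.
have n0 := prime_gt0 pn; rewrite w0 /w.
have /andP[q1 q2] := npow_dyadic_bounds s0 n0.
have hk := inv_nat_le_bucket R n0.
set k := trunc_log 2 n in q1 q2 hk *; set q := npow s n in q1 q2 *.
have r01 := npow2_bounds s0; have /andP[r0 r1] := r01.
have hr := geo_expn_le k r01.
set r := npow s 2 in r0 r1 hr q1 q2 *.
set x : R := n%:R^-1 in hk *; have x0 : 0 <= x by rewrite invr_ge0.
have q0 : 0 <= q by exact: npow_ge0.
have q1' : q <= 1 by exact: npow_le1.
have rk0 : 0 <= r ^+ k.+1 by rewrite exprn_ge0.
have rk1 : r ^+ k.+1 <= 1 by rewrite exprn_ile1.
have /andP[a1 a2] := ln1D_bounds (mulr_ge0 x0 q0).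
have /andP[b1 b2] := ln1D_bounds x0.
have hrk : r ^+ k * (1 - r) <= k.+1%:R^-1.
  by rewrite -[leRHS]mul1r ler_pdivlMr// mulrC mulrA.
have e1 : q - r ^+ k.+1 <= k.+1%:R^-1.
  apply: le_trans hrk; rewrite mulrBr mulr1 -exprSr; lra.
have hx := ler_wpM2l x0 hk; have he := ler_wpM2l x0 e1.
have hb1 := ler_wpM2r rk0 b1; have hb2 := ler_wpM2r rk0 b2.
have xx : x * x * r ^+ k.+1 <= x * x by rewrite ler_piMr ?mulr_ge0.
have xq : (x * q) ^+ 2 <= x * x.
  by rewrite exprMn -expr2 ler_piMr ?exprn_ge0// exprn_ile1.
have xr : x * r ^+ k.+1 <= x * q by rewrite ler_wpM2l.
have xk0 : 0 <= x / k.+1%:R by rewrite mulr_ge0.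
rewrite ler_norml; move: xq hb1 a1; rewrite !expr2 => xq hb1 a1.
move: hx he hb2 xx xr xk0 xq hb1 a1 a2; clear; clearbody x q r k.
move: (x / _) (r ^+ _) (ln (1 + x * q)) (ln (1 + x)) => z rho A B *.
by apply/andP; split; lra.
Qed.

Lemma cvg_dyadic_log s : 0 < s -> cvgn (series (dyadic_log s)).
Proof.
move=> s0; apply: (@dominated_series_cvg _ _ (w s)); last exact: w_series_cvg.
move=> n; rewrite /dyadic_log /prime_log; case: ifP => pn; last first.
  by rewrite mul0r normr0 w_ge0.
have n0 := prime_gt0 pn; rewrite w0.
have /andP[q1 _] := npow_dyadic_bounds (ltW s0) n0.
have x0 : 0 <= n%:R^-1 :> R by rewrite invr_ge0.
have /andP[_ b2] := ln1D_bounds x0.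
rewrite ger0_norm; last first.
  by rewrite mulr_ge0 ?exprn_ge0 ?npow_ge0// ln_ge0// lerDl.
by apply: ler_pM => //; rewrite ?exprn_ge0 ?npow_ge0// ln_ge0// lerDl.
Qed.

Definition log_defect j : R :=
  \sum_((2 ^ j)%N <= n < (2 ^ j.+1)%N) prime_log 0 n - j.+1%:R^-1.

Lemma log_defect_cvg : cvgn (series log_defect).
Proof.
pose u n : R := if prime n then n%:R^-1 - prime_log 0 n else 0.
have u0 n : 0 <= u n <= n%:R ^- 2.
  rewrite /u /prime_log; case: ifP => pn; last by rewrite lexx invr_ge0 exprn_ge0.
  have x0 : 0 <= n%:R^-1 :> R by rewrite invr_ge0.
  rewrite pn w0 -exprVn; have /andP[h1 h2] := ln1D_bounds x0.
  by apply/andP; split; [rewrite subr_ge0 | rewrite lerBlDr -lerBlDl].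
have cu : cvgn (series u).
  apply: (@dominated_series_cvg _ _ (w 1)); last exact: w_series_cvg.
  move=> n; have /andP[h1 h2] := u0 n; rewrite ger0_norm// (le_trans h2)//.
  by rewrite -exprVn -w0 w_sqr mulr0 add0r.
have -> : log_defect = (fun j => prec R j - j.+1%:R^-1) -
    (fun j => \sum_((2 ^ j)%N <= n < (2 ^ j.+1)%N) u n).
  apply/funext => j; rewrite !fctE /log_defect.
  suff -> : \sum_((2 ^ j)%N <= n < (2 ^ j.+1)%N) prime_log 0 n =
      prec R j - \sum_((2 ^ j)%N <= n < (2 ^ j.+1)%N) u n by ring.
  rewrite /prec [X in _ = X - _]big_mkcond -sumrB; apply: eq_bigr => n _; rewrite /u /prime_log.
  by case: ifP => _; [rewrite subKr | rewrite subr0].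
apply: is_cvg_seriesB; first exact: mertens_second.
have c2 := cvg_comp _ _ cvg_expn2 cu.
apply/cvg_ex; exists (limn (series u)); apply: cvg_trans c2.
by apply: near_eq_cvg; apply: nearW => J /=; rewrite series_dyadic.
Qed.

End MertensThird.

(** * Mertens' third theorem *)

Section MertensConstant.
Variable R : realType.
Implicit Types (s : R) (n j k : nat).

(** The sequence along which [s] tends to 0. Its values stay in [(0, 1]], where the uniform
    estimates hold. *)
Definition sg (i : nat) : R := i.+1%:R^-1.

Lemma sg_gt0 i : 0 < sg i. Proof. by rewrite invr_gt0. Qed.

Lemma sg_le1 i : sg i <= 1. Proof. by rewrite invf_le1 ?ler1n. Qed.

Lemma cvg_sg : sg @ \oo --> 0. Proof. exact: cvg_harmonic. Qed.

Lemma euler_gamma_cvg :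
  (fun n : nat => \sum_(1 <= k < n.+1) k%:R^-1 - ln n%:R) @ \oo --> euler_gamma R.
Proof.
set u := (fun n : nat => _).
have ge1 n : ln n.+1%:R <= \sum_(1 <= k < n.+1) k%:R^-1 :> R.
  elim: n => [|n IH]; first by rewrite ln1 big_geq.
  rewrite big_nat_recr//=; have /andP[_ h] := @lnS_sub R _ (ltn0Sn n).
  by apply: le_trans (lerD IH (lexx _)); rewrite -lerBlDl.
suff : cvgn u by [].
(* Since [ln 0 = 0], [u 0 = 0] lies below [u 1 = 1]; the sequence decreases only from 1 on. *)
suff : cvgn (fun n => u n.+1).
  by move=> /cvg_ex[l hl]; apply/cvg_ex; exists l; rewrite -(cvg_shiftS u).
apply: nonincreasing_is_cvgn.
  apply/nonincreasing_seqP => n; rewrite /u [X in X - _ <= _]big_nat_recr//=.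
  have /andP[h _] := @lnS_sub R _ (ltn0Sn n).
  by rewrite -addrA lerD2l lerBlDl.
exists 0 => _ [n _ <-]; rewrite /u subr_ge0; apply: (le_trans _ (ge1 n.+1)).
by rewrite ler_ln_nat.
Qed.

Let r i : R := npow (sg i) 2.

Let r_lt1 i : r i < 1. Proof. exact/npow2_lt1/sg_gt0. Qed.

Let r01 i : 0 <= r i <= 1. Proof. exact/npow2_bounds/ltW/sg_gt0. Qed.

Let P i : R := limn (series (dyadic_log (sg i))).

(** Abel's theorem with weights [r^(j+1)]: the damped sum of [1/(j+1)] is [- ln (1 - r)], the damped
    sum of the logarithms is [P i]. *)
Lemma log_defect_abel : P i + ln (1 - r i) @[i --> \oo] --> limn (series (log_defect R)).
Proof.
rewrite -[limn _]mulr1.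
apply: (@abel_bounded_variation _ (log_defect R) _ (fun i j => r i ^+ j.+1) 1).
- exact: log_defect_cvg.
- move=> i n; apply: le_trans (sum_geo_diff_le n (r01 i)).
  apply: ler_sum => k _; have /andP[r0 r1] := r01 i.
  rewrite [r i ^+ k.+2]exprS -[X in _ - X]mul1r -mulrBl normrM distrC.
  rewrite [X in X * _]ger0_norm ?subr_ge0// [X in _ * X]ger0_norm ?exprn_ge0//.
  rewrite ler_wpM2l ?subr_ge0// exprS.
  by rewrite ler_piMl// exprn_ge0.
- move=> k; rewrite (_ : (fun i => r i ^+ k.+1) = fun i => npow (sg i) (2 ^ k.+1)).
    by rewrite -(npow0 R (2 ^ k.+1)); apply: cvg_npow; exact: cvg_sg.
  by apply/funext => i; rewrite npow_expn.
- move=> i.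
  have -> : (fun j => log_defect R j * r i ^+ j.+1) =
    (fun j => \sum_((2 ^ j)%N <= n < (2 ^ j.+1)%N) dyadic_log (sg i) n) -
    (fun j => r i ^+ j.+1 / j.+1%:R).
    apply/funext => j; rewrite !fctE /log_defect mulrBl mulr_suml [X in _ - X]mulrC.
    congr (_ - _); rewrite big_nat_cond [RHS]big_nat_cond; apply: eq_bigr => n.
    by move=> /andP[/trunc_log_bucket e _]; rewrite /dyadic_log e.
  rewrite -[ln _]opprK.
  have c1 := cvg_comp _ _ cvg_expn2 (cvg_dyadic_log (sg_gt0 i)).
  have c2 : series (fun j => r i ^+ j.+1 / j.+1%:R) @ \oo --> - ln (1 - r i).
    by apply: cvg_log_series; rewrite r_lt1; have /andP[->] := r01 i.
  rewrite (_ : series _ = (fun J => series (dyadic_log (sg i)) (2 ^ J)%N -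
    series (fun j => r i ^+ j.+1 / j.+1%:R) J)); first exact: cvgB.
  apply/funext => J; rewrite series_dyadic; first by rewrite /series/= -sumrB.
  by rewrite /dyadic_log /prime_log mul0r.
Qed.

Lemma cvg_prime_log n : prime_log (sg i) n @[i --> \oo] --> prime_log (0 : R) n.
Proof.
rewrite /prime_log; case: ifP => _; last exact: cvg_cst.
apply: continuous_cvg; first by apply: continuous_ln; rewrite ltr_pwDl// w_ge0.
by apply: cvgD; [exact: cvg_cst | apply: cvg_w; exact: cvg_sg].
Qed.

Lemma prime_log_dyadic_cvg : - ln (Vinf (sg i)) - P i @[i --> \oo] --> 0.
Proof.
have cpl := cvg_prime_log.
have [i n||n|i|L cL lL] := @tannery R
  (fun i => prime_log (sg i) - dyadic_log (sg i)) (fun n => 2 * prime_tail R n)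
  (fun=> 0) (fun i => - ln (Vinf (sg i)) - P i).
- exact/prime_log_approx/ltW/sg_gt0.
- by apply: is_cvg_seriesZ; exact: prime_tail_cvg.
- rewrite -[X in _ --> X](subrr (prime_log 0 n)); apply: cvgB => //.
  rewrite -[X in _ --> X]mulr1; apply: cvgM; first exact: cvg_cst.
  rewrite (_ : (fun i => _) = fun i => npow (sg i) (2 ^ (trunc_log 2 n).+1)).
    by rewrite -(npow0 R (2 ^ (trunc_log 2 n).+1)); apply: cvg_npow; exact: cvg_sg.
  by apply/funext => i; rewrite npow_expn.
- rewrite (_ : series _ = series (prime_log (sg i)) - series (dyadic_log (sg i))).
    apply: cvgB; first exact/cvg_series_prime_log/sg_gt0.
    exact/cvg_dyadic_log/sg_gt0.
  by rewrite seriesD seriesN.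
- suff <- : L = 0 by [].
  apply: (cvg_unique (@Rhausdorff R) cL).
  rewrite (_ : series _ = fun=> 0); first exact: cvg_cst.
  by apply/funext => n; rewrite /series/= big1.
Qed.

(** Both [1 - 2^-s] and [Vinf s] vanish to first order at [s = 0], with slopes [ln 2] and [zeta 1];
    the quotient has a limit, which evaluates the undamped series. *)
Lemma sum_log_defect : limn (series (log_defect R)) = ln (ln 2 / zeta 1).
Proof.
have l0 : 0 < ln 2 :> R by rewrite ln_gt0// ltr1n.
have z0 : 0 < zeta 1 :> R by exact: lt_le_trans (zeta_ge1 _).
have c1 : - ln (Vinf (sg i)) + ln (1 - r i) @[i --> \oo] --> limn (series (log_defect R)).
  rewrite -[X in _ --> X]add0r.
  rewrite (_ : (fun i => _) = fun i => (- ln (Vinf (sg i)) - P i) + (P i + ln (1 - r i))).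
    by apply: cvgD; [exact: prime_log_dyadic_cvg | exact: log_defect_abel].
  by apply/funext => i; ring.
apply: (cvg_unique (@Rhausdorff R) c1).
rewrite (_ : (fun i => _) = fun i => ln (((1 - r i) / sg i) / (Vinf (sg i) / sg i))).
  apply: continuous_cvg; first by apply: continuous_ln; rewrite divr_gt0.
  apply: cvgM; first exact: cvg_npow2_sub sg_gt0 cvg_sg.
  by apply: cvgV; [rewrite gt_eqF | exact: cvg_Vinf_div sg_gt0 cvg_sg].
apply/funext => i; have s0 := sg_gt0 i; have V0 := Vinf_gt0 s0.
have r1 : 0 < 1 - r i by rewrite subr_gt0.
have -> : (1 - r i) / sg i / (Vinf (sg i) / sg i) = (1 - r i) / Vinf (sg i).
  by field; rewrite !gt_eqF.
by rewrite addrC; apply/esym/ln_div; rewrite posrE.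
Qed.

(** Truncated at [2^J], the logarithm of the product is the partial sum of [log_defect] plus a
    harmonic number, that is [ln J] plus Euler's constant in the limit. *)
Lemma mertens_third :
  V 0 (2 ^ J) * J%:R @[J --> \oo] --> zeta 1 / ln 2 * expR (- euler_gamma R).
Proof.
have l0 : 0 < ln 2 :> R by rewrite ln_gt0// ltr1n.
have z0 : 0 < zeta 1 :> R by exact: lt_le_trans (zeta_ge1 _).
have -> : zeta 1 / ln 2 * expR (- euler_gamma R) =
    expR (- ln (ln 2 / zeta 1) - euler_gamma R) :> R.
  by rewrite expRD -lnV ?posrE ?divr_gt0// lnK ?posrE ?invr_gt0 ?divr_gt0// invf_div.
have c : expR (- series (log_defect R) J - (\sum_(1 <= k < J.+1) k%:R^-1 - ln J%:R))
    @[J --> \oo] --> expR (- ln (ln 2 / zeta 1) - euler_gamma R).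
  apply: continuous_cvg; first exact: continuous_expR.
  apply: cvgB; last exact: euler_gamma_cvg.
  by apply: cvgN; rewrite -sum_log_defect; exact: log_defect_cvg.
apply: cvg_trans c; apply: near_eq_cvg; exists 1 => // J /= J0.
have -> : series (log_defect R) J = - ln (V 0 (2 ^ J)) - \sum_(1 <= k < J.+1) k%:R^-1.
  rewrite -series_prime_log// series_dyadic// /series/= sumrB; congr (_ - _).
  by rewrite big_add1.
have V0 : 0 < V (0 : R) (2 ^ J) by exact: V_gt0.
have -> : - (- ln (V 0 (2 ^ J)) - \sum_(1 <= k < J.+1) k%:R^-1) -
  (\sum_(1 <= k < J.+1) k%:R^-1 - ln J%:R) = ln (V 0 (2 ^ J)) + ln J%:R :> R by ring.
by rewrite expRD !lnK ?posrE// ltr0n.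
Qed.

End MertensConstant.

(** * Uniform estimates as [s] tends to 0 *)

Section UniformEstimates.
Variable R : realType.
Implicit Types (s : R) (n j k N P q : nat).

(** The mean of the logarithm of the product of the kept primes between [P] and [N]: each
    contributes [ln p] with probability [w / (1 + w)]. *)
Definition B s P N : R :=
  \sum_(0 <= p < N | prime p && (P < p)%N) ln p%:R * (w s p / (1 + w s p)).

Definition B1 s N : R := \sum_(0 <= p < N | prime p) ln p%:R * w s p.

Lemma big_nat_cond_split (a b c : nat) (Q : pred nat) (F : nat -> R) :
  (a <= b)%N -> (b <= c)%N ->
  \sum_(a <= i < c | Q i) F i = \sum_(a <= i < b | Q i) F i + \sum_(b <= i < c | Q i) F i.
Proof. by move=> ab bc; rewrite (@big_cat_nat _ _ _ b). Qed.

(** Dropping the denominator, or restoring a prime [p <= P], costs at most [(P+1) ln p / p^2]; the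
    sum of [ln p / p^2] is at most 6. *)
Lemma B1_sub_B s P N : 0 <= s -> 0 <= B1 s N - B s P N <= 6 * P.+1%:R.
Proof.
move=> s0; rewrite /B1 /B big_mkcondr/= -sumrB.
have H p : prime p -> 0 <= ln p%:R * w s p -
    (if (P < p)%N then ln p%:R * (w s p / (1 + w s p)) else 0) <=
    P.+1%:R * (ln p%:R / p%:R ^+ 2).
  move=> pp; have p0 : 0 < p%:R :> R by rewrite ltr0n prime_gt0.
  have l0 := ln_nat_ge0 R p; have w0' := w_ge0 s p; have wV := w_leV p s0.
  have lp0 : 0 <= ln p%:R / p%:R ^+ 2 :> R by rewrite divr_ge0 ?exprn_ge0// ltW.
  case: ifPn => Pp.
    rewrite -mulrBr.
    have -> : w s p - w s p / (1 + w s p) = w s p ^+ 2 / (1 + w s p) by field; lra.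
    rewrite mulr_ge0 ?divr_ge0 ?exprn_ge0 ?addr_ge0//=.
    apply: (@le_trans _ _ (ln p%:R / p%:R ^+ 2)); last by rewrite ler_peMl// ler1n.
    rewrite ler_wpM2l// ler_pdivrMr ?ltr_pwDl//.
    apply: (@le_trans _ _ (p%:R ^- 2)).
      by rewrite -exprVn ler_sqr ?nnegrE// invr_ge0 ltW.
    by rewrite ler_peMr ?invr_ge0 ?exprn_ge0 ?(ltW p0)// lerDl.
  rewrite subr0; apply/andP; split; first exact: mulr_ge0.
  have -> : P.+1%:R * (ln p%:R / p%:R ^+ 2) = ln p%:R * (P.+1%:R / p%:R ^+ 2) :> R by ring.
  apply: ler_wpM2l => //.
  apply: (le_trans wV); rewrite ler_pdivlMr ?exprn_gt0// expr2 mulrA mulVf ?gt_eqF// mul1r.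
  by rewrite ler_nat ltnW// ltnS leqNgt.
apply/andP; split; first by apply: sumr_ge0 => p /H/andP[].
apply: (@le_trans _ _ (P.+1%:R * series (fun n => ln n%:R / n%:R ^+ 2) N)).
  rewrite /series/= mulr_sumr big_mkcond; apply: ler_sum => p _; case: ifPn => [/H/andP[]//|_].
  by rewrite mulr_ge0// divr_ge0 ?exprn_ge0// ln_nat_ge0.
by rewrite mulrC ler_wpM2r// sum_ln_div_sqr_le.
Qed.

Definition bucket_B1 s j : R :=
  \sum_((2 ^ j)%N <= p < (2 ^ j.+1)%N | prime p) ln p%:R * w s p.

Lemma bucket_B1_bounds s j : 0 <= s ->
  npow s 2 ^+ j.+1 * lam R j <= bucket_B1 s j <= npow s 2 ^+ j * lam R j.
Proof.
move=> s0; rewrite /bucket_B1 /lam !mulr_sumr; apply/andP; split;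
  rewrite big_nat_cond [leRHS]big_nat_cond; apply: ler_sum => p
    /andP[/andP[h1 h2] pp]; have p0 := prime_gt0 pp;
  have := npow_dyadic_bounds s0 p0; rewrite (@trunc_log_bucket j p) ?h1//;
  move=> /andP[q1 q2];
  rewrite (_ : ln p%:R * w s p = npow s p * (ln p%:R / p%:R)); try by rewrite /w; ring.
- by apply: ler_wpM2r => //; rewrite divr_ge0// ln_nat_ge0.
- by apply: ler_wpM2r => //; rewrite divr_ge0// ln_nat_ge0.
Qed.

Lemma bucket_B1_le s j : 0 <= s -> bucket_B1 s j <= lam R j.
Proof.
move=> s0; have /andP[_ h] := bucket_B1_bounds j s0; apply: (le_trans h).
have /andP[r0 r1] := npow2_bounds s0.
by rewrite ler_piMl ?lam_ge0// exprn_ile1.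
Qed.

Lemma B1_dyadicS s j : B1 s (2 ^ j.+1) = B1 s (2 ^ j) + bucket_B1 s j.
Proof. by rewrite /B1 (@big_nat_cond_split _ (2 ^ j)%N)// leq_exp2l. Qed.

Lemma B1_dyadic s J : B1 s (2 ^ J) = \sum_(0 <= j < J) bucket_B1 s j.
Proof.
elim: J => [|J IH]; last by rewrite B1_dyadicS IH big_nat_recr.
by rewrite expn0 /B1 big_ltn_cond// !big_geq.
Qed.

Lemma B1_mono s M N : (M <= N)%N -> B1 s M <= B1 s N.
Proof.
move=> MN; rewrite /B1 (big_nat_cond_split _ _ (leq0n M) MN) lerDl.
by apply: sumr_ge0 => p _; rewrite mulr_ge0 ?w_ge0 ?ln_nat_ge0.
Qed.

(** Replacing [p^-s] by [r^i] on block [i] costs [L], as the masses [(1 - r) r^i] sum to at most 1;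
    replacing [lam R i] by [ln 2] costs [C], by Abel's inequality and Mertens' first theorem. *)
Lemma B1_dyadic_approx : exists2 C : R, 0 <= C & forall s j, 0 <= s ->
  `|B1 s (2 ^ j.+1) - ln 2 * geo (npow s 2) j| <= C.
Proof.
have [L L0 HL] := lam_bounded R; have [C C0 HC] := mertens_first R.
exists (L + C); first exact: addr_ge0.
move=> s j s0; have r01 := npow2_bounds s0; have /andP[r0 r1] := r01.
set r := npow s 2 in r01 r0 r1 *.
have -> : B1 s (2 ^ j.+1) - ln 2 * geo r j =
    - (\sum_(0 <= i < j.+1) (r ^+ i * lam R i - bucket_B1 s i)) +
    series (fun i => (lam R i - ln 2) * r ^+ i) j.+1.
  rewrite B1_dyadic /geo /series/= mulr_sumr -sumrB -sumrN -big_split/=.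
  by apply: eq_bigr => i _; ring.
apply: (le_trans (ler_normD _ _)); apply: lerD; last first.
  rewrite -[leRHS]mulr1 -(expr0 r); apply: (@norm_abel_le _ (fun i => lam R i - ln 2)) => // k.
    by rewrite exprS ler_piMl// exprn_ge0.
  by rewrite exprn_ge0.
rewrite normrN (le_trans (ler_norm_sum _ _ _))//.
apply: (@le_trans _ _ (\sum_(0 <= i < j.+1) L * ((1 - r) * r ^+ i))).
  apply: ler_sum => i _; have /andP[h1 h2] := bucket_B1_bounds i s0.
  rewrite ger0_norm ?subr_ge0//.
  apply: (@le_trans _ _ (lam R i * ((1 - r) * r ^+ i))).
    move: h1; rewrite -/r exprS => h1; lra.
  by rewrite ler_wpM2r// mulr_ge0 ?exprn_ge0// subr_ge0.
by rewrite -mulr_sumr ler_piMr// sum_geo_diff_le.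
Qed.

(** The slack of [q] blocks allows for the constant in [theta n << n]; each extra block contributes
    at most [L]. *)
Lemma B_approx P q : exists2 C : R, 0 <= C & forall s j N, 0 <= s ->
  (2 ^ j <= N)%N -> (N <= 2 ^ (j.+1 + q))%N ->
  `|B s P N - ln 2 * geo (npow s 2) j| <= C.
Proof.
have [L L0 HL] := lam_bounded R; have [C C0 HC] := B1_dyadic_approx.
exists (6 * P.+1%:R + (q%:R * L + L) + C); first by rewrite !addr_ge0 ?mulr_ge0.
move=> s j N s0 jN Nj.
have /andP[h1 h2] := B1_sub_B P N s0.
have h3 := HC s j s0.
have h4 : B1 s (2 ^ j.+1) - L <= B1 s N.
  apply: le_trans (B1_mono s jN); rewrite B1_dyadicS.
  have := bucket_B1_le j s0; have := HL j; lra.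
have h5 : B1 s N <= B1 s (2 ^ j.+1) + q%:R * L.
  apply: (le_trans (B1_mono s Nj)); elim: q {Nj} => [|q IH].
    by rewrite addn0 mul0r addr0.
  rewrite addnS B1_dyadicS; have := bucket_B1_le (j.+1 + q) s0; have := HL (j.+1 + q)%N.
  by rewrite -natr1 mulrDl mul1r; lra.
have h6 : 0 <= q%:R * L by rewrite mulr_ge0.
have h7 : 0 <= 6 * P.+1%:R :> R by rewrite mulr_ge0.
move: h3; rewrite !ler_norml => /andP[h31 h32].
move: (6 * P.+1%:R) (q%:R * L) (ln 2 * geo _ _) (B s P N) (B1 s N) (B1 s _) h1 h2 h4 h5 h6 h7 h31 h32.
by move=> a b c d e f *; apply/andP; split; lra.
Qed.

Lemma V_anti s M N : 0 <= s -> (M <= N)%N -> V s N <= V s M.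
Proof.
move=> s0 MN; rewrite /V (@big_cat_nat _ _ _ M)//= ler_piMr//; first exact/ltW/V_gt0.
rewrite big_seq_cond prodr_ile1// => p _; have h : 0 < 1 + w s p by rewrite ltr_pwDl// w_ge0.
by rewrite invr_ge0 (ltW h)/= invf_le1// lerDl w_ge0.
Qed.

Lemma V_le_exp s M N : 0 <= s -> (M <= N)%N ->
  V s M <= V s N * expR (\sum_(M <= p < N | prime p) p%:R^-1).
Proof.
move=> s0 MN; rewrite {2}/V (@big_cat_nat _ _ _ M)//= -/(V s M) -mulrA.
rewrite ler_peMr//; first exact/ltW/V_gt0.
rewrite expR_sum -big_split/=; elim/big_ind: _ => // [x y x1 y1|p pp].
  by rewrite (le_trans x1)// ler_peMr// (le_trans _ x1).
have h : 0 < 1 + w s p by rewrite ltr_pwDl// w_ge0.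
rewrite mulrC ler_pdivlMr// mul1r (le_trans _ (expR_ge1Dx _))// lerD2l.
exact: w_leV.
Qed.

Lemma sum_prec j q : \sum_((2 ^ j)%N <= p < (2 ^ (j + q))%N | prime p) p%:R^-1 =
  \sum_(0 <= i < q) prec R (j + i).
Proof.
elim: q => [|q IH]; first by rewrite addn0 !big_geq.
rewrite big_nat_recr//= -IH addnS (@big_nat_cond_split _ (2 ^ (j + q))%N)//.
  by rewrite leq_exp2l// leq_addr.
by rewrite leq_exp2l.
Qed.

Definition v s j : R := V s (2 ^ j.+1).

Lemma v_gt0 s j : 0 <= s -> 0 < v s j. Proof. exact: V_gt0. Qed.

(** [N] and [2^(j+1)] differ by boundedly many blocks, each carrying prime reciprocals of total
    [O(1/(j+1))], so [V] changes by that relative amount. *)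
Lemma V_approx q : exists2 C : R, 0 <= C & forall s j N, 0 <= s ->
  (2 ^ j <= N)%N -> (N <= 2 ^ (j.+1 + q))%N ->
  `|V s N - v s j| <= C * v s j / j.+1%:R.
Proof.
have [K K0 HK] := prec_bounded R.
exists (K * expR K + q%:R * K).
  by rewrite addr_ge0 ?mulr_ge0// expR_ge0.
move=> s j N s0 jN Nj; have v0 := v_gt0 j s0.
have Kj : K / j.+1%:R <= K by rewrite ler_piMr// invf_le1 ?ler1n.
have Kj0 : 0 <= K / j.+1%:R by rewrite divr_ge0.
have up : V s N - v s j <= v s j * (K / j.+1%:R * expR K).
  have h1 : V s N <= v s j * expR (prec R j).
    by apply: (le_trans (V_anti s0 jN)); apply: V_le_exp => //; rewrite leq_exp2l.
  rewrite lerBlDr; apply: (le_trans h1).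
  have -> : v s j * (K / j.+1%:R * expR K) + v s j =
    v s j * (1 + K / j.+1%:R * expR K) by ring.
  rewrite ler_wpM2l ?(ltW v0)//.
  have hx : expR (prec R j) * (1 - prec R j) <= 1.
    have h2 : expR (prec R j) * expR (- prec R j) = 1 by rewrite -expRD subrr expR0.
    by rewrite -[leRHS]h2 ler_wpM2l ?expR_ge0 ?expR_ge1Dx.
  have p0 := prec_ge0 R j.
  have : prec R j * expR (prec R j) <= K / j.+1%:R * expR K.
    by apply: ler_pM; rewrite ?expR_ge0// ler_expR (le_trans (HK j)).
  by move: hx; move: (expR (prec R j)) (prec R j) (K / _ * _) => x y z; lra.
have lo : - (v s j * (q%:R * (K / j.+1%:R))) <= V s N - v s j.
  have := V_le_exp s0 (_ : 2 ^ j.+1 <= 2 ^ (j.+1 + q))%N.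
  rewrite leq_exp2l// leq_addr => /(_ isT); rewrite sum_prec -/(v s j).
  set S := \sum_(_ <= _ < _) _ => h.
  have Sle : S <= q%:R * (K / j.+1%:R).
    apply: (@le_trans _ _ (\sum_(0 <= i < q) K / j.+1%:R)); last first.
      by rewrite sumr_const_nat subn0 mulr_natl.
    apply: ler_sum => i _; apply: (le_trans (HK _)); rewrite ler_wpM2l//.
    by rewrite lef_pV2 ?posrE// ler_nat; lia.
  have h1 : v s j * expR (- S) <= V s N.
    apply: le_trans (V_anti s0 Nj).
    by rewrite expRN ler_pdivrMr ?expR_gt0.
  have h2 : v s j * (1 - S) <= v s j * expR (- S).
    by rewrite ler_wpM2l ?(ltW v0)// expR_ge1Dx.
  have h3 := ler_wpM2l (ltW v0) Sle.
  move: h1 h2 h3; rewrite mulrBr mulr1.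
  by move: (v s j * expR _) (v s j * S) (v s j * (q%:R * _)) => a b d; lra.
have e1 : (K * expR K + q%:R * K) * v s j / j.+1%:R =
  v s j * (K / j.+1%:R * expR K) + v s j * (q%:R * (K / j.+1%:R)) by ring.
have n1 : 0 <= v s j * (K / j.+1%:R * expR K).
  by rewrite !mulr_ge0 ?expR_ge0 ?(ltW v0).
have n2 : 0 <= v s j * (q%:R * (K / j.+1%:R)) by rewrite !mulr_ge0 ?(ltW v0).
rewrite e1 ler_norml; move: up lo n1 n2.
move: (v s j * (K / _ * _)) (v s j * (q%:R * _)) (V s N - v s j) => a b c *.
by apply/andP; split; lra.
Qed.

Lemma npow1_2 : npow (1 : R) 2 = 2^-1.
Proof. by rewrite /npow mulN1r expRN lnK// posrE. Qed.

Lemma npow2_ge_half s : s <= 1 -> 2^-1 <= npow s 2.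
Proof.
by move=> s1; rewrite -npow1_2 /npow ler_expR ler_wpM2r ?ln_nat_ge0// lerN2.
Qed.

(** Block [i] of [w s] has mass at least [r^(i+1) / 2], which is at least [r^i / 4] because
    [r >= 1/2] for [s <= 1]; then [V_bound] gives [8 = 2 * 4]. *)
Lemma v_geo_le s j : 0 <= s <= 1 -> v s j * geo (npow s 2) j <= 8.
Proof.
move=> /andP[s0 s1]; have hr := npow2_ge_half s1; have v0 := v_gt0 j s0.
have /andP[r0 r1] := npow2_bounds s0.
set r := npow s 2 in hr r0 r1 *.
have h : 4^-1 * geo r j <= series (w s) (2 ^ j.+1)%N.
  rewrite series_dyadic ?w_0// /geo /series/= mulr_sumr; apply: ler_sum => i _.
  apply: (@le_trans _ _ (\sum_((2 ^ i)%N <= n < (2 ^ i.+1)%N) ((2 ^ i.+1)%:R^-1 * r ^+ i.+1))).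
    rewrite sumr_const_nat expnS mul2n -addnn addnK addnn -muln2 natrM -[leRHS]mulr_natl.
    have x0 : 0 < (2 ^ i)%:R :> R by rewrite ltr0n expn_gt0.
    have -> : (2 ^ i)%:R * (((2 ^ i)%:R * 2)^-1 * r ^+ i.+1) = 2^-1 * r ^+ i.+1 :> R.
      by move: (2 ^ i)%:R x0 => x x0; field; rewrite gt_eqF.
    rewrite exprS mulrA ler_wpM2r ?exprn_ge0//; lra.
  rewrite [leLHS]big_nat_cond [leRHS]big_nat_cond; apply: ler_sum => n /andP[/andP[n1 n2] _].
  have n0 : (0 < n)%N by rewrite (leq_trans _ n1)// expn_gt0.
  have := npow_dyadic_bounds s0 n0; rewrite (@trunc_log_bucket i n) ?n1// => /andP[q1 _].
  apply: ler_pM => //; first by rewrite exprn_ge0.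
  by rewrite lef_pV2 ?posrE ?ltr0n ?expn_gt0// ler_nat ltnW.
have := V_bound (2 ^ j.+1) s0; rewrite -/(v s j).
have := ler_wpM2l (ltW v0) h; lra.
Qed.

End UniformEstimates.

(** * The summand, its smooth model, and the sum over the primes *)

Section Comparison.
Variable R : realType.
Implicit Types (s c : R) (n j k m N P q : nat).

(* At [s = 0] this is the term of the sum in the theorem; for [s > 0] every
   prime [p] is weighted by [p ^ -(1 + s)] instead of [p^-1]. *)
Definition T s P m n N : R := w s n * (B s P N - ln (n%:R / m%:R)) * V s N.

(* [F s j / n] approximates [T s P m n N] uniformly in [s] when [n] and [N]
   are of order [2 ^ j]: there [B] is close to [ln 2 * geo (npow s 2) j], by
   Mertens' estimates. *)
Definition F s j : R :=
  - (ln 2 * (npow s 2 ^+ j * v s j * (j.+1%:R - geo (npow s 2) j))).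

Lemma geo_defect_bounds (r : R) j : 0 <= r <= 1 ->
  0 <= j.+1%:R - geo r j <= j.+1%:R * (1 - r) * geo r j.
Proof.
move=> r01; have /andP[r0 r1] := r01; rewrite subr_ge0 geo_le//= -mulrA geo_mul.
have -> : j.+1%:R - geo r j = \sum_(0 <= i < j.+1) (1 - r ^+ i).
  by rewrite /geo sumrB sumr_const_nat subn0.
have -> : j.+1%:R * (1 - r ^+ j.+1) = \sum_(0 <= i < j.+1) (1 - r ^+ j.+1).
  by rewrite sumr_const_nat subn0 mulr_natl.
rewrite [leLHS]big_nat_cond [leRHS]big_nat_cond; apply: ler_sum => i /andP[/andP[_ ij] _].
by rewrite lerD2l lerN2; apply: ler_wiXn2l => //; exact: ltnW.
Qed.

Lemma V_le1 s N : 0 <= s -> V s N <= 1.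
Proof.
by move=> s0; apply: le_trans (V_anti s0 (leq0n N)) _; rewrite /V big_geq.
Qed.

Lemma norm_F_le s j : 0 <= s -> `|F s j| <= ln 2 * (j.+1%:R ^+ 2 * (1 - npow s 2)).
Proof.
move=> s0; have r01 := npow2_bounds s0; have /andP[r0 r1] := r01.
have /andP[e0 e1] := geo_defect_bounds j r01; have v0 := v_gt0 j s0.
rewrite /F normrN normrM ger0_norm ?ln_nat_ge0// ler_wpM2l ?ln_nat_ge0//.
rewrite ger0_norm ?mulr_ge0 ?exprn_ge0 ?(ltW v0)//.
apply: (@le_trans _ _ (1 * (j.+1%:R - geo (npow s 2) j))).
  by rewrite ler_wpM2r// mulr_ile1 ?exprn_ge0 ?exprn_ile1 ?(ltW v0) ?V_le1.
rewrite mul1r (le_trans e1)// expr2 -mulrA [leRHS]mulrAC -mulrA.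
by rewrite !ler_wpM2l ?subr_ge0 ?geo_le.
Qed.

(** All four follow from [v * geo <= 8]. Here [geo] is at least [(j+1) r^j], the defect [j+1 - geo]
    is at most [(j+1) (1-r) geo], and leftover powers of [(j+1) (1-r)] are absorbed by [r^j];
    [32 = 8 * 4]. *)
Lemma v_defect_bounds s j : 0 <= s <= 1 ->
  [/\ npow s 2 ^+ j * v s j <= 8 / j.+1%:R,
      npow s 2 ^+ j * (1 - npow s 2) * (j.+1%:R - geo (npow s 2) j) * v s j <=
        32 / j.+1%:R,
      npow s 2 ^+ j * (j.+1%:R - geo (npow s 2) j) * v s j <= 8 &
      (j.+1%:R - geo (npow s 2) j) * v s j <= 8 * (j.+1%:R * (1 - npow s 2))].
Proof.
move=> s01; have /andP[s0 _] := s01; have r01 := npow2_bounds s0.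
have v0 := v_gt0 j s0; have h1 := v_geo_le j s01; have h2 := geo_ge j r01.
have h3 := geo_expn_le j r01; have h4 := geo_expn_sqr_le j r01.
have /andP[e0 e1] := geo_defect_bounds j r01; have /andP[r0 r1] := r01.
have rj0 : 0 <= npow s 2 ^+ j by rewrite exprn_ge0.
set r := npow s 2 in r01 r0 r1 rj0 h1 h2 h3 h4 e0 e1 *.
set k : R := j.+1%:R in h2 h3 h4 e0 e1 *; have k0 : 0 < k by rewrite ltr0n.
set rho := r ^+ j in rj0 h2 h3 h4 *; set E := k - _ in e0 e1 *.
set vv := v s j in v0 h1 *; set G := geo r j in h1 h2 e1 *.
have r10 : 0 <= 1 - r by rewrite subr_ge0.
have a4 : E * vv <= 8 * (k * (1 - r)).
  apply: (le_trans (ler_wpM2r (ltW v0) e1)).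
  have := ler_wpM2l (mulr_ge0 (ltW k0) r10) h1; lra.
split => //.
- by rewrite ler_pdivlMr//; have := ler_wpM2r (ltW v0) h2; lra.
- rewrite ler_pdivlMr//.
  have := ler_wpM2l (mulr_ge0 (mulr_ge0 rj0 r10) (ltW k0)) a4.
  have -> : rho * (1 - r) * k * (8 * (k * (1 - r))) = 8 * (rho * (k * (1 - r)) ^+ 2) by ring.
  lra.
- have := ler_wpM2l rj0 a4; lra.
Qed.

(** With [j = trunc_log 2 n], [B - ln (n/m)] is [- ln 2 * (j+1 - geo)] up to a bounded error, which
    the factor [r^j v = O(1/(j+1))] turns into [O(1/(j+1))]. *)
Lemma T_approx P m q : (0 < m)%N -> exists2 C : R, 0 <= C &
  forall s n N, 0 <= s <= 1 -> (0 < n)%N -> (n <= N)%N ->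
    (N <= 2 ^ ((trunc_log 2 n).+1 + q))%N ->
  `|T s P m n N - n%:R^-1 * F s (trunc_log 2 n)| <=
    C * (n%:R^-1 / (trunc_log 2 n).+1%:R).
Proof.
move=> m0; have [CB CB0 HB] := B_approx R P q; have [CV CV0 HV] := V_approx R q.
have l0 : 0 <= ln 2 :> R by exact: ln_nat_ge0.
pose CD := CB + ln 2 + ln m%:R.
have CD0 : 0 <= CD by rewrite !addr_ge0// ln_nat_ge0.
exists (8 * (1 + CV) * CD + ln 2 * (32 * (1 + CV) + 8 * CV)).
  by apply: addr_ge0; apply: mulr_ge0 => //; lra.
move=> s n N s01 n0 nN Nn; have /andP[s0 s1] := s01.
have /andP[jn nj] := trunc_log_bounds (ltnSn 1) n0.
set j := trunc_log 2 n in jn nj Nn *.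
have jN : (2 ^ j <= N)%N by exact: leq_trans nN.
have hB := HB s j N s0 jN Nn; have hV := HV s j N s0 jN Nn.
have := npow_dyadic_bounds s0 n0; rewrite -/j => /andP[q1 q2].
have [a1 a2 a3 _] := v_defect_bounds j s01.
have r01 := npow2_bounds s0; have /andP[r0 r1] := r01.
have /andP[e0 _] := geo_defect_bounds j r01; have v0 := v_gt0 j s0.
have V1 := V_gt0 N s0.
have lnj : (0 : R) <= ln (2 : R) * j.+1%:R - ln (n%:R : R) <= ln (2 : R).
  have h1 : j%:R * ln 2 <= ln n%:R :> R by rewrite -ln_expn2 ler_ln_nat ?expn_gt0.
  have h2 : ln n%:R <= j.+1%:R * ln 2 :> R by rewrite -ln_expn2 ler_ln_nat// ltnW.
  have ej : j.+1%:R = j%:R + 1 :> R by rewrite natr1.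
  by move: h1 h2; rewrite ej; move: (j%:R) (ln n%:R) => a b *; apply/andP; split; lra.
have eln : ln (n%:R / m%:R) = ln n%:R - ln m%:R :> R by rewrite ln_div ?posrE ?ltr0n.
have lm0 := ln_nat_ge0 R m.
have rj0 : 0 <= npow s 2 ^+ j by rewrite exprn_ge0.
have k0 : 0 < j.+1%:R :> R by rewrite ltr0n.
rewrite /T /F eln /w.
rewrite exprS in q1.
set r := npow s 2 in q1 q2 rj0 r0 r1 a1 a2 a3 hB e0 *.
set rho := r ^+ j in q1 q2 rj0 a1 a2 a3 *; set vv := v s j in v0 hV a1 a2 a3 *.
set D := B s P N - _; set E := j.+1%:R - _ in e0 a2 a3 *.
set x : R := n%:R^-1; set qq := npow s n in q1 q2 *.
have hD : `|D + ln 2 * E| <= CD.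
  have -> : D + ln 2 * E = (B s P N - ln 2 * geo r j) + (ln 2 * j.+1%:R - ln n%:R) + ln m%:R.
    by rewrite /D /E; ring.
  apply: (le_trans (ler_normD _ _)); rewrite /CD (ger0_norm lm0) lerD2r.
  apply: (le_trans (ler_normD _ _)); apply: lerD => //.
  by have /andP[h1 h2] := lnj; rewrite ger0_norm.
(* Three replacements, one at a time: [D] by [- ln 2 * E], [qq] by [rho], [V s N] by [vv]. *)
have -> : x * qq * D * V s N - x * - (ln 2 * (rho * vv * E)) =
  x * (qq * V s N * (D + ln 2 * E) -
    ln 2 * E * ((qq - rho) * V s N + rho * (V s N - vv))) by ring.
have x0 : 0 <= x by rewrite invr_ge0.
rewrite normrM (ger0_norm x0) mulrCA ler_wpM2l//.
have ki0 : 0 <= j.+1%:R^-1 :> R by rewrite invr_ge0.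
have ki1 : j.+1%:R^-1 <= 1 :> R by rewrite invf_le1// ler1n.
set ki := j.+1%:R^-1 in ki0 ki1 hV a1 a2 *; clearbody ki.
have V1v : V s N <= (1 + CV) * vv.
  move: hV; rewrite ler_norml => /andP[_ hV].
  have : CV * vv * ki <= CV * vv.
    by rewrite ler_piMr ?mulr_ge0 ?(ltW v0).
  lra.
have qq0 : 0 <= qq by exact: npow_ge0.
have t1 : `|qq * V s N * (D + ln 2 * E)| <= (1 + CV) * CD * (8 * ki).
  rewrite normrM ger0_norm; last by rewrite mulr_ge0// ltW.
  have h1 : qq * V s N <= rho * ((1 + CV) * vv) by apply: ler_pM => //; exact: ltW.
  have h2 : rho * ((1 + CV) * vv) <= (1 + CV) * (8 * ki).
    by rewrite mulrCA ler_wpM2l// addr_ge0.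
  rewrite [leRHS]mulrAC; apply: ler_pM => //; first by rewrite mulr_ge0// ltW.
  exact: le_trans h2.
have t2 : `|ln 2 * E * ((qq - rho) * V s N + rho * (V s N - vv))| <=
    ln 2 * ((1 + CV) * (32 * ki) + CV * ki * 8).
  rewrite -mulrA normrM (ger0_norm l0) ler_wpM2l// mulrDr.
  apply: (le_trans (ler_normD _ _)); apply: lerD.
    rewrite normrM (ger0_norm e0) normrM (ger0_norm (ltW V1)).
    have h1 : `|qq - rho| <= rho * (1 - r).
      by rewrite distrC ger0_norm ?subr_ge0//; lra.
    have h2 : E * (`|qq - rho| * V s N) <= E * (rho * (1 - r) * ((1 + CV) * vv)).
      by rewrite ler_wpM2l//; apply: ler_pM => //; exact: ltW.
    apply: (le_trans h2).
    have := ler_wpM2l (addr_ge0 ler01 CV0) a2; lra.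
  rewrite normrM (ger0_norm e0) normrM (ger0_norm rj0).
  have h2 : E * (rho * `|V s N - vv|) <= E * (rho * (CV * vv * ki)).
    by rewrite !ler_wpM2l.
  apply: (le_trans h2).
  have -> : E * (rho * (CV * vv * ki)) = CV * ki * (rho * E * vv) by ring.
  by rewrite ler_wpM2l// mulr_ge0.
apply: (le_trans (ler_normB _ _)); apply: (le_trans (lerD t1 t2)).
by rewrite le_eqVlt; apply/orP; left; apply/eqP; ring.
Qed.

(** Each increment of [F s] is bounded by masses of the geometric law and of the negative binomial
    law with parameter [1 - 2^-s], whose totals do not exceed 1 whatever [s] is. *)
Lemma F_variation : exists C : R, forall s n, 0 <= s <= 1 ->
  \sum_(0 <= k < n) `|F s k.+1 - F s k| <= C.
Proof.
have [K K0 HK] := prec_bounded R.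
have l0 : 0 <= ln 2 :> R by exact: ln_nat_ge0.
exists (ln 2 * (16 + 8 * K)) => s n s01; have /andP[s0 s1] := s01.
have r01 := npow2_bounds s0; have /andP[r0 r1] := r01.
have r10 : 0 <= 1 - npow s 2 by rewrite subr_ge0.
set r := npow s 2 in r01 r0 r1 r10.
have H k : `|F s k.+1 - F s k| <= ln 2 * ((8 + 8 * K) * ((1 - r) * r ^+ k) +
    8 * ((1 - r) ^+ 2 * (k.+1%:R * r ^+ k))).
  have /andP[e0 e1] := geo_defect_bounds k r01.
  have v0 := v_gt0 k s0; have v1 := v_gt0 k.+1 s0.
  have [_ _ _ a4] := v_defect_bounds k s01; rewrite -/r in a4.
  have g1 := v_geo_le k.+1 s01; rewrite -/r in g1.
  have rk0 : 0 <= r ^+ k by rewrite exprn_ge0.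
  have eg : geo r k.+1 = geo r k + r ^+ k.+1 by rewrite /geo big_nat_recr.
  have er := geo_mul r k.
  have gk : geo r k <= geo r k.+1 by rewrite eg lerDl exprn_ge0.
  have vd : 0 <= v s k - v s k.+1 <= v s k * (K / k.+2%:R).
    rewrite subr_ge0 V_anti ?leq_exp2l//=.
    have le12 : (2 ^ k.+1 <= 2 ^ k.+2)%N by rewrite leq_exp2l.
    have := V_le_exp s0 le12; rewrite -/(prec R k.+1).
    rewrite -/(v s k) -/(v s k.+1) => h.
    have h1 : v s k * expR (- prec R k.+1) <= v s k.+1 by rewrite expRN ler_pdivrMr ?expR_gt0.
    have h2 : v s k * (1 - prec R k.+1) <= v s k * expR (- prec R k.+1).
      by rewrite ler_wpM2l ?(ltW v0)// expR_ge1Dx.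
    have h3 := ler_wpM2l (ltW v0) (HK k.+1); rewrite mulrBr mulr1 in h2.
    move: h1 h2 h3; move: (v s k * expR _) (v s k * prec _ _) (v s k * (K / _)) => a b d *; lra.
  have /andP[vd0 vd1] := vd.
  set E := k.+1%:R - geo r k in e0 e1 a4 *.
  (* One term for each factor that changes: [E] grows by [(1 - r) * geo r k], the power gains a
     factor [r], and [v] drops by at most the fraction [K / (k+2)]. *)
  have -> : F s k.+1 - F s k = - (ln 2 * (v s k.+1 * (r ^+ k.+1 * ((1 - r) * geo r k)) -
       v s k.+1 * ((1 - r) * r ^+ k * E) - r ^+ k * E * (v s k - v s k.+1))).
    rewrite /F -/r -/E eg er -[k.+2%:R]natr1.
    have -> : k.+1%:R + 1 - (geo r k + r ^+ k.+1) = E + (1 - r ^+ k.+1) by rewrite /E; ring.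
    by rewrite exprS; ring.
  rewrite normrN normrM (ger0_norm l0) ler_wpM2l//.
  have b1 : `|v s k.+1 * (r ^+ k.+1 * ((1 - r) * geo r k))| <= 8 * ((1 - r) * r ^+ k).
    have gk0 : 0 <= geo r k by rewrite (le_trans _ (geo_ge1 _ r0)).
    rewrite ger0_norm; last by rewrite !mulr_ge0 ?exprn_ge0// ltW.
    have -> : v s k.+1 * (r ^+ k.+1 * ((1 - r) * geo r k)) =
      (v s k.+1 * geo r k) * ((1 - r) * r ^+ k) * r by rewrite exprS; ring.
    have rr0 : 0 <= (1 - r) * r ^+ k by rewrite mulr_ge0.
    apply: (@le_trans _ _ ((v s k.+1 * geo r k) * ((1 - r) * r ^+ k))).
      by rewrite ler_piMr// mulr_ge0// mulr_ge0// ltW.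
    by rewrite ler_wpM2r// (le_trans _ g1)// ler_wpM2l// ltW.
  have b2 : `|v s k.+1 * ((1 - r) * r ^+ k * E)| <=
      8 * ((1 - r) ^+ 2 * (k.+1%:R * r ^+ k)).
    rewrite ger0_norm; last by rewrite !mulr_ge0// ltW.
    have h1 : v s k.+1 * ((1 - r) * r ^+ k * E) <= v s k * ((1 - r) * r ^+ k * E).
      by rewrite ler_wpM2r ?mulr_ge0// -subr_ge0.
    apply: (le_trans h1).
    have := ler_wpM2l (mulr_ge0 r10 rk0) a4; lra.
  have b3 : `|r ^+ k * E * (v s k - v s k.+1)| <= 8 * K * ((1 - r) * r ^+ k).
    rewrite ger0_norm; last by rewrite !mulr_ge0.
    apply: (le_trans (ler_wpM2l (mulr_ge0 rk0 e0) vd1)).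
    have Kk : 0 <= K / k.+2%:R by rewrite divr_ge0.
    have h1 := ler_wpM2l (mulr_ge0 rk0 Kk) a4.
    have h2 : K / k.+2%:R * k.+1%:R <= K.
      by rewrite mulrAC ler_pdivrMr// ler_wpM2l// ler_nat.
    have h3 := ler_wpM2r (mulr_ge0 r10 rk0) h2.
    move: h1 h3; move: (K / _) => z; lra.
  apply: (le_trans (ler_normB _ _)); apply: (@le_trans _ _ (8 * ((1 - r) * r ^+ k) +
    8 * ((1 - r) ^+ 2 * (k.+1%:R * r ^+ k)) + 8 * K * ((1 - r) * r ^+ k))); last by lra.
  by apply: lerD b3; apply: (le_trans (ler_normB _ _)); apply: lerD.
apply: (le_trans (ler_sum _ (fun k _ => H k))).
rewrite -mulr_sumr ler_wpM2l// big_split/= -[X in X + _]mulr_sumr -[X in _ + X]mulr_sumr.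
have h1 := sum_geo_diff_le n r01; have h2 := sum_geo_diff_sqr_le n r01.
have K8 : 0 <= 8 + 8 * K by lra.
have h3 := ler_wpM2l K8 h1; lra.
Qed.

Lemma cvg_F j : F (sg R i) j @[i --> \oo] --> (0 : R).
Proof.
apply/cvgr0Pnorm_le => e e0.
have c : ln 2 * (j.+1%:R ^+ 2 * (1 - npow (sg R i) 2)) @[i --> \oo] --> (0 : R).
  rewrite -(mulr0 (ln 2)); apply: cvgM; first exact: cvg_cst.
  rewrite -(mulr0 (j.+1%:R ^+ 2)); apply: cvgM; first exact: cvg_cst.
  have -> : (0 : R) = 1 - npow 0 2 by rewrite npow0 subrr.
  apply: cvgB; first exact: cvg_cst.
  by apply: cvg_npow; exact: cvg_sg.
move/cvgr0Pnorm_le : c => /(_ e e0); apply: filterS => i; apply: le_trans.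
by rewrite (le_trans (norm_F_le j (ltW (sg_gt0 R i))))// ler_norm.
Qed.

Lemma F0 j : F 0 j = 0.
Proof.
apply/eqP; rewrite -normr_le0; apply: le_trans (norm_F_le j (lexx 0)) _.
by rewrite npow0 subrr !mulr0.
Qed.

Lemma cvg_V N : V (sg R i) N @[i --> \oo] --> V (0 : R) N.
Proof.
have e s : 0 <= s -> V s N = expR (- series (prime_log s) N).
  by move=> s0; rewrite series_prime_log// opprK lnK// posrE V_gt0.
rewrite e// (_ : (fun i => _) = fun i => expR (- series (prime_log (sg R i)) N)).
  apply: continuous_cvg; first exact: continuous_expR.
  by apply: cvgN; apply: cvg_finite_sum => n _ _; exact: cvg_prime_log.
by apply/funext => i; rewrite e// ltW// sg_gt0.
Qed.

Lemma cvg_B P N : B (sg R i) P N @[i --> \oo] --> B (0 : R) P N.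
Proof.
apply: cvg_finite_sum => n _ _; apply: cvgM; first exact: cvg_cst.
have cw : w (sg R i) n @[i --> \oo] --> w (0 : R) n by apply: cvg_w; exact: cvg_sg.
apply: cvgM => //; apply: cvgV; first by rewrite gt_eqF// ltr_pwDl// w_ge0.
by apply: cvgD => //; exact: cvg_cst.
Qed.

Lemma cvg_T P m n N : T (sg R i) P m n N @[i --> \oo] --> T (0 : R) P m n N.
Proof.
apply: cvgM; last exact: cvg_V.
apply: cvgM; first by apply: cvg_w; exact: cvg_sg.
by apply: cvgB; [exact: cvg_B | exact: cvg_cst].
Qed.

(* [prime_term s p] is the derivative in [s] of
   [w s p * V s p.+1 = V s p - V s p.+1], hence the telescoping below. *)
Definition prime_term s n : R := if prime n then T s 1 1 n n.+1 else 0.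

Lemma series_prime_term s N : 0 <= s ->
  series (prime_term s) N = - (V s N * B s 1 N).
Proof.
move=> s0; elim: N => [|N IH].
  by rewrite /series/= /B !big_geq// mulr0 oppr0.
rewrite seriesSr IH /prime_term; case: ifPn => pN; last first.
  by rewrite addr0 /V /B [in RHS]big_mkcond [X in _ = - (_ * X)]big_mkcond
    !big_nat_recr//= -!big_mkcond/= (negbTE pN) mulr1 addr0.
have eV : V s N.+1 = V s N / (1 + w s N).
  by rewrite /V [LHS]big_mkcond big_nat_recr//= -big_mkcond/= pN.
have eB : B s 1 N.+1 = B s 1 N + ln N%:R * (w s N / (1 + w s N)).
  by rewrite /B [LHS]big_mkcond big_nat_recr//= -big_mkcond/= pN prime_gt1.
rewrite /T eV eB divr1; have h : 0 < 1 + w s N by rewrite ltr_pwDl// w_ge0.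
by field; rewrite gt_eqF.
Qed.

Lemma B_nondecreasing s P : 0 <= s -> nondecreasing_seq (B s P).
Proof.
move=> s0; apply/nondecreasing_seqP => N; rewrite /B.
rewrite [leRHS]big_mkcond big_nat_recr//= -big_mkcond/= lerDl; case: ifP => // _.
by rewrite mulr_ge0 ?divr_ge0 ?addr_ge0 ?w_ge0 ?ln_nat_ge0.
Qed.

(** Up to a bounded error the limit of [B] is [ln 2 / (1 - 2^-s)], and [(1 - 2^-s) / s] tends to
    [ln 2]. *)
Lemma B_infinity : exists2 b : nat -> R,
  forall i, B (sg R i) 1 @ \oo --> b i & sg R i * b i @[i --> \oo] --> (1 : R).
Proof.
have [C C0 HC] := B_approx R 1 0; pose r i : R := npow (sg R i) 2.
have l0 : 0 < ln 2 :> R by rewrite ln_gt0// ltr1n.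
have r1 i : 0 < 1 - r i by rewrite subr_gt0; exact/npow2_lt1/sg_gt0.
have H i j : `|B (sg R i) 1 (2 ^ j.+1) - ln 2 * geo (r i) j| <= C.
  by apply: HC; rewrite ?addn0 ?leq_exp2l//; exact/ltW/sg_gt0.
have nd i := B_nondecreasing 1 (ltW (sg_gt0 R i)).
have cB i : cvgn (B (sg R i) 1).
  apply: nondecreasing_is_cvgn => //; exists (ln 2 / (1 - r i) + C) => _ [N _ <-].
  apply: (@le_trans _ _ (B (sg R i) 1 (2 ^ N.+1))).
    by apply: nd; rewrite ltnW// (leq_trans (ltn_expl N (ltnSn 1)))// leq_exp2l.
  rewrite -lerBlDl; apply: (@le_trans _ _ (B (sg R i) 1 (2 ^ N.+1) - ln 2 * geo (r i) N)).
    rewrite lerD2l lerN2 ler_wpM2l ?(ltW l0)//.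
    rewrite -[leRHS]mul1r ler_pdivlMr// mulrC geo_mul gerBl exprn_ge0//.
    by rewrite npow_ge0.
  by apply: le_trans (H i N); exact: ler_norm.
exists (fun i => limn (B (sg R i) 1)) => //.
have Hb i : `|limn (B (sg R i) 1) - ln 2 / (1 - r i)| <= C.
  have c1 : B (sg R i) 1 (2 ^ j.+1) @[j --> \oo] --> limn (B (sg R i) 1).
    rewrite (cvg_shiftS (fun j => B (sg R i) 1 (2 ^ j))).
    exact: cvg_comp _ _ cvg_expn2 (cB i).
  have c2 : ln 2 * geo (r i) j @[j --> \oo] --> ln 2 / (1 - r i).
    apply: cvgM; first exact: cvg_cst.
    have -> : geo (r i) = (fun j => (1 - r i ^+ j.+1) / (1 - r i)).
      by apply/funext => j; rewrite -geo_mul mulrC mulrA mulVf ?mul1r// gt_eqF.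
    rewrite -[X in _ --> X]mul1r; apply: cvgM; last exact: cvg_cst.
    rewrite -[X in _ --> X]subr0; apply: cvgB; first exact: cvg_cst.
    rewrite (cvg_shiftS (fun j => r i ^+ j)); apply: cvg_expr.
    by rewrite ger0_norm ?npow_ge0//; rewrite -subr_gt0.
  have c3 : `|B (sg R i) 1 (2 ^ j.+1) - ln 2 * geo (r i) j| @[j --> \oo] -->
      `|limn (B (sg R i) 1) - ln 2 / (1 - r i)|.
    by apply: cvg_norm; exact: cvgB.
  rewrite -(cvg_lim (@Rhausdorff R) c3); apply: limr_le.
    by apply/cvg_ex; eexists; exact: c3.
  by apply: nearW => j; exact: H.
have -> : (fun i => sg R i * limn (B (sg R i) 1)) = (fun i =>
    ln 2 * ((1 - r i) / sg R i)^-1 + sg R i * (limn (B (sg R i) 1) - ln 2 / (1 - r i))).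
  by apply/funext => i; rewrite invf_div; ring.
rewrite -[X in _ --> X]addr0; apply: cvgD.
  suff : ln 2 / ((1 - r i) / sg R i) @[i --> \oo] --> ln (2 : R) / ln 2.
    by rewrite divff// gt_eqF.
  apply: cvgM; first exact: cvg_cst.
  apply: cvgV; first by rewrite gt_eqF.
  exact: cvg_npow2_sub (sg_gt0 R) (@cvg_sg R).
apply/cvgr0Pnorm_le => e e0.
have c : sg R i * C @[i --> \oo] --> (0 : R).
  by rewrite -(mul0r C); apply: cvgM; [exact: cvg_sg | exact: cvg_cst].
move/cvgr0Pnorm_le : c => /(_ e e0); apply: filterS => i; apply: le_trans.
by rewrite !normrM ler_wpM2l// (ger0_norm C0).
Qed.

Lemma prime_term_infinity : exists2 x : nat -> R,
  forall i, series (prime_term (sg R i)) @ \oo --> x i & x @ \oo --> - (zeta 1 : R).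
Proof.
have [b hb hb1] := B_infinity.
exists (fun i => - (Vinf (sg R i) * b i)).
  move=> i; rewrite (_ : series _ = fun N => - (V (sg R i) N * B (sg R i) 1 N)).
    by apply: cvgN; apply: cvgM => //; exact/V_cvg/sg_gt0.
  by apply/funext => N; rewrite series_prime_term// ltW// sg_gt0.
apply: cvgN; rewrite -[zeta 1]mulr1.
rewrite (_ : (fun i => _) = fun i => (Vinf (sg R i) / sg R i) * (sg R i * b i)).
  by apply: cvgM => //; exact: cvg_Vinf_div (sg_gt0 R) (@cvg_sg R).
apply/funext => i; rewrite mulrA divfK// gt_eqF//; exact: sg_gt0.
Qed.

(** At [s = 0], [B] is [J ln 2 + O(1)] at [2^J]. The main part is given by [mertens_third]; the
    bounded part is multiplied by [V], which tends to 0. *)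
Lemma prime_term_zero :
  series (prime_term 0) (2 ^ J)%N @[J --> \oo] -->
    - (zeta 1 * expR (- euler_gamma R)).
Proof.
have [C C0 HC] := B_approx R 1 0.
have l0 : 0 < ln 2 :> R by rewrite ln_gt0// ltr1n.
have c1 := @mertens_third R.
have cV : V (0 : R) (2 ^ J) @[J --> \oo] --> (0 : R).
  rewrite -[X in _ --> X](mulr0 (zeta 1 / ln 2 * expR (- euler_gamma R))).
  apply: (@cvg_trans _ ((V 0 (2 ^ J) * J%:R * J%:R^-1) @[J --> \oo])).
    apply: near_eq_cvg; exists 1 => // J /= J0.
    by rewrite mulfK// pnatr_eq0 -lt0n.
  apply: cvgM => //; rewrite -(cvg_shiftS (fun J => J%:R^-1 : R)); exact: cvg_harmonic.
have -> : - (zeta 1 * expR (- euler_gamma R)) =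
    - (ln 2 * (zeta 1 / ln 2 * expR (- euler_gamma R)) + 0) :> R.
  by rewrite addr0; field; rewrite gt_eqF.
rewrite (_ : (fun J => _) = fun J => - (ln 2 * (V 0 (2 ^ J) * J%:R) +
    V 0 (2 ^ J) * (B 0 1 (2 ^ J) - ln 2 * J%:R))); last first.
  by apply/funext => J; rewrite series_prime_term//; ring.
apply: cvgN; apply: cvgD; first by apply: cvgM => //; exact: cvg_cst.
have HB J : `|B 0 1 (2 ^ J) - ln 2 * J%:R| <= C :> R.
  case: J => [|J].
    by rewrite expn0 /B big_nat_cond big1 ?mulr0 ?subrr ?normr0// => [[|p]].
  have := HC 0 J (2 ^ J.+1)%N; rewrite addn0 !leq_exp2l// lexx => /(_ isT (leqnSn J) (leqnn _)).
  rewrite npow0 (_ : geo 1 J = J.+1%:R)// /geo.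
  rewrite (eq_bigr (fun=> 1)); last by move=> i _; rewrite expr1n.
  by rewrite sumr_const_nat subn0.
apply/cvgr0Pnorm_le => e e0.
have c : V (0 : R) (2 ^ J) * C @[J --> \oo] --> (0 : R).
  by rewrite -[X in _ --> X](mul0r C); apply: cvgM => //; exact: cvg_cst.
move/cvgr0Pnorm_le : c => /(_ e e0); apply: filterS => J; apply: le_trans.
by rewrite !normrM ler_wpM2l// (ger0_norm C0).
Qed.

End Comparison.

(** * Comparison with the primes *)

Section AbstractLimit.
Variable R : realType.

Lemma cvg_series_sub (f g : nat -> R) (a b : R) :
  series f @ \oo --> a -> series g @ \oo --> b ->
  series (fun n => f n - g n) @ \oo --> a - b.
Proof.
move=> fa gb; rewrite (_ : series _ = series f - series g); first exact: cvgB.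
by apply/funext => n; rewrite fctE /series/= -sumrB.
Qed.

Lemma cvg_series_add (f g : nat -> R) (a b : R) :
  series f @ \oo --> a -> series g @ \oo --> b ->
  series (fun n => f n + g n) @ \oo --> a + b.
Proof.
move=> fa gb; rewrite (_ : series _ = series f + series g); first exact: cvgD.
by apply/funext => n; rewrite fctE /series/= -big_split.
Qed.

Lemma cvg_seriesZ (f : nat -> R) (k a : R) :
  series f @ \oo --> a -> series (fun n => k * f n) @ \oo --> k * a.
Proof.
move=> fa; rewrite (_ : series _ = fun n => k * series f n).
  by apply: cvgM => //; exact: cvg_cst.
by apply/funext => n; rewrite /series/= mulr_sumr.
Qed.

(* The sums over [A] and over the primes, weighted by [c], are compared: their
   difference tends to [c * zeta 1] along [s -> 0], while the smooth parts
   [F s] cancel because [A] and the primes have the same logarithmic density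
   up to the factor [c]. *)
Lemma starter_limit (A : pred nat) (N : nat -> nat) (P m q : nat) (c : R) :
  A 0%N = false -> (0 < m)%N ->
  (forall n, A n -> (n <= N n)%N && (N n <= 2 ^ ((trunc_log 2 n).+1 + q))%N) ->
  cvgn (series (fun j =>
    \sum_((2 ^ j)%N <= n < (2 ^ j.+1)%N | A n) n%:R^-1 - c * prec R j)) ->
  cvgn (series (fun n => if A n then n%:R^-1 / (trunc_log 2 n).+1%:R else 0 : R)) ->
  (forall i, series (fun n => if A n then T (sg R i) P m n (N n) else 0) @ \oo --> (0 : R)) ->
  cvgn (series (fun n => `|if A n then T (0 : R) P m n (N n) else 0|)) /\
  series (fun n => if A n then T 0 P m n (N n) else 0) @ \oo -->
    c * (zeta 1 * (1 - expR (- euler_gamma R))).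
Proof.
move=> A0 m0 AN cD cA T0.
have [C1 C10 H1] := T_approx R P q m0.
have [C2 C20 H2] := T_approx R 1 0 (ltnSn 0).
pose a n : R := if A n then n%:R^-1 / (trunc_log 2 n).+1%:R else 0.
pose g n := C1 * a n + `|c| * (C2 * prime_tail R n).
have a_ge0 n : 0 <= a n by rewrite /a; case: ifP => // _; rewrite divr_ge0.
have pt_ge0 n : 0 <= prime_tail R n.
  by rewrite /prime_tail; case: ifP => // _; rewrite divr_ge0.
have cg : cvgn (series g).
  apply/cvg_ex; eexists; apply: cvg_series_add.
    by apply: cvg_seriesZ; exact: cA.
  by apply: cvg_seriesZ; apply: cvg_seriesZ; exact: prime_tail_cvg.
pose d n : R := (if A n then n%:R^-1 else 0) - c * (if prime n then n%:R^-1 else 0).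
pose TA (s : R) n := if A n then T s P m n (N n) else 0.
have An0 n : A n -> (0 < n)%N by case: n => //; rewrite A0.
have HA s n : 0 <= s <= 1 ->
    `|TA s n - (if A n then n%:R^-1 else 0) * F s (trunc_log 2 n)| <= C1 * a n.
  move=> s01; rewrite /TA /a; case: ifP => An; last by rewrite mul0r subr0 normr0 mulr0.
  by have /andP[h1 h2] := AN n An; apply: H1 => //; exact: An0.
have HP s n : 0 <= s <= 1 ->
    `|prime_term s n - (if prime n then n%:R^-1 else 0) * F s (trunc_log 2 n)| <=
    C2 * prime_tail R n.
  move=> s01; rewrite /prime_term /prime_tail; case: ifP => pn; last first.
    by rewrite mul0r subr0 normr0 mulr0.
  by apply: H2; rewrite ?prime_gt0// addn0; exact: trunc_log_ltn.
have sg01 i : 0 <= sg R i <= 1 by rewrite sg_le1 ltW// sg_gt0.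
(* What is left after both smooth models are removed: [g] dominates it uniformly in [i], and [h],
   the difference at [s = 0], is its pointwise limit because [F] tends to 0. *)
pose f i n := TA (sg R i) n - c * prime_term (sg R i) n - d n * F (sg R i) (trunc_log 2 n).
pose h n := TA 0 n - c * prime_term 0 n.
have fg i n : `|f i n| <= g n.
  have -> : f i n = (TA (sg R i) n - (if A n then n%:R^-1 else 0) * F (sg R i) (trunc_log 2 n)) -
    c * (prime_term (sg R i) n - (if prime n then n%:R^-1 else 0) * F (sg R i) (trunc_log 2 n)).
    by rewrite /f /d; ring.
  apply: (le_trans (ler_normB _ _)); apply: lerD; first exact: HA.
  by rewrite normrM ler_wpM2l//; exact: HP.
have fh n : f i n @[i --> \oo] --> h n.
  rewrite -[h n]subr0 -[X in _ - X](mulr0 (d n)); apply: cvgB; last first.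
    by apply: cvgM; [exact: cvg_cst | exact: cvg_F].
  apply: cvgB.
    by rewrite /TA; case: ifP => _; [exact: cvg_T | exact: cvg_cst].
  apply: cvgM; first exact: cvg_cst.
  by rewrite /prime_term; case: ifP => _; [exact: cvg_T | exact: cvg_cst].
have cf i : cvgn (series (f i)) by exact: dominated_series_cvg (fg i) cg.
have [x hx xlim] := prime_term_infinity R.
(* The total of the smooth parts; the leading 0 is the vanishing sum over [A] at [s = sg R i]. *)
pose z i := 0 - c * x i - limn (series (f i)).
have dz i : series (fun n => d n * F (sg R i) (trunc_log 2 n)) @ \oo --> z i.
  rewrite (_ : (fun n => _) = fun n => (TA (sg R i) n - c * prime_term (sg R i) n) - f i n).
    apply: cvg_series_sub; last exact: cf.
    by apply: cvg_series_sub; [exact: T0 | exact: cvg_seriesZ].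
  by apply/funext => n; rewrite /f; ring.
pose D j := \sum_((2 ^ j)%N <= n < (2 ^ j.+1)%N | A n) n%:R^-1 - c * prec R j.
have d0 : d 0%N = 0 by rewrite /d A0/= mulr0 subr0.
(* [F] depends on [n] only through its block, so the coefficients can be collected into block sums
   [D j], whose series converges. *)
have Dz i : series (fun j => D j * F (sg R i) j) @ \oo --> z i.
  have c2 := cvg_comp _ _ cvg_expn2 (dz i).
  apply: cvg_trans c2; apply: near_eq_cvg; apply: nearW => J /=.
  rewrite series_dyadic ?d0 ?mul0r//; apply: eq_bigr => j _.
  have -> : D j = \sum_((2 ^ j)%N <= n < (2 ^ j.+1)%N) d n.
    rewrite /D /prec big_mkcond [X in _ - c * X]big_mkcond mulr_sumr -sumrB.
    by apply: eq_bigr => n _; rewrite /d.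
  rewrite mulr_suml big_nat_cond [RHS]big_nat_cond.
  by apply: eq_bigr => n /andP[/trunc_log_bucket -> _].
have z0 : z @ \oo --> 0.
  have [C HC] := F_variation R.
  rewrite -(mulr0 (limn (series D))).
  apply: (@abel_bounded_variation _ D _ (fun i j => F (sg R i) j) C) => //.
  - by move=> i n; exact: HC.
  - by move=> k; exact: cvg_F.
have [L cL lL] := @tannery R f g h _ fg cg fh cf.
have L_eq : L = c * zeta 1.
  apply: (cvg_unique (@Rhausdorff R) lL).
  rewrite (_ : (fun i => _) = fun i => - (c * x i) - z i).
    have -> : c * zeta 1 = - (c * - zeta 1) - 0 :> R by ring.
    by apply: cvgB => //; apply: cvgN; apply: cvgM => //; exact: cvg_cst.
  by apply/funext => i; rewrite /z; ring.
(* At [s = 0] the model [F] vanishes, so the approximation becomes an absolute bound. *)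
have TA0 n : `|TA 0 n| <= C1 * a n.
  by have := @HA 0 n; rewrite F0 mulr0 subr0 lexx ler01 => /(_ isT).
have PT0 n : `|prime_term (0 : R) n| <= C2 * prime_tail R n.
  by have := @HP 0 n; rewrite F0 mulr0 subr0 lexx ler01 => /(_ isT).
have cC1 : cvgn (series (fun n => C1 * a n)) by exact: is_cvg_seriesZ.
have cP : cvgn (series (prime_term (0 : R))).
  apply: dominated_series_cvg PT0 _; apply: is_cvg_seriesZ; exact: prime_tail_cvg.
split.
  by apply: dominated_series_cvg cC1 => n; rewrite normr_id; exact: TA0.
have limP : limn (series (prime_term (0 : R))) = - (zeta 1 * expR (- euler_gamma R)).
  have c2 := cvg_comp _ _ cvg_expn2 cP.
  exact: (cvg_unique (@Rhausdorff R) c2 (@prime_term_zero R)).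
rewrite (_ : (fun n => _) = fun n => h n - - c * prime_term 0 n); last first.
  by apply/funext => n; rewrite /h /TA; ring.
have -> : c * (zeta 1 * (1 - expR (- euler_gamma R))) =
    c * zeta 1 - - c * limn (series (prime_term (0 : R))).
  by rewrite limP; ring.
by apply: cvg_series_sub; [rewrite -L_eq | exact: cvg_seriesZ].
Qed.

End AbstractLimit.

(** * Optional stopping *)

Section Starters.
Variables (N : nat -> nat) (m : nat).
Hypothesis m_gt0 : (0 < m)%N.
Let M := max_pdiv m.

(** The admissible lists of primes, with [p <= theta n] replaced by [p < N n] for an integer bound
    [N]. *)
Definition chain (s : seq nat) : Prop :=
  [/\ all prime s, path ltn M s &
    forall i, (i < size s)%N -> (nth 0%N s i < N (m * \prod_(p <- take i s) p))%N].

Lemma chain_rcons s p : chain (rcons s p) <->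
  [/\ chain s, prime p, (last M s < p)%N & (p < N (m * \prod_(p <- s) p))%N].
Proof.
rewrite /chain all_rcons rcons_path size_rcons; split.
  move=> [/andP[pp ps] /andP[pths lsp] H]; split => //; last first.
    by have := H (size s) (leqnn _); rewrite nth_rcons ltnn eqxx -cats1 take_size_cat.
  split => // i si; have := H i (ltnW si).
  by rewrite nth_rcons si -cats1 takel_cat// ltnW.
move=> [[ps pths H] pp lsp pN]; split; [by rewrite pp|by rewrite pths|].
move=> i; rewrite ltnS leq_eqVlt => /orP[/eqP->|si].
  by rewrite nth_rcons ltnn eqxx -cats1 take_size_cat.
by rewrite nth_rcons si -cats1 takel_cat ?(ltnW si)//; exact: H.
Qed.

Lemma leq_last_path s x : path ltn x s -> (x <= last x s)%N.
Proof.
elim: s x => [|y s IH] x //= /andP[xy /IH]; exact/leq_trans/ltnW.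
Qed.

(** The states reachable once all primes up to [y] are revealed: each state survives, and one whose
    bound is not passed also spawns its product with [y]. *)
Fixpoint starters (y : nat) : seq nat :=
  if y is y'.+1 then
    if prime y && (M < y)%N then
      starters y' ++ [seq (a * y)%N | a <- starters y' & (y < N a)%N]
    else starters y'
  else [:: m].

Lemma starters_chain y n : n \in starters y ->
  exists2 s, chain s /\ (last M s <= maxn M y)%N & n = (m * \prod_(p <- s) p)%N.
Proof.
elim: y n => [|y IH] n /=.
  by rewrite inE => /eqP ->; exists [::];
    [split => //=; rewrite leq_max leqnn | rewrite big_nil muln1].
have IH' : n \in starters y ->
    exists2 s, chain s /\ (last M s <= maxn M y.+1)%N & n = (m * \prod_(p <- s) p)%N.
  move=> /IH[s [cs ls] ->]; exists s => //; split => //; apply: (leq_trans ls).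
  by rewrite geq_max leq_maxl/= leq_max leqnSn orbT.
case: ifP => // /andP[py My]; rewrite mem_cat => /orP[//|/mapP[a]].
rewrite mem_filter => /andP[yN /IH[s [cs ls] ea]] ->.
exists (rcons s y.+1); last by rewrite ea -cats1 big_cat big_seq1/= mulnA.
split; last by rewrite last_rcons leq_max leqnn orbT.
apply/chain_rcons; split => //; last by rewrite -ea.
by rewrite (leq_ltn_trans ls)// gtn_max My ltnSn.
Qed.

Lemma starters_sub y z : (y <= z)%N -> {subset starters y <= starters z}.
Proof.
elim: z => [|z IH]; first by rewrite leqn0 => /eqP ->.
rewrite leq_eqVlt => /orP[/eqP -> //|]; rewrite ltnS => /IH yz n /yz nz /=.
by case: ifP => // _; rewrite mem_cat nz.
Qed.

Lemma chain_starters s y : chain s -> (last M s <= y)%N ->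
  (m * \prod_(p <- s) p)%N \in starters y.
Proof.
elim/last_ind: s y => [|s p IH] y.
  move=> _ _; rewrite big_nil muln1; apply: (starters_sub (leq0n y)).
  by rewrite inE.
move=> /chain_rcons[cs pp lsp pN]; rewrite last_rcons => py.
apply: (starters_sub py); case: p pp lsp pN {py} => // p pp lsp pN.
have [_ pths _] := cs.
rewrite /= pp (leq_ltn_trans (leq_last_path pths))//= mem_cat; apply/orP; right.
apply/mapP; exists (m * \prod_(p <- s) p)%N; last by rewrite -cats1 big_cat big_seq1/= mulnA.
by rewrite mem_filter pN IH.
Qed.

Lemma chain_prod_gt0 s : chain s -> (0 < m * \prod_(p <- s) p)%N.
Proof.
move=> [/allP ps _ _]; rewrite muln_gt0 m_gt0 big_seq.
by apply: prodn_cond_gt0 => p /ps/prime_gt0.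
Qed.

Lemma last_chain_leq s : chain s -> (last M s <= m * \prod_(p <- s) p)%N.
Proof.
elim/last_ind: s => [|s p _] cs; first by rewrite big_nil muln1 max_pdiv_leq.
rewrite last_rcons; apply: dvdn_leq; first exact: chain_prod_gt0.
by rewrite -cats1 big_cat big_seq1/= mulnA dvdn_mull.
Qed.

(** A new product [a * y] is divisible by [y] while no earlier state is, so the enumeration has no
    repetitions. *)
Lemma starters_ndvd y n : n \in starters y ->
  (0 < n)%N /\ forall q, prime q -> (maxn M y < q)%N -> ~~ (q %| n)%N.
Proof.
elim: y n => [|y IH] n /=.
  rewrite inE => /eqP ->; split => // q pq; rewrite gtn_max => /andP[Mq _].
  apply/negP => qm; have : q \in \pi(m) by rewrite inE/= mem_primes pq m_gt0.
  by move=> /max_pdiv_max; rewrite leqNgt Mq.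
have IH' : n \in starters y ->
    (0 < n)%N /\ forall q, prime q -> (maxn M y.+1 < q)%N -> ~~ (q %| n)%N.
  move=> /IH[n0 H]; split => // q pq; rewrite gtn_max => /andP[Mq yq]; apply: H => //.
  by rewrite gtn_max Mq ltnW.
case: ifP => // /andP[py My]; rewrite mem_cat => /orP[//|/mapP[a]].
rewrite mem_filter => /andP[_ /IH[a0 H]] ->; split; first by rewrite muln_gt0 a0.
move=> q pq; rewrite gtn_max => /andP[Mq yq]; rewrite Euclid_dvdM// negb_or.
rewrite H//= ?gtn_max ?Mq ?(ltnW yq)//.
by rewrite dvdn_prime2// gtn_eqF.
Qed.

Lemma uniq_starters y : uniq (starters y).
Proof.
elim: y => [|y IH] //=; case: ifP => // /andP[py My].
rewrite cat_uniq IH/= map_inj_uniq ?filter_uniq// ?andbT; last first.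
  by move=> a b /eqP; rewrite eqn_pmul2r// => /eqP.
apply/hasPn => n /mapP[a _ ->]; apply/negP => /starters_ndvd[_ H].
by have := H y.+1 py; rewrite gtn_max My ltnSn dvdn_mull// => /(_ isT).
Qed.

Lemma starters_leq_max y : (y <= M)%N -> starters y = [:: m].
Proof.
elim: y => [|y IH] //= yM; rewrite IH ?(ltnW yM)//.
by rewrite ltnNge yM andbF.
Qed.

End Starters.

(** * The stopped martingale and the vanishing of the sum for [s > 0] *)

Section OptionalStopping.
Variables (R : realType) (N : nat -> nat) (m q : nat).
Hypothesis m_gt0 : (0 < m)%N.
Hypothesis N_gt : forall n, (0 < n)%N -> (n < N n)%N.
Let M := max_pdiv m.
Implicit Types (s : R) (a n y : nat).

(** The contribution of state [a] at time [y]: only primes up to [y] are revealed, and none at or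
    beyond [N a]. *)
Definition stopped_term s y a : R := T s M m a (minn (N a) y.+1).

Lemma V_S s n : V s n.+1 = if prime n then V s n / (1 + w s n) else V s n.
Proof.
rewrite /V big_mkcond big_nat_recr//= -big_mkcond/=.
by case: ifP => //; rewrite mulr1.
Qed.

Lemma B_S s P n : B s P n.+1 =
  if prime n && (P < n)%N then B s P n + ln n%:R * (w s n / (1 + w s n)) else B s P n.
Proof.
rewrite /B big_mkcond big_nat_recr//= -big_mkcond/=.
by case: ifP => //; rewrite addr0.
Qed.

(* Revealing the prime [y.+1] is a fair bet: the process stays at [a] or moves
   to [a * y.+1] with probabilities proportional to [1] and [w s y.+1]. *)
Lemma stopped_termS s y a : 0 <= s -> (0 < a)%N -> prime y.+1 -> (M < y.+1)%N ->
  stopped_term s y a = stopped_term s y.+1 a +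
    (if (y.+1 < N a)%N then stopped_term s y.+1 (a * y.+1) else 0).
Proof.
move=> s0 a0 py My; rewrite /stopped_term; have [yN|yN] := ltnP y.+1 (N a); last first.
  by rewrite (minn_idPl (leqW yN)) addr0.
have ap0 : (0 < a * y.+1)%N by rewrite muln_gt0 a0.
(* Since [N n > n], the new product is still running after the prime just kept, so both states have
   cutoff [y.+2]. *)
have yN' : (y.+2 <= N (a * y.+1))%N by rewrite (leq_trans _ (N_gt ap0))// ltnS leq_pmull.
rewrite (minn_idPr yN) (minn_idPr yN').
rewrite /T !(V_S s y.+1) !(B_S s M y.+1) py My wM//=.
have h : 0 < 1 + w s y.+1 by rewrite ltr_pwDl// w_ge0.
have -> : ln ((a * y.+1)%:R / m%:R) = ln (a%:R / m%:R) + ln y.+1%:R :> R.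
  rewrite natrM mulrAC lnM ?posrE ?divr_gt0 ?ltr0n//.
by field; rewrite gt_eqF.
Qed.

Lemma sum_stopped_term s y : 0 <= s -> \sum_(a <- starters N m y) stopped_term s y a = 0.
Proof.
move=> s0; elim: y => [|y IH].
  rewrite big_seq1 /stopped_term /T /B big_nat_cond big1 ?sub0r.
    by rewrite divff ?pnatr_eq0 -?lt0n// ln1 oppr0 mulr0 mul0r.
  move=> p /andP[/andP[_ +] /andP[pp _]]; rewrite leq_min => /andP[_].
  by rewrite ltnS leqn0 => /eqP p0; rewrite p0 in pp.
have [yM|My] := leqP y.+1 M.
  rewrite starters_leq_max// big_seq1 /stopped_term /T /B big_nat_cond big1 ?sub0r.
    by rewrite divff ?pnatr_eq0 -?lt0n// ln1 oppr0 mulr0 mul0r.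
  move=> p /andP[/andP[_ +] /andP[_ Mp]]; rewrite leq_min ltnS => /andP[_ py].
  by move: (leq_trans py yM); rewrite leqNgt Mp.
rewrite /= My andbT; case: ifP => py; last first.
  rewrite -[RHS]IH; apply: eq_bigr => a _; rewrite /stopped_term.
  have [yN|yN] := ltnP y.+1 (N a); last first.
    by rewrite (minn_idPl (leqW yN)).
  by rewrite (minn_idPr yN) /T !(V_S s y.+1) !(B_S s M y.+1) py.
rewrite big_cat big_map big_filter/= [X in _ + X]big_mkcond -big_split/= -[RHS]IH.
rewrite [LHS]big_seq [RHS]big_seq; apply: eq_bigr => a /(starters_ndvd m_gt0)[a0 _].
by rewrite -stopped_termS.
Qed.

Hypothesis N_le : forall n, (0 < n)%N -> (N n <= 2 ^ ((trunc_log 2 n).+1 + q))%N.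

(** Uniform in the time [y], because [B] is increasing and at [N n] it is at most [ln n + O(1)].
    This majorant justifies optional stopping. *)
Lemma stopped_term_bound : exists2 C : R, 0 <= C & forall s y n, 0 <= s -> (0 < n)%N ->
  `|stopped_term s y n| <= w s n * (2 * ln n%:R + C).
Proof.
have [C C0 HC] := B_approx R M q.
exists (C + ln 2 + ln m%:R); first by rewrite !addr_ge0 ?ln_nat_ge0.
move=> s y n s0 n0; rewrite /stopped_term /T.
have V0 := V_gt0 (minn (N n) y.+1) s0.
rewrite normrM normrM (ger0_norm (w_ge0 s n)) (ger0_norm (ltW V0)) -mulrA ler_wpM2l ?w_ge0//.
apply: (@le_trans _ _ (`|B s M (minn (N n) y.+1) - ln (n%:R / m%:R)| * 1)).
  by rewrite ler_wpM2l// V_le1.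
rewrite mulr1 (le_trans (ler_normB _ _))//.
have B0 : 0 <= B s M (minn (N n) y.+1).
  by apply: sumr_ge0 => p _; rewrite mulr_ge0 ?divr_ge0 ?addr_ge0 ?w_ge0 ?ln_nat_ge0.
have /andP[jn nj] := trunc_log_bounds (ltnSn 1) n0; set j := trunc_log 2 n in jn nj.
have lj : j%:R * ln 2 <= ln n%:R :> R by rewrite -ln_expn2 ler_ln_nat ?expn_gt0.
have B1' : B s M (minn (N n) y.+1) <= ln n%:R + ln 2 + C.
  apply: (@le_trans _ _ (B s M (N n))); first exact/B_nondecreasing/geq_minl.
  have := HC s j (N n) s0; rewrite N_le// (leq_trans jn (ltnW (N_gt n0))) => /(_ isT isT).
  rewrite ler_norml => /andP[_]; rewrite lerBlDr => /le_trans; apply.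
  rewrite addrC lerD2r.
  have := ler_wpM2l (ln_nat_ge0 R 2) (geo_le j (npow2_bounds s0)).
  by rewrite -(natr1 j); move: lj; rewrite mulrDr mulr1 mulrC; lra.
have h := ler_normB (ln n%:R : R) (ln m%:R).
rewrite (ger0_norm (ln_nat_ge0 R n)) (ger0_norm (ln_nat_ge0 R m)) in h.
rewrite (ger0_norm B0) ln_div ?posrE ?ltr0n//.
move: B1' h; move: (B _ _ _) (ln n%:R : R) => b x; move: `|x - _| => d *; lra.
Qed.

(** Half of the exponent [s] absorbs the logarithm: [n^(-s/2) ln n <= 2/s]. *)
Lemma w_ln_cvg s (C : R) : 0 < s -> 0 <= C -> cvgn (series (fun n => w s n * (2 * ln n%:R + C))).
Proof.
move=> s0 C0; have s20 : 0 < s / 2 by rewrite divr_gt0.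
apply: (@dominated_series_cvg _ _ (fun n => (4 / s + C) * w (s / 2) n)); last first.
  by apply/cvg_ex; eexists; apply: cvg_seriesZ; exact: w_series_cvg.
move=> n; rewrite ger0_norm; last by rewrite mulr_ge0 ?w_ge0// addr_ge0// mulr_ge0// ln_nat_ge0.
have h1 : w s n = w (s / 2) n * npow (s / 2) n.
  by rewrite /w -mulrA -expRD; congr (_ * expR _); field.
have h2 : w s n <= w (s / 2) n by apply: w_anti; lra.
have h3 : npow (s / 2) n * ln n%:R <= 2 / s.
  have h := @expR_ge1Dx R (s / 2 * ln n%:R).
  have e : npow (s / 2) n * expR (s / 2 * ln n%:R) = 1.
    by rewrite -expRD mulNr addNr expR0.
  have h4 := ler_wpM2l (npow_ge0 (s / 2) n) h; rewrite e in h4.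
  rewrite ler_pdivlMr//; have := npow_ge0 (s / 2) n; lra.
rewrite mulrDr [leRHS]mulrDl; apply: lerD; last by rewrite mulrC ler_wpM2l.
have h5 := ler_wpM2l (w_ge0 (s / 2) n) h3.
have -> : w s n * (2 * ln n%:R) = 2 * (w (s / 2) n * (npow (s / 2) n * ln n%:R)).
  by rewrite h1; ring.
have -> : 4 / s * w (s / 2) n = 2 * (w (s / 2) n * (2 / s)) by ring.
by rewrite ler_pM2l.
Qed.

(** The sums at finite times vanish, and [y] is sent to infinity by dominated convergence: [n] is
    listed once [y >= n] and its term is final once [y >= N n]. The majorant needs [s > 0]. *)
Lemma sum_T_zero (A : pred nat) s : 0 < s ->
  (forall n, reflect (exists2 t, chain N m t & n = (m * \prod_(p <- t) p)%N) (A n)) ->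
  series (fun n => if A n then T s M m n (N n) else 0) @ \oo --> (0 : R).
Proof.
move=> s0 AP; have [C C0 HC] := stopped_term_bound.
pose f y n := if n \in starters N m y then stopped_term s y n else 0.
have fA y n : n \in starters N m y -> A n.
  by move=> /starters_chain[t [ct _] e]; apply/AP; exists t.
have Af n y : A n -> (n <= y)%N -> n \in starters N m y.
  move=> /AP[t ct e] ny; rewrite e; apply: chain_starters => //.
  by apply: leq_trans ny; rewrite e; exact: last_chain_leq ct.
have [i n||n|y|L cL lL] := @tannery R f (fun n => w s n * (2 * ln n%:R + C))
  (fun n => if A n then T s M m n (N n) else 0) (fun=> 0).
- rewrite /f; case: ifP => [/(starters_ndvd m_gt0)[n0 _]|_]; first exact/HC/n0/ltW.
  by rewrite normr0 mulr_ge0 ?w_ge0// addr_ge0// mulr_ge0// ln_nat_ge0.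
- exact: w_ln_cvg.
- apply: cvg_near_cst; exists (maxn n (N n)) => // y /=; rewrite geq_max => /andP[ny Ny].
  rewrite /f; have -> : (n \in starters N m y) = A n.
    by apply/idP/idP => [/fA//|/Af]; apply.
  by case: ifP => // An; rewrite /stopped_term (minn_idPl (leqW Ny)).
- apply: cvg_near_cst; exists (\max_(a <- starters N m y) a).+1 => // X /= HX.
  rewrite -(sum_stopped_term y (ltW s0)) /series/= -big_mkcond/= -big_filter.
  apply: perm_big; apply: uniq_perm; rewrite ?filter_uniq ?iota_uniq ?uniq_starters//.
  move=> n; rewrite mem_filter mem_index_iota/=.
  case: (boolP (n \in _)) => //= nL; apply: leq_ltn_trans HX.
  by rewrite (big_rem n)//= leq_maxl.
- suff L0 : L = 0 by rewrite L0 in cL.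
  by apply: (cvg_unique (@Rhausdorff R) lL); exact: cvg_cst.
Qed.

End OptionalStopping.

(** * Density of a starter set *)

Section LogDensity.
Variable R : realType.
Variables (A : pred nat) (c K : R).

Definition count n : R := (\sum_(1 <= k < n.+1 | A k) 1)%N%:R.

Hypothesis K_ge0 : 0 <= K.
Hypothesis count_approx : forall n, (2 <= n)%N ->
  `|count n - c * (n%:R / ln n%:R)| <= K * (n%:R / ln n%:R ^+ 2).

Lemma countS n : count n.+1 = count n + (A n.+1)%:R.
Proof.
rewrite /count big_mkcond big_nat_recr//= -big_mkcond/= natrD; congr (_ + _).
Qed.

(** [count] includes its endpoint; subtracting [A X] and [A M] adjusts it to the half-open range. *)
Lemma sum_inv_by_parts (M X : nat) : (0 < M)%N -> (M <= X)%N ->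
  \sum_(M <= n < X | A n) n%:R^-1 =
  (count X - (A X)%:R) / X%:R - (count M - (A M)%:R) / M%:R +
  \sum_(M <= n < X) count n / n%:R / n.+1%:R.
Proof.
move=> M0; elim: X => [|X IH]; first by rewrite leqn0 => /eqP M00; rewrite M00 in M0.
rewrite leq_eqVlt => /orP[/eqP <-|]; first by rewrite !big_geq// subrr addr0.
rewrite ltnS => MX; rewrite big_mkcond big_nat_recr//= -big_mkcond/= IH//.
rewrite [in RHS]big_nat_recr//= countS addrK.
have X0 : X%:R != 0 :> R by rewrite pnatr_eq0 -lt0n (leq_trans M0).
have e : X.+1%:R = X%:R + 1 :> R by rewrite natr1.
have X1 : X%:R + 1 != 0 :> R by rewrite natr1 pnatr_eq0.
rewrite e; move: (_ / M%:R) (\sum_(_ <= _ < _) _) (X%:R) X0 X1 => a b x X0 X1.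
by case: (A X) => /=; field; rewrite X0 X1.
Qed.

Lemma count_ratio j n : (0 < j)%N -> (2 ^ j <= n <= 2 ^ j.+1)%N ->
  `|count n / n%:R - c / (j.+1%:R * ln 2)| <= (K / ln 2 ^+ 2 + `|c| / ln 2) / j%:R ^+ 2.
Proof.
move=> j0 /andP[jn nj].
have l0 : 0 < ln 2 :> R by rewrite ln_gt0// ltr1n.
have n2 : (2 <= n)%N by rewrite (leq_trans _ jn)// -[X in (X <= _)%N]expn1 leq_exp2l.
have n0 : 0 < n%:R :> R by rewrite ltr0n ltnW.
have jR : 0 < j%:R :> R by rewrite ltr0n.
have jR1 : 0 < j.+1%:R :> R by rewrite ltr0n.
have ln1' : j%:R * ln 2 <= ln n%:R :> R by rewrite -ln_expn2 ler_ln_nat ?expn_gt0.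
have ln2' : ln n%:R <= j.+1%:R * ln 2 :> R by rewrite -ln_expn2 ler_ln_nat// ltnW.
have jl : 0 < j%:R * ln 2 :> R by rewrite mulr_gt0.
have lnn : 0 < ln n%:R :> R by exact: lt_le_trans ln1'.
have -> : count n / n%:R - c / (j.+1%:R * ln 2) =
    (count n - c * (n%:R / ln n%:R)) / n%:R + c * ((ln n%:R)^-1 - (j.+1%:R * ln 2)^-1).
  have -> : (count n - c * (n%:R / ln n%:R)) / n%:R = count n / n%:R - c * (ln n%:R)^-1.
    by field; rewrite !gt_eqF.
  ring.
apply: (le_trans (ler_normD _ _)); rewrite [leRHS]mulrDl; apply: lerD.
  rewrite normrM normfV (ger0_norm (ltW n0)) ler_pdivrMr//.
  apply: (le_trans (count_approx n2)).
  rewrite mulrA mulrAC ler_wpM2r ?(ltW n0)// -mulrA -invfM ler_wpM2l//.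
  rewrite lef_pV2 ?posrE ?mulr_gt0 ?exprn_gt0// -exprMn ler_sqr ?nnegrE ?(ltW lnn)//.
    by rewrite mulrC.
  by rewrite mulr_ge0// ltW.
rewrite normrM -mulrA ler_wpM2l//.
have h1 : (ln n%:R)^-1 <= (j%:R * ln 2)^-1 :> R by rewrite lef_pV2 ?posrE.
have h2 : (j.+1%:R * ln 2)^-1 <= (ln n%:R)^-1 :> R by rewrite lef_pV2 ?posrE ?mulr_gt0.
rewrite ger0_norm ?subr_ge0//; apply: (le_trans (lerD h1 (lexx _))).
have e : j.+1%:R = j%:R + 1 :> R by rewrite natr1.
rewrite e; move: (j%:R) jR (ln 2) l0 => x x0 l l0'.
rewrite -subr_ge0 (_ : _ - _ = (l * x ^+ 2 * (x + 1))^-1).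
  by rewrite invr_ge0 ltW// !mulr_gt0 ?exprn_gt0//; lra.
by field; rewrite !gt_eqF//; lra.
Qed.

Lemma harmonic_bucket j :
  ln 2 - (2 ^ j)%:R^-1 <= \sum_((2 ^ j)%N <= n < (2 ^ j.+1)%N) n.+1%:R^-1 :> R /\
  \sum_((2 ^ j)%N <= n < (2 ^ j.+1)%N) n.+1%:R^-1 <= ln 2 :> R.
Proof.
have le2 : (2 ^ j <= 2 ^ j.+1)%N by rewrite leq_exp2l.
have p0 : (0 < 2 ^ j)%N by rewrite expn_gt0.
have tl : \sum_((2 ^ j)%N <= n < (2 ^ j.+1)%N) (ln n.+1%:R - ln n%:R) = ln 2 :> R.
  rewrite (telescope_sumr (fun n => ln n%:R : R) le2) !ln_expn2 -natr1; ring.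
have ti : \sum_((2 ^ j)%N <= n < (2 ^ j.+1)%N) (n.+1%:R^-1 - n%:R^-1) =
    (2 ^ j.+1)%:R^-1 - (2 ^ j)%:R^-1 :> R.
  by rewrite (telescope_sumr (fun n => n%:R^-1 : R) le2).
split; last first.
  rewrite -[leRHS]tl big_nat_cond [leRHS]big_nat_cond; apply: ler_sum => n.
  rewrite andbT => /andP[jn _].
  by have /andP[] := @lnS_sub R n (leq_trans p0 jn).
rewrite -tl lerBlDr -lerBlDl -sumrB.
apply: (@le_trans _ _ (\sum_((2 ^ j)%N <= n < (2 ^ j.+1)%N) (n%:R^-1 - n.+1%:R^-1))).
  rewrite big_nat_cond [leRHS]big_nat_cond; apply: ler_sum => n.
  rewrite andbT => /andP[jn _]; rewrite lerD2r.
  by have /andP[] := @lnS_sub R n (leq_trans p0 jn).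
have -> : \sum_((2 ^ j)%N <= n < (2 ^ j.+1)%N) (n%:R^-1 - n.+1%:R^-1) =
  (2 ^ j)%:R^-1 - (2 ^ j.+1)%:R^-1 :> R.
  by rewrite -[RHS]opprB -ti -sumrN; apply: eq_bigr => n _; rewrite opprB.
by rewrite gerBl.
Qed.

Lemma sqr_le_expn2 j : (j.+1 ^ 2 <= 4 * 2 ^ j)%N.
Proof.
elim: j => [|[|[|j]] IH] //; move: IH; rewrite !expnS !expn0 !muln1.
by move: (2 ^ j)%N => x; nia.
Qed.

(** In partial summation over a block both boundary terms are close to [k = c / ((j+1) ln 2)] and
    nearly cancel; the remaining sum is close to [k ln 2 = c / (j+1)]. *)
Lemma bucket_density : exists2 C : R, 0 <= C & forall j,
  `|\sum_((2 ^ j)%N <= n < (2 ^ j.+1)%N | A n) n%:R^-1 - c / j.+1%:R| <= C * j.+1%:R ^- 2.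
Proof.
have l0 : 0 < ln 2 :> R by rewrite ln_gt0// ltr1n.
have l1 : ln 2 <= 1 :> R by have := @le_ln1Dx R 1; apply; lra.
set E := K / ln 2 ^+ 2 + `|c| / ln 2.
have E0 : 0 <= E by rewrite addr_ge0 ?divr_ge0 ?exprn_ge0// ltW.
have cl0 : 0 <= `|c| / ln 2 by rewrite divr_ge0// ltW.
have Q0 : 0 <= 3 * E + 8 + 4 * (`|c| / ln 2).
  by move: E (`|c| / ln 2) E0 cl0 => x y *; lra.
exists (4 * (3 * E + 8 + 4 * (`|c| / ln 2)) + (1 + `|c|)).
  by rewrite addr_ge0 ?mulr_ge0// addr_ge0.
case=> [|j].
  (* Block 0 is [{1}], below the range of [count_approx]; it accounts for the summand [1 + |c|]. *)
  rewrite expr1n invr1 !mulr1 expn0 expn1 big_mkcond big_nat1.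
  apply: (@le_trans _ _ (1 + `|c|)); last first.
    by rewrite lerDr mulr_ge0.
  apply: (le_trans (ler_normB _ _)); rewrite lerD2r.
  by case: ifP => _; rewrite ?invr1 ?normr1 ?normr0.
set J := j.+1; have J0 : (0 < J)%N by [].
have p0 : (0 < 2 ^ J)%N by rewrite expn_gt0.
have le2 : (2 ^ J <= 2 ^ J.+1)%N by rewrite leq_exp2l.
have JR : 0 < J%:R :> R by rewrite ltr0n.
have JR1 : 0 < J.+1%:R :> R by rewrite ltr0n.
rewrite sum_inv_by_parts//; set k := c / (J.+1%:R * ln 2).
have [hl hu] := harmonic_bucket J.
set Hs := \sum_(_ <= _ < _) _ in hl hu.
set X : R := (2 ^ J.+1)%:R; set M : R := (2 ^ J)%:R.
have X0 : 0 < X by rewrite ltr0n expn_gt0.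
have M0 : 0 < M by rewrite ltr0n expn_gt0.
have MV : M^-1 <= 4 * J%:R ^- 2.
  have h : J%:R ^+ 2 <= 4 * M :> R.
    rewrite -natrX -natrM ler_nat; apply: leq_trans (sqr_le_expn2 J).
    by rewrite leq_exp2r.
  by rewrite ler_pdivlMr ?exprn_gt0// mulrC ler_pdivrMr.
have XV : X^-1 <= M^-1 by rewrite lef_pV2 ?posrE// ler_nat.
set e := J%:R ^- 2 in MV.
have e0 : 0 <= e by rewrite invr_ge0 exprn_ge0// ltW.
have bnd n : (2 ^ J <= n <= 2 ^ J.+1)%N ->
    `|(count n - (A n)%:R) / n%:R - k| <= E * e + n%:R^-1.
  move=> Jn; have -> : (count n - (A n)%:R) / n%:R - k =
    (count n / n%:R - k) - (A n)%:R / n%:R by ring.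
  apply: (le_trans (ler_normB _ _)); apply: lerD; first exact: count_ratio.
  by rewrite ger0_norm// ler_piMl//; case: (A n).
have bX := bnd (2 ^ J.+1)%N; rewrite le2 leqnn in bX.
have bM := bnd (2 ^ J)%N; rewrite le2 leqnn in bM.
have kl : c / J.+1%:R = k * ln 2 by rewrite /k; field; rewrite !gt_eqF.
have k0 : `|k| <= `|c| / ln 2.
  rewrite /k normrM ler_wpM2l// ger0_norm; last by rewrite invr_ge0 mulr_ge0// ltW.
  by rewrite lef_pV2 ?posrE ?mulr_gt0// ler_peMl ?(ltW l0)// ler1n.
have bS : `|\sum_((2 ^ J)%N <= n < (2 ^ J.+1)%N) count n / n%:R / n.+1%:R - k * ln 2| <=
    E * e + `|c| / ln 2 * M^-1.
  have -> : \sum_((2 ^ J)%N <= n < (2 ^ J.+1)%N) count n / n%:R / n.+1%:R - k * ln 2 =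
    \sum_((2 ^ J)%N <= n < (2 ^ J.+1)%N) (count n / n%:R - k) / n.+1%:R + k * (Hs - ln 2).
    rewrite mulrBr addrA /Hs mulr_sumr -big_split/=; congr (_ - _).
    by apply: eq_bigr => n _; ring.
  apply: (le_trans (ler_normD _ _)); apply: lerD.
    apply: (le_trans (ler_norm_sum _ _ _)).
    apply: (@le_trans _ _ (\sum_((2 ^ J)%N <= n < (2 ^ J.+1)%N) E * e * n.+1%:R^-1)).
      rewrite big_nat_cond [leRHS]big_nat_cond; apply: ler_sum => n.
      rewrite andbT => /andP[Jn nJ]; rewrite normrM (@ger0_norm _ n.+1%:R^-1)//.
      by rewrite ler_wpM2r//; apply: count_ratio => //; rewrite Jn ltnW.
    by rewrite -mulr_sumr ler_piMr ?mulr_ge0// (le_trans hu).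
  rewrite normrM; apply: ler_pM => //.
  by rewrite distrC ger0_norm ?subr_ge0//; rewrite lerBlDr -lerBlDl.
set U := _ / X in bX *; set W := _ / M in bM *.
have -> : U - W + \sum_((2 ^ J)%N <= n < (2 ^ J.+1)%N) count n / n%:R / n.+1%:R - c / J.+1%:R =
    (U - k) - (W - k) + (\sum_((2 ^ J)%N <= n < (2 ^ J.+1)%N) count n / n%:R / n.+1%:R - k * ln 2).
  by rewrite kl; ring.
have ee : e <= 4 * J.+1%:R ^- 2.
  rewrite /e ler_pdivlMr ?exprn_gt0// mulrC ler_pdivrMr ?exprn_gt0//.
  have -> : 4 * J%:R ^+ 2 = (2 * J%:R) ^+ 2 :> R by ring.
  by rewrite ler_sqr ?nnegrE ?mulr_ge0// -natrM ler_nat mul2n -addnn addnS ltnS leq_addr.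
set e1 := J.+1%:R ^- 2 in ee *.
have e10 : 0 <= e1 by rewrite invr_ge0 exprn_ge0.
have {}bX := bX isT; have {}bM := bM isT.
apply: (le_trans (ler_normD _ _)); have := ler_normB (U - k) (W - k).
have h1 : `|c| / ln 2 * M^-1 <= `|c| / ln 2 * (4 * e) by rewrite ler_wpM2l.
have h2 : (3 * E + 8 + 4 * (`|c| / ln 2)) * e <= (3 * E + 8 + 4 * (`|c| / ln 2)) * (4 * e1).
  by rewrite ler_wpM2l.
have h3 : 0 <= (1 + `|c|) * e1 by rewrite mulr_ge0// addr_ge0.
rewrite -/X in bX; rewrite -/M in bM.
move: bX bM bS h1 h2 h3 MV XV.
move: `|U - k| `|W - k| (`|U - k - _|) (`|_ - k * _|) (`|c| / ln 2) X^-1 M^-1 => u w' uw S cl Xi Mi.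
move=> *; lra.
Qed.

(** Both densities are compared with [c / (j+1)]: [A] with absolutely summable error, the primes by
    Mertens' second theorem. *)
Lemma density_defect_cvg : cvgn (series (fun j =>
  \sum_((2 ^ j)%N <= n < (2 ^ j.+1)%N | A n) n%:R^-1 - c * prec R j)).
Proof.
have [C C0 HC] := bucket_density.
rewrite (_ : (fun j => _) = fun j =>
  (\sum_((2 ^ j)%N <= n < (2 ^ j.+1)%N | A n) n%:R^-1 - c / j.+1%:R) -
   c * (prec R j - j.+1%:R^-1)); last by apply/funext => j; ring.
apply/cvg_ex; eexists; apply: cvg_series_sub; last first.
  by apply: cvg_seriesZ; exact: mertens_second.
apply: (@dominated_series_cvg _ _ (fun j => C * j.+1%:R ^- 2)) => //.
by apply: is_cvg_seriesZ; exact: sum_inv_sqr_cvg.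
Qed.

Lemma density_tail_cvg : A 0%N = false ->
  cvgn (series (fun n => if A n then n%:R^-1 / (trunc_log 2 n).+1%:R else 0 : R)).
Proof.
move=> A0; have [C C0 HC] := bucket_density.
apply: (@dyadic_series_cvg _ _ (fun j => (`|c| + C) * j.+1%:R ^- 2)).
- by rewrite A0.
- by move=> n; case: ifP => // _; rewrite divr_ge0.
- move=> j; have jR : 0 < j.+1%:R :> R by rewrite ltr0n.
  set al := \sum_((2 ^ j)%N <= n < (2 ^ j.+1)%N | A n) n%:R^-1 : R.
  have h : al <= (`|c| + C) * j.+1%:R^-1.
    have := HC j; rewrite -/al ler_norml => /andP[_]; rewrite lerBlDr => /le_trans; apply.
    rewrite mulrDl addrC; apply: lerD; first by rewrite ler_wpM2r ?invr_ge0// ler_norm.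
    rewrite ler_wpM2l// expr2 invfM ler_piMl ?invr_ge0//.
    by rewrite invf_le1// ler1n.
  apply: (@le_trans _ _ (al / j.+1%:R)); last first.
    by apply: le_trans (ler_wpM2r _ h) _; rewrite ?invr_ge0// expr2 invfM mulrA.
  rewrite /al mulr_suml [leRHS]big_mkcond [leLHS]big_nat_cond [leRHS]big_nat_cond.
  apply: ler_sum => n /andP[/trunc_log_bucket e _].
  by rewrite e; case: ifP.
- by apply: is_cvg_seriesZ; exact: sum_inv_sqr_cvg.
Qed.

End LogDensity.

(** * Sums over sets of integers, and positivity of Euler's constant *)

Section Summability.
Variable R : realType.
Implicit Types (D : set nat) (f : nat -> R).

Lemma sum_over_cvg D f l :
  series (fun n => if n \in D then f n else 0) @ \oo --> l -> sum_over D f = l.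
Proof.
move=> cf; apply: (cvg_lim (@Rhausdorff R)); apply: cvg_trans cf.
by apply: near_eq_cvg; apply: nearW => n /=; rewrite /series/= -big_mkcond.
Qed.

Lemma esum_series D f : (forall n, 0 <= f n) ->
  (\esum_(n in D) (f n)%:E = \sum_(n <oo) (if n \in D then f n else 0)%:E)%E.
Proof.
move=> f0; have {1}-> : D = [set n | n \in D] by apply/seteqP; split => n /=; rewrite in_setE.
rewrite -nneseries_esum => [|n _]; last by rewrite lee_fin.
by rewrite eseries_mkcond; apply: eq_eseriesr => n _; case: ifP.
Qed.

Lemma abs_summableP D f :
  cvgn (series (fun n => `|if n \in D then f n else 0|)) -> abs_summable D f.
Proof.
move=> cf; rewrite /abs_summable /summable.
have -> : (\esum_(x in D) `|(EFin \o f) x| = \esum_(x in D) (`|f x|)%:E)%E by [].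
rewrite esum_series//; apply: (@le_lt_trans _ _ (limn (series (fun n =>
    `|if n \in D then f n else 0|)))%:E); last exact: ltry.
apply: lime_le; first by apply: is_cvg_nneseries => n _ _; rewrite lee_fin; case: ifP.
apply: nearW => N; rewrite sumEFin lee_fin.
have -> : \sum_(0 <= n < N) (if n \in D then `|f n| else 0) =
    series (fun n => `|if n \in D then f n else 0|) N.
  by apply: eq_bigr => n _; case: ifP => // _; rewrite normr0.
exact: series_le_lim.
Qed.

Lemma series_esum_cvg D f : (forall n, 0 <= f n) ->
  (\esum_(n in D) (f n)%:E < +oo)%E ->
  cvgn (series (fun n => if n \in D then f n else 0)).
Proof.
move=> f0; rewrite esum_series//; apply: nnseries_is_cvg => n.
by case: ifP.
Qed.

(** Makes [1 - exp (- gamma)] invertible. With one harmonic term fewer the defining sequence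
    increases, from [1 - ln 2] at its second place. *)
Lemma euler_gamma_gt0 : 0 < euler_gamma R.
Proof.
have l1 : ln 2 < 1 :> R.
  rewrite -[X in _ < X]expRK ltr_ln ?posrE ?expR_gt0//.
  by rewrite (_ : 2 = 1 + 1)// expR_gt1Dx.
apply: (@lt_le_trans _ _ (1 - ln 2)); first by rewrite subr_gt0.
rewrite -(cvg_lim (@Rhausdorff R) (@euler_gamma_cvg R)).
apply: limr_ge; first by apply/cvg_ex; eexists; exact: euler_gamma_cvg.
have h k : 1 - ln 2 <= \sum_(1 <= i < k.+2) i%:R^-1 - ln k.+2%:R :> R.
  elim: k => [|k IH]; first by rewrite big_nat1 invr1.
  rewrite big_nat_recr//=; apply: (le_trans IH).
  have /andP[_ h] := @lnS_sub R k.+2 (ltn0Sn _).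
  by rewrite -[leRHS]addrA lerD2l lerBrDr [leLHS]addrC.
exists 1 => // -[//|[_|k _]] /=.
  by rewrite big_nat1 ln1 invr1 subr0 gerBl ln_nat_ge0.
apply: (le_trans (h k)); rewrite [X in _ <= X - _]big_nat_recr//=.
by rewrite lerD2r lerDl.
Qed.

End Summability.

(** * The sum attached to a single starter *)

Section StarterConstants.
Variables (R : realType) (theta : nat -> R).
Hypothesis theta_ge : forall n : nat, (1 <= n)%N -> Num.max 2 n%:R <= theta n.
Hypothesis theta_le : exists K : R, forall n : nat, (1 <= n)%N -> theta n <= K * n%:R.

Let N n := (Num.truncn (theta n)).+1.

Lemma theta_ge0 n : (0 < n)%N -> 0 <= theta n.
Proof. by move=> n0; apply: le_trans (theta_ge n0); rewrite le_max ler0n. Qed.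

Lemma theta_bound_gt n : (0 < n)%N -> (n < N n)%N.
Proof.
move=> n0; rewrite /N ltnS truncn_ge_nat ?theta_ge0//.
by apply: le_trans (theta_ge n0); rewrite le_max lexx orbT.
Qed.

(** [theta n << n] in dyadic form: [q] is chosen so that [K + 1 <= q <= 2^q]. *)
Lemma theta_bound_le : exists q, forall n, (0 < n)%N ->
  (N n <= 2 ^ ((trunc_log 2 n).+1 + q))%N.
Proof.
have [K HK] := theta_le; pose q := (Num.truncn K).+2; exists q => n n0.
have h1 : (N n)%:R <= (2 ^ q)%:R * n%:R :> R.
  rewrite /N -natr1; apply: (@le_trans _ _ (K * n%:R + n%:R)).
    apply: lerD; last by rewrite ler1n.
    by apply: le_trans (HK n n0); rewrite truncn_le theta_ge0.
  have -> : K * n%:R + n%:R = (K + 1) * n%:R by ring.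
  rewrite ler_wpM2r// (@le_trans _ _ q%:R)//; last by rewrite ler_nat ltnW// ltn_expl.
  by rewrite -[q%:R]natr1 lerD2r ltW// truncnS_gt.
rewrite -natrM ler_nat in h1; apply: (leq_trans h1).
by rewrite mulnC expnD leq_mul2r ltnW ?orbT// trunc_log_ltn.
Qed.

Lemma starter_setP m n : (0 < m)%N ->
  starter_set theta m n <-> exists2 s, chain N m s & n = (m * \prod_(p <- s) p)%N.
Proof.
move=> m0.
have pos s i : all prime s -> (0 < m * \prod_(p <- take i s) p)%N.
  move=> /allP ps; rewrite muln_gt0 m0 big_seq.
  by apply: prodn_cond_gt0 => p /mem_take/ps/prime_gt0.
split=> [[s [ps pths H ->]]|[s [ps pths H] ->]]; exists s => //; split => //.
  by move=> i si; rewrite /N ltnS truncn_ge_nat ?H// theta_ge0// pos.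
by move=> i si; rewrite -truncn_ge_nat ?theta_ge0 ?pos// -ltnS; exact: H.
Qed.

Lemma starter_set_geq m n : (0 < m)%N -> starter_set theta m n -> (m <= n)%N.
Proof.
move=> m0 /(starter_setP _ m0)[s cs ->]; rewrite leq_pmulr//.
by have := chain_prod_gt0 m0 cs; rewrite muln_gt0 => /andP[].
Qed.

(** At [s = 0] the keeping probability [w / (1 + w)] is [1 / (p + 1)], the weight of [ln p] in the
    formula. *)
Lemma starter_termE m n : starter_term theta m n = T 0 (max_pdiv m) m n (N n).
Proof.
rewrite /starter_term /T w0; congr (_ * (_ - _) * _).
  rewrite /B; apply: eq_bigr => p /andP[pp _]; rewrite w0.
  have p0 : 0 < p%:R :> R by rewrite ltr0n prime_gt0.
  by field; rewrite !gt_eqF//= addr_gt0.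
by rewrite /V; apply: eq_bigr => p _; rewrite w0.
Qed.

Variables (c : nat -> R).
Hypothesis c_def : starter_constants theta c.

Lemma counting_function_nat (A : set nat) n :
  counting_function A n%:R = count R (fun k => k \in A) n.
Proof. by rewrite /counting_function natrK. Qed.

Lemma starter_term_sum m : (0 < m)%N ->
  cvgn (series (fun n => `|if n \in starter_set theta m then starter_term theta m n else 0|)) /\
  series (fun n => if n \in starter_set theta m then starter_term theta m n else 0) @ \oo -->
    c m * (zeta 1 * (1 - expR (- euler_gamma R))).
Proof.
move=> m0; have [K HK] := c_def; have [q Hq] := theta_bound_le.
pose A := fun n => n \in starter_set theta m.
have A0 : A 0%N = false.
  by apply/negP; rewrite /A in_setE => /(starter_set_geq m0); rewrite leqNgt m0.
pose K' := `|K| * ln (2 * m)%:R ^+ 6 / m%:R.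
have K'0 : 0 <= K' by rewrite !mulr_ge0 ?exprn_ge0 ?ln_nat_ge0.
have cA n : (2 <= n)%N ->
    `|count R A n - c m * (n%:R / ln n%:R)| <= K' * (n%:R / ln n%:R ^+ 2).
  move=> n2; rewrite -counting_function_nat.
  have n2R : 2 <= n%:R :> R by rewrite ler_nat.
  apply: (le_trans (HK m n%:R m0 n2R)).
  have -> : K' * (n%:R / ln n%:R ^+ 2) =
    `|K| * (ln (2 * m)%:R ^+ 6 * n%:R / (m%:R * ln n%:R ^+ 2)).
    rewrite /K' [(m%:R * _)^-1]invfM.
    by move: (ln _ ^+ 2)^-1 (m%:R^-1) (ln _ ^+ 6) => a b d; ring.
  rewrite ler_wpM2r ?ler_norm// divr_ge0 ?mulr_ge0 ?exprn_ge0 ?ln_nat_ge0//.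
have E : (fun n => if n \in starter_set theta m then starter_term theta m n else 0) =
    fun n => if A n then T 0 (max_pdiv m) m n (N n) else 0.
  by apply/funext => n; rewrite /A; case: ifP => // _; rewrite starter_termE.
have E' : (fun n => `|if n \in starter_set theta m then starter_term theta m n else 0|) =
    fun n => `|if A n then T 0 (max_pdiv m) m n (N n) else 0|.
  by apply/funext => n; rewrite (congr1 (@^~ n) E).
rewrite E' E; apply: (@starter_limit R A N (max_pdiv m) m q (c m) A0 m0).
- move=> n An; have n0 : (0 < n)%N by case: n An => //; rewrite A0.
  by rewrite ltnW ?theta_bound_gt// Hq.
- exact: density_defect_cvg K'0 cA.
- exact: density_tail_cvg K'0 cA A0.
- move=> i; apply: (@sum_T_zero R N m q m0 theta_bound_gt Hq A (sg R i) (sg_gt0 R i)).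
  move=> n; rewrite /A; apply: (iffP idP); rewrite in_setE => /(starter_setP n m0)//.
Qed.

End StarterConstants.

(** * Summation over the set of starters *)

Section Union.
Variables (R : realType) (theta : nat -> R).
Hypothesis theta_ge : forall n : nat, (1 <= n)%N -> Num.max 2 n%:R <= theta n.
Variables (c : nat -> R) (S : set nat).
Hypothesis c_def : starter_constants theta c.
Hypothesis S_pos : forall m : nat, S m -> (1 <= m)%N.
Hypothesis S_disj : forall m1 m2 : nat, S m1 -> S m2 -> m1 <> m2 ->
  starter_set theta m1 `&` starter_set theta m2 = set0.
Hypothesis S_sum :
  (\esum_(m in S) (m%:R^-1 * ln (m%:R : R) ^+ 6)%:E < +oo)%E.

Let g m : R := ln (2 * m)%:R ^+ 6 / m%:R.

Let g_ge0 m : 0 <= g m.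
Proof. by rewrite divr_ge0 ?exprn_ge0 ?ln_nat_ge0. Qed.

Lemma ln_double_le m : (2 <= m)%N -> ln (2 * m)%:R <= 2 * ln m%:R :> R.
Proof.
move=> m2; have m0 : 0 < m%:R :> R by rewrite ltr0n ltnW.
rewrite natrM lnM ?posrE ?ltr0n ?(ltnW m2)//.
have -> : 2 * ln m%:R = ln m%:R + ln m%:R :> R by ring.
by rewrite lerD2r ler_ln_nat.
Qed.

(** [ln (2m) <= 2 ln m] for [m >= 2] gives the factor [64 = 2^6]. It fails at [m = 1], where
    [ln 1 = 0]; there the second series contributes exactly [(ln 2)^6]. *)
Lemma starter_weight_cvg : cvgn (series (fun m => if m \in S then g m else 0)).
Proof.
have c1 := series_esum_cvg (fun m => _) S_sum.
have {}c1 : cvgn (series (fun m => if m \in S then m%:R^-1 * ln (m%:R : R) ^+ 6 else 0)).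
  by apply: c1 => m; rewrite mulr_ge0 ?exprn_ge0 ?ln_nat_ge0.
have c2 : cvgn (series (fun m => 64 * (if m \in S then m%:R^-1 * ln (m%:R : R) ^+ 6 else 0) +
    4 * ln 2 ^+ 6 * m.+1%:R ^- 2)).
  apply/cvg_ex; eexists; apply: cvg_series_add; apply: cvg_seriesZ; first exact: c1.
  exact: sum_inv_sqr_cvg.
apply: dominated_series_cvg c2 => m; case: ifP => mS; last first.
  by rewrite normr0 mulr0 add0r !mulr_ge0 ?exprn_ge0 ?invr_ge0 ?exprn_ge0 ?(ln_nat_ge0 _ 2).
rewrite ger0_norm ?g_ge0//.
have m1 : (1 <= m)%N by apply: S_pos; rewrite in_setE in mS.
case: (ltngtP m 1%N) m1 => // [m2|->] _; last first.
  by rewrite /g muln1 ln1 expr0n !mulr0 add0r divr1; lra.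
apply: (@le_trans _ _ (64 * (m%:R^-1 * ln m%:R ^+ 6))); last first.
  by rewrite lerDl !mulr_ge0 ?exprn_ge0 ?invr_ge0 ?exprn_ge0 ?(ln_nat_ge0 _ 2).
have -> : 64 * (m%:R^-1 * ln m%:R ^+ 6) = (2 * ln m%:R) ^+ 6 / m%:R :> R.
  by move: (m%:R^-1) (ln m%:R) => a b; ring.
by rewrite ler_wpM2r// lerXn2r ?nnegrE ?mulr_ge0 ?ln_nat_ge0 ?ln_double_le.
Qed.

Lemma counting_function_two m : (0 < m)%N ->
  counting_function (starter_set theta m) 2 <= 4 / m%:R :> R.
Proof.
move=> m0; have m0R : 0 < m%:R :> R by rewrite ltr0n.
rewrite -[2]/(2%:R) counting_function_nat /count.
have [m3|m2] := ltnP 2 m.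
  rewrite big_nat_cond big1 ?divr_ge0// => n /andP[/andP[_ n2]].
  by rewrite in_setE => /(starter_set_geq theta_ge m0); rewrite ltnS in n2; lia.
rewrite ler_pdivlMr// -natrM ler_nat.
apply: (@leq_trans (2 * 2)); rewrite // leq_mul//.
by rewrite big_mkcond /index_iota/= !big_cons big_nil; case: ifP => _; case: ifP.
Qed.

(** The asymptotics at [x = 2] bounds [c m] by the count up to 2 plus the error term, both of order
    [log^6(2m) / m]. *)
Lemma starter_constant_le : exists2 C, 0 <= C & forall m, (0 < m)%N -> `|c m| <= C * g m.
Proof.
have [K HK] := c_def.
have l0 : 0 < ln 2 :> R by rewrite ln_gt0// ltr1n.
exists (4 / ln 2 ^+ 6 * ln 2 + `|K| / ln 2).
  by rewrite addr_ge0 ?mulr_ge0 ?invr_ge0 ?exprn_ge0// ltW.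
move=> m m0; have m0R : 0 < m%:R :> R by rewrite ltr0n.
have := HK m 2 m0 (lexx _); have := counting_function_two m0.
set a := counting_function _ _ => a4 h.
have a4' : a <= 4 / ln 2 ^+ 6 * g m.
  apply: (le_trans a4); rewrite /g.
  have -> : 4 / ln 2 ^+ 6 * (ln (2 * m)%:R ^+ 6 / m%:R) =
    4 / m%:R * (ln (2 * m)%:R ^+ 6 / ln 2 ^+ 6) :> R.
    by rewrite mulrACA [RHS]mulrACA [m%:R^-1 * _]mulrC.
  rewrite ler_peMr ?divr_ge0// ler_pdivlMr ?exprn_gt0// mul1r.
  apply: lerXn2r; rewrite ?nnegrE ?ln_nat_ge0 ?(ltW l0)//.
  by apply: (@ler_ln_nat _ 2); rewrite // leq_pmulr.
have h2 : `|c m * (2 / ln 2)| <= a + `|K| * (g m * 2 / ln 2 ^+ 2).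
  have -> : c m * (2 / ln 2) = a - (a - c m * (2 / ln 2)) by ring.
  apply: (le_trans (ler_normB _ _)); apply: lerD; first by rewrite ger0_norm.
  apply: (le_trans h).
  have -> : ln (2 * m)%:R ^+ 6 * 2 / (m%:R * ln 2 ^+ 2) = g m * 2 / ln 2 ^+ 2 :> R.
    by rewrite /g invfM; move: (ln _ ^+ 2)^-1 (m%:R^-1) (ln _ ^+ 6) => x y d; ring.
  apply: ler_wpM2r (ler_norm _); apply: divr_ge0; last by rewrite exprn_ge0// ltW.
    by rewrite mulr_ge0 ?g_ge0.
have l20 : 0 < 2 / ln 2 :> R by rewrite divr_gt0.
rewrite -(ler_pM2r l20); move: h2; rewrite normrM [`|2 / _|]gtr0_norm// => h2.
apply: (le_trans h2); apply: (le_trans (lerD a4' (lexx _))).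
have -> : (4 / ln 2 ^+ 6 * ln 2 + `|K| / ln 2) * g m * (2 / ln 2) =
    4 / ln 2 ^+ 6 * g m * 2 + `|K| * (g m * 2 / ln 2 ^+ 2).
  by move: l0 (g m) (`|K|); move: (ln 2) => l l0 x y; field; rewrite gt_eqF.
rewrite lerD2r ler_peMr ?ler1n// mulr_ge0 ?g_ge0// divr_ge0// exprn_ge0//; exact: ltW.
Qed.

Lemma counting_function_union x M : (Num.truncn x < M)%N ->
  counting_function (\bigcup_(m in S) starter_set theta m) x =
  \sum_(0 <= m < M) (if m \in S then counting_function (starter_set theta m) x else 0) :> R.
Proof.
move=> xM; rewrite -big_mkcond /counting_function -natr_sum; congr (_%:R).
rewrite [RHS](eq_bigr (fun m =>
    (\sum_(1 <= n < (Num.truncn x).+1) (n \in starter_set theta m))%N)); last first.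
  by move=> m _; rewrite big_mkcond; apply: eq_bigr => n _; case: ifP.
rewrite [RHS]exchange_big/= big_mkcond big_nat_cond [RHS]big_nat_cond.
apply: eq_bigr => n /andP[/andP[n1 nx] _].
case: ifP => [|/negP] nA; last first.
  rewrite big1// => m mS; case: (boolP (n \in _)) => // nm; case: nA.
  by rewrite in_setE; exists m; rewrite -in_setE.
move: nA; rewrite in_setE => -[m mS nm].
rewrite big_mkcond (eq_bigr (fun k => if k == m then 1%N else 0%N)); last first.
  move=> k _; case: eqP => [->|km]; first by rewrite !mem_set.
  case: ifP => // kS; case: (boolP (n \in _)) => // nk; exfalso.
  rewrite in_setE in kS; rewrite in_setE in nk.
  by have /seteqP[/(_ n)/(_ (conj nk nm))] := S_disj kS mS km.
rewrite -big_mkcond/= big_nat1_eq ifT//=.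
have := starter_set_geq theta_ge (S_pos mS) nm; lia.
Qed.

Lemma counting_function_union_approx (C : R) :
  series (fun m => if m \in S then c m else 0) @ \oo --> C ->
  exists K : R, forall x : R, 2 <= x ->
    `|counting_function (\bigcup_(m in S) starter_set theta m) x - C * (x / ln x)| <=
    K * (x / ln x ^+ 2).
Proof.
move=> cC; have [K HK] := c_def.
exists (`|K| * limn (series (fun m => if m \in S then g m else 0))) => x x2.
have x0 : 0 < x by apply: lt_le_trans x2.
have lx0 : 0 < ln x by rewrite ln_gt0// (lt_le_trans _ x2)// ltr1n.
have xl0 : 0 <= x / ln x ^+ 2 by rewrite divr_ge0 ?exprn_ge0// ltW.
set a := counting_function _ _.
have lim : `|a - series (fun m => if m \in S then c m else 0) M * (x / ln x)| @[M --> \oo] -->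
    `|a - C * (x / ln x)|.
  apply: cvg_norm; apply: cvgB; first exact: cvg_cst.
  by apply: cvgM => //; exact: cvg_cst.
rewrite -(cvg_lim (@Rhausdorff R) lim); apply: limr_le; first by apply/cvg_ex; eexists; exact: lim.
(* Elements of a starter set are at least the starter, so starters beyond [x] do not affect the
   count. *)
exists (Num.truncn x).+1 => // M /= xM.
rewrite /a (counting_function_union xM) /series/= mulr_suml -sumrB.
apply: (le_trans (ler_norm_sum _ _ _)).
apply: (@le_trans _ _ (\sum_(0 <= m < M)
    `|K| * (x / ln x ^+ 2) * (if m \in S then g m else 0))).
  apply: ler_sum => m _; case: ifP => mS; last by rewrite mul0r subr0 normr0 mulr0.
  have m1 : (1 <= m)%N by apply: S_pos; rewrite in_setE in mS.
  apply: (le_trans (HK m x m1 x2)).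
  have -> : ln (2 * m)%:R ^+ 6 * x / (m%:R * ln x ^+ 2) = x / ln x ^+ 2 * g m.
    by rewrite /g invfM; move: (ln x ^+ 2)^-1 (m%:R^-1) (ln _ ^+ 6) => u y d; ring.
  by rewrite -[leRHS]mulrA; apply: ler_wpM2r (ler_norm _); rewrite mulr_ge0// g_ge0.
rewrite -mulr_sumr [leRHS]mulrAC; apply: ler_wpM2l; first by rewrite mulr_ge0.
apply: (@series_le_lim _ (fun m => if m \in S then g m else 0)).
  by move=> m; case: ifP => // _; exact: g_ge0.
exact: starter_weight_cvg.
Qed.

Lemma starter_constants_cvg :
  cvgn (series (fun m => `|if m \in S then c m else 0|)).
Proof.
have [C C0 HC] := starter_constant_le.
have cs : cvgn (series (fun m => C * (if m \in S then g m else 0))).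
  by apply/cvg_ex; eexists; apply: cvg_seriesZ; exact: starter_weight_cvg.
apply: dominated_series_cvg cs => m; rewrite normr_id; case: ifP => mS.
  by apply: HC; apply: S_pos; rewrite in_setE in mS.
by rewrite normr0 mulr0.
Qed.

End Union.

(** * The formula for the constant of the union *)

Theorem theorem1p2 (R : realType) (theta : nat -> R)
  (theta_ge : forall n : nat, (1 <= n)%N -> Num.max 2 n%:R <= theta n)
  (theta_le : exists K : R, forall n : nat, (1 <= n)%N -> theta n <= K * n%:R)
  (c : nat -> R) (c_def : starter_constants theta c)
  (S : set nat) (S_pos : forall m : nat, S m -> (1 <= m)%N)
  (S_disj : forall m1 m2 : nat, S m1 -> S m2 -> m1 <> m2 ->
     starter_set theta m1 `&` starter_set theta m2 = set0)
  (S_sum : (\esum_(m in S) (m%:R^-1 * ln (m%:R : R) ^+ 6)%:E < +oo)%E) :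
  let A := \bigcup_(m in S) starter_set theta m in
  (exists K : R, forall x : R, 2 <= x ->
     counting_function A x <= K * (x / ln x)) ->
  let C := sum_over S c in
  [/\ abs_summable S c,
      exists K : R, forall x : R, 2 <= x ->
        `| counting_function A x - C * (x / ln x) | <= K * (x / ln x ^+ 2),
      forall m : nat, S m ->
        abs_summable (starter_set theta m) (starter_term theta m),
      abs_summable S
        (fun m => sum_over (starter_set theta m) (starter_term theta m))
    & C = 6 / pi ^+ 2 / (1 - expR (- euler_gamma R)) *
          sum_over S
            (fun m => sum_over (starter_set theta m) (starter_term theta m))].
Proof.
move=> A _ C.
have cc := starter_constants_cvg theta_ge c_def S_pos S_sum.
(* The ratio of each inner sum to [c m]; its inverse is the prefactor of the formula. *)
pose D : R := zeta 1 * (1 - expR (- euler_gamma R)).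
have sE m : S m -> sum_over (starter_set theta m) (starter_term theta m) = c m * D.
  move=> /S_pos m0; apply: sum_over_cvg.
  by have [] := starter_term_sum theta_ge theta_le c_def m0.
have sE' : (fun m => if m \in S then sum_over (starter_set theta m) (starter_term theta m) else 0) =
    fun m => D * (if m \in S then c m else 0).
  apply/funext => m; case: ifP => [|_]; last by rewrite mulr0.
  by rewrite in_setE => mS; rewrite sE// mulrC.
have cC : series (fun m => if m \in S then c m else 0) @ \oo --> C.
  have c1 : cvgn (series (fun m => if m \in S then c m else 0)) by exact: normed_cvg.
  by rewrite /C (sum_over_cvg c1).
split.
- exact: abs_summableP.
- exact: (counting_function_union_approx theta_ge c_def S_pos S_disj S_sum cC).
- move=> m /S_pos m0; apply: abs_summableP.
  by have [] := starter_term_sum theta_ge theta_le c_def m0.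
- apply: abs_summableP.
  rewrite (_ : (fun m => `|_|) = fun m => `|D| * `|if m \in S then c m else 0|).
    by apply/cvg_ex; eexists; apply: cvg_seriesZ; exact: cc.
  by apply/funext => m; rewrite -normrM (congr1 (@^~ m) sE').
- have c2 := cvg_seriesZ (k := D) cC; rewrite -sE' in c2.
  rewrite (sum_over_cvg c2) /D basel.
  have g1 : 1 - expR (- euler_gamma R) != 0.
    by rewrite subr_eq0 eq_sym lt_eqF// expR_lt1 oppr_lt0 euler_gamma_gt0.
  have p0 : pi != 0 :> R by rewrite gt_eqF// pi_gt0.
  by move: g1 p0; move: (1 - _) (pi : R) => a b a0 b0; field; rewrite a0 b0.
Qed.
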